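(* Let $\Bbbk$ be a commutative ring, $z,t\in\Bbbk^\times$, $k\in\mathbb Z$. (1) The two presentations of $\mathcal{H}eis_k(z,t)$ called ''Definition I'' and ''Definition II'' in the context are presentations of the same strict $\Bbbk$-linear monoidal category, with all of the named morphisms introduced in the two definitions (that is, $x,y,\tau^{\pm1},c,d,\sigma_\pm,\delta_\pm,L_\pm,\eta^\diamond_a,\eta^\heartsuit_a,\varepsilon^\diamond_a,\varepsilon^\heartsuit_a,c',d',\mathsf a_n^\pm,\mathsf b_n^\pm$) being the same. (2) There is a unique isomorphism of $\Bbbk$-linear monoidal categories $\Omega_k:\mathcal{H}eis_k(z,t)\to\mathcal{H}eis_{-k}(z,t^{-1})^{\mathrm{op}}$ (exchanging the objects $\uparrow$ and $\downarrow$) sending $x\mapsto y$, $\tau\mapsto-\delta_-$, $d\mapsto c$, $c\mapsto d$. The effect of $\Omega_k$ on the other morphisms is: $y\mapsto x$; $\tau^{-1}\mapsto-\delta_+$; $\sigma_+\mapsto-\sigma_-$; $\sigma_-\mapsto-\sigma_+$; $\delta_+\mapsto-\tau^{-1}$; $\delta_-\mapsto-\tau$; $L_+\mapsto-L_-$; $L_-\mapsto-L_+$; $\eta^\diamond_a\mapsto\varepsilon^\diamond_a$; $\varepsilon^\diamond_a\mapsto\eta^\diamond_a$; $\eta^\heartsuit_a\mapsto\varepsilon^\heartsuit_a$; $\varepsilon^\heartsuit_a\mapsto\eta^\heartsuit_a$; $d'\mapsto-c'$; $c'\mapsto-d'$; $\mathsf a_n^\pm\mapsto-\mathsf b_n^\pm$;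 $\mathsf b_n^\pm\mapsto-\mathsf a_n^\pm$.
   Context: In a strict monoidal category, $f\circ g$ means $f$ after $g$, and $\mathbf 1$ is the unit object. The superscript $\mathrm{op}$ reverses composition of morphisms but not the tensor product. **Common part.** Start with generating objects $\uparrow,\downarrow$; an invertible morphism $x:\uparrow\to\uparrow$ and $\tau:\uparrow\otimes\uparrow\to\uparrow\otimes\uparrow$ with $\tau\circ(1_\uparrow\otimes x)\circ\tau=x\otimes 1_\uparrow$, $\tau\circ\tau=z\tau+1_{\uparrow\otimes\uparrow}$ (so $\tau$ is invertible), $(\tau\otimes1_\uparrow)\circ(1_\uparrow\otimes\tau)\circ(\tau\otimes1_\uparrow)=(1_\uparrow\otimes\tau)\circ(\tau\otimes1_\uparrow)\circ(1_\uparrow\otimes\tau)$; and $c:\mathbf 1\to\downarrow\otimes\uparrow$, $d:\uparrow\otimes\downarrow\to\mathbf 1$ with $(d\otimes1_\uparrow)\circ(1_\uparrow\otimes c)=1_\uparrow$, $(1_\downarrow\otimes d)\circ(c\otimes1_\downarrow)=1_\downarrow$. Set $\sigma_\pm:=(1_\downarrow\otimes1_\uparrow\otimes d)\circ(1_\downarrow\otimes\tau^{\pm1}\otimes1_\downarrow)\circ(c\otimes1_\uparrow\otimes1_\downarrow):\uparrow\otimes\downarrow\to\downarrow\otimes\uparrow$, $\delta_\pm:=(1_\downarrow\otimes1_\downarrow\otimes d)\circ(1_\downarrow\otimes\sigma_\pm\otimes1_\downarrow)\circ(c\otimes1_\downarrow\otimes1_\downarrow):\downarrow\otimes\downarrow\to\downarrow\otimes\downarrow$,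 $y:=(1_\downarrow\otimes d)\circ(1_\downarrow\otimes x\otimes1_\downarrow)\circ(c\otimes1_\downarrow):\downarrow\to\downarrow$ (invertible). For a sign $\pm$ let $M_\pm$ denote, if $k\ge0$, the column matrix with entries $\sigma_\pm,\ d\circ(x^{a}\otimes1_\downarrow)$ $(a=0,\dots,k-1)$, a morphism $\uparrow\otimes\downarrow\to(\downarrow\otimes\uparrow)\oplus\mathbf 1^{\oplus k}$ in the additive envelope; if $k<0$, the row matrix with entries $\sigma_\pm,\ (1_\downarrow\otimes x^{a})\circ c$ $(a=0,\dots,-k-1)$, a morphism $(\uparrow\otimes\downarrow)\oplus\mathbf 1^{\oplus(-k)}\to\downarrow\otimes\uparrow$. Below, $L_\pm:\downarrow\otimes\uparrow\to\uparrow\otimes\downarrow$; $\eta_a^\diamond,\eta_a^\heartsuit:\mathbf 1\to\uparrow\otimes\downarrow$ are defined for $0\le a<k$ (when $k>0$); $\varepsilon_a^\diamond,\varepsilon_a^\heartsuit:\downarrow\otimes\uparrow\to\mathbf 1$ are defined for $0\le a<-k$ (when $k<0$); $c':\mathbf 1\to\uparrow\otimes\downarrow$ and $d':\downarrow\otimes\uparrow\to\mathbf 1$. **Definition I.** Adjoin to the common part the entries of a two-sided inverse to $M_+$, denoted $[L_-,\eta^\diamond_0,\dots,\eta^\diamond_{k-1}]$ (row) if $k\ge0$ and $[L_+,\varepsilon^\heartsuit_0,\dots,\varepsilon^\heartsuit_{-k-1}]^T$ (column) if $k<0$. Define $c':=-t^{-1}z^{-1}(x^{-1}\otimes1_\downarrow)\circ\eta^\diamond_{k-1}$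 if $k>0$, $t\,L_-\circ c$ if $k=0$, $t^{-1}L_+\circ(1_\downarrow\otimes x^{-k})\circ c$ if $k<0$; $d':=t\,d\circ(x^k\otimes1_\downarrow)\circ L_-$ if $k\ge0$, $-t^{-1}z^{-1}\varepsilon^\heartsuit_0$ if $k<0$. Impose $d\circ c'=tz^{-1}1_{\mathbf 1}$ if $k>0$; $d\circ c'=(tz^{-1}-t^{-1}z^{-1})1_{\mathbf 1}$ if $k=0$; $d'\circ(1_\downarrow\otimes x^{-k})\circ c=tz^{-1}1_{\mathbf 1}$ if $k<0$. The remaining one of $L_+,L_-$ is defined by the leftward skein relation $L_+-L_-=z\,c'\circ d'$. Set $\eta^\heartsuit_0:=\eta^\diamond_0+z\,L_-\circ c$, $\eta^\heartsuit_a:=\eta^\diamond_a$ $(0<a<k)$ if $k>0$; $\varepsilon^\diamond_0:=\varepsilon^\heartsuit_0+z\,d\circ L_+$, $\varepsilon^\diamond_a:=\varepsilon^\heartsuit_a$ $(0<a<-k)$ if $k<0$. **Definition II.** Adjoin to the common part the entries of a two-sided inverse to $M_-$, denoted $[L_-,\eta^\heartsuit_0,\dots,\eta^\heartsuit_{k-1}]$ (row) if $k>0$ and $[L_+,\varepsilon^\diamond_0,\dots,\varepsilon^\diamond_{-k-1}]^T$ (column) if $k\le0$. Define $c':=tz^{-1}\eta^\heartsuit_0$ if $k>0$, $t^{-1}L_+\circ(1_\downarrow\otimes x^{-k})\circ c$ if $k\le0$; $d':=t\,d\circ(x^k\otimes1_\downarrow)\circ L_-$ if $k>0$, $t^{-1}d\circ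 L_+$ if $k=0$, $tz^{-1}\varepsilon^\diamond_{-k-1}\circ(y^{-1}\otimes1_\uparrow)$ if $k<0$. Impose $d\circ(x^k\otimes1_\downarrow)\circ c'=-t^{-1}z^{-1}1_{\mathbf 1}$ if $k>0$; $d'\circ c=(tz^{-1}-t^{-1}z^{-1})1_{\mathbf 1}$ if $k=0$; $d'\circ c=-t^{-1}z^{-1}1_{\mathbf 1}$ if $k<0$. The remaining one of $L_\pm$ is defined by $L_+-L_-=z\,c'\circ d'$. Set $\eta^\diamond_0:=\eta^\heartsuit_0-z\,L_-\circ c$, $\eta^\diamond_a:=\eta^\heartsuit_a$ $(0<a<k)$ if $k>0$; $\varepsilon^\heartsuit_0:=\varepsilon^\diamond_0-z\,d\circ L_+$, $\varepsilon^\heartsuit_a:=\varepsilon^\diamond_a$ $(0<a<-k)$ if $k<0$. **Bubbles (both definitions).** $\mathsf a_n:=d'\circ(1_\downarrow\otimes x^n)\circ c$, $\mathsf b_n:=d\circ(x^n\otimes1_\downarrow)\circ c'$ for $n\in\mathbb Z$. For $n>0$: $\mathsf a_n^+:=\mathsf a_n$, $\mathsf b_n^+:=\mathsf b_n$. For $n\le0$: $\mathsf a_n^+:=-tz^{-1}d\circ(x^k\otimes1_\downarrow)\circ\eta^\diamond_{-n}$ if $n>-k$, $tz^{-1}1_{\mathbf 1}$ if $n=-k$, $0$ if $n<-k$; $\mathsf b_n^+:=t^{-1}z^{-1}\varepsilon^\diamond_{-n}\circ(1_\downarrow\otimes x^{-k})\circ c$ if $n>k$, $-t^{-1}z^{-1}1_{\mathbf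 1}$ if $n=k$, $0$ if $n<k$. For all $n$: $\mathsf a_n^-:=\mathsf a_n-\mathsf a_n^+$, $\mathsf b_n^-:=\mathsf b_n-\mathsf b_n^+$. *)

(* Defs.v *)
From HB Require Import structures.
From mathcomp Require Import all_boot all_order all_algebra.
From mathcomp Require Import boolp.

Set Implicit Arguments.
Unset Strict Implicit.
Unset Printing Implicit Defensive.

Import Order.TTheory GRing.Theory Num.Theory.
Local Open Scope quotient_scope.
Local Open Scope ring_scope.

Record ring_unit (R : comPzRingType) := RingUnit {
  uval :> R;
  uinv : R;
  uvalK : uval * uinv = 1
}.

Lemma ring_unit_invK (R : comPzRingType) (u : ring_unit R) :
  uinv u * uval u = 1.
Proof. by rewrite mulrC uvalK. Qed.

Definition unit_inv (R : comPzRingType) (u : ring_unit R) : ring_unit R :=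
  RingUnit (ring_unit_invK u).

(* The monoid of objects is the free monoid on the two generating objects, so
   the tensor product of objects is concatenation and the unit object is the
   empty word. *)
Inductive arrow := up | down.

Definition arrow_bool (a : arrow) : bool := if a is up then true else false.
Definition bool_arrow (b : bool) : arrow := if b then up else down.
Lemma arrow_boolK : cancel arrow_bool bool_arrow. Proof. by case. Qed.
HB.instance Definition _ := Equality.copy arrow (can_type arrow_boolK).

Notation word := (seq arrow).

(* Concatenation is associative and right unital only up to a propositional
   equality; equality proofs between words are unique, so the choice of the
   proofs is immaterial. *)
Definition hcast (H : word -> word -> Type) (X X' Y Y' : word)
    (eX : X = X') (eY : Y = Y') (f : H X Y) : H X' Y' :=
  match eX in _ = A, eY in _ = B return H A B with erefl, erefl => f end.

(* Strict R-linear monoidal categories on the monoid of objects [word]. *)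
Record slmcat (R : comPzRingType) := SLMCat {
  mor : word -> word -> lmodType R;
  idm : forall X, mor X X;
  mcomp : forall X Y Z, mor Y Z -> mor X Y -> mor X Z;
  tens : forall X Y X' Y', mor X Y -> mor X' Y' -> mor (X ++ X') (Y ++ Y');
  comp1m : forall X Y (f : mor X Y), mcomp (idm Y) f = f;
  compm1 : forall X Y (f : mor X Y), mcomp f (idm X) = f;
  compA : forall X Y Z W (h : mor Z W) (g : mor Y Z) (f : mor X Y),
    mcomp h (mcomp g f) = mcomp (mcomp h g) f;
  comp_linl : forall X Y Z (f : mor X Y), linear (fun g : mor Y Z => mcomp g f);
  comp_linr : forall X Y Z (g : mor Y Z), linear (fun f : mor X Y => mcomp g f);
  tens_linl : forall X Y X' Y' (g : mor X' Y'),
    linear (fun f : mor X Y => tens f g);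
  tens_linr : forall X Y X' Y' (f : mor X Y),
    linear (fun g : mor X' Y' => tens f g);
  tens_id : forall X Y, tens (idm X) (idm Y) = idm (X ++ Y);
  interchange : forall X Y Z X' Y' Z' (g : mor Y Z) (f : mor X Y)
      (g' : mor Y' Z') (f' : mor X' Y'),
    tens (mcomp g f) (mcomp g' f') = mcomp (tens g g') (tens f f');
  tens1m : forall X Y (f : mor X Y), tens (idm [::]) f = f;
  tensm1 : forall X Y (f : mor X Y),
    hcast (H := mor) (cats0 X) (cats0 Y) (tens f (idm [::])) = f;
  tensA : forall X Y X' Y' X'' Y''
      (f : mor X Y) (g : mor X' Y') (h : mor X'' Y''),
    hcast (H := mor) (catA X X' X'') (catA Y Y' Y'') (tens f (tens g h))
      = tens (tens f g) h
}.

Arguments idm {R s} X : rename.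
Arguments mcomp {R s X Y Z} g f : rename.
Arguments tens {R s X Y X' Y'} f g : rename.

Declare Scope slm_scope.
Delimit Scope slm_scope with M.
Local Open Scope slm_scope.
Notation "g ∘ f" := (mcomp g f)
  (at level 40, f at next level, left associativity) : slm_scope.
Notation "f ⊗ g" := (tens f g)
  (at level 38, g at next level, left associativity) : slm_scope.

Lemma opcat_compA (R : comPzRingType) (C : slmcat R) X Y Z W
    (h : mor C W Z) (g : mor C Z Y) (f : mor C Y X) :
  f ∘ g ∘ h = f ∘ (g ∘ h).
Proof. by rewrite compA. Qed.

Lemma hcast_op (H : word -> word -> Type) X X' Y Y' (eX : X = X') (eY : Y = Y')
    (f : H Y X) :
  hcast (H := fun X Y => H Y X) eX eY f = hcast (H := H) eY eX f.
Proof. by case: _ / eX; case: _ / eY. Qed.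

Lemma opcat_tensm1 (R : comPzRingType) (C : slmcat R) X Y (f : mor C Y X) :
  hcast (H := fun X Y => mor C Y X) (cats0 X) (cats0 Y) (f ⊗ idm [::]) = f.
Proof. by rewrite (hcast_op (H := mor C)) tensm1. Qed.

Lemma opcat_tensA (R : comPzRingType) (C : slmcat R) X Y X' Y' X'' Y''
    (f : mor C Y X) (g : mor C Y' X') (h : mor C Y'' X'') :
  hcast (H := fun X Y => mor C Y X) (catA X X' X'') (catA Y Y' Y'')
    (f ⊗ (g ⊗ h)) = f ⊗ g ⊗ h.
Proof. by rewrite (hcast_op (H := mor C)) tensA. Qed.

Definition opcat (R : comPzRingType) (C : slmcat R) : slmcat R :=
  @SLMCat R (fun X Y => mor C Y X) (fun X => idm X)
    (fun _ _ _ g f => f ∘ g) (fun _ _ _ _ f g => f ⊗ g)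
    (fun _ _ f => compm1 f) (fun _ _ f => comp1m f)
    (@opcat_compA R C)
    (fun X Y Z f => @comp_linr R C Z Y X f)
    (fun X Y Z g => @comp_linl R C Z Y X g)
    (fun X Y X' Y' => @tens_linl R C Y X Y' X')
    (fun X Y X' Y' => @tens_linr R C Y X Y' X')
    (@tens_id R C)
    (fun _ _ _ _ _ _ g f g' f' => interchange f g f' g')
    (fun _ _ f => tens1m f)
    (@opcat_tensm1 R C) (@opcat_tensA R C).

(* Strict R-linear monoidal functors with a prescribed map on objects. *)
Record is_smfunctor (R : comPzRingType) (C D : slmcat R) (phi : word -> word)
    (F : forall X Y, mor C X Y -> mor D (phi X) (phi Y)) : Prop := IsSMFunctor {
  fmap_linear : forall X Y, linear (F X Y);
  fmap_id : forall X, F X X (idm X) = idm (phi X);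
  fmap_comp : forall X Y Z (g : mor C Y Z) (f : mor C X Y),
    F X Z (g ∘ f) = F Y Z g ∘ F X Y f;
  fobj_unit : phi [::] = [::];
  fobj_tens : forall X Y, phi (X ++ Y) = phi X ++ phi Y;
  fmap_tens : forall X Y X' Y' (f : mor C X Y) (g : mor C X' Y'),
    hcast (H := mor D) (fobj_tens X X') (fobj_tens Y Y') (F _ _ (f ⊗ g))
      = F X Y f ⊗ F X' Y' g
}.

Definition is_smiso (R : comPzRingType) (C D : slmcat R) (phi : word -> word)
    (F : forall X Y, mor C X Y -> mor D (phi X) (phi Y)) : Prop :=
  is_smfunctor F /\
  exists (psi : word -> word)
         (G : forall X Y, mor D X Y -> mor C (psi X) (psi Y))
         (phiK : cancel phi psi) (psiK : cancel psi phi),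
    [/\ is_smfunctor G,
        forall X Y (f : mor C X Y),
          hcast (H := mor C) (phiK X) (phiK Y) (G _ _ (F X Y f)) = f
      & forall X Y (g : mor D X Y),
          hcast (H := mor D) (psiK X) (psiK Y) (F _ _ (G X Y g)) = g].

(* Presentation of strict R-linear monoidal categories by generating morphisms
   and relations: terms modulo the congruence generated by the relations and
   the axioms of [slmcat]. *)
Section Presentation.
Variables (R : comPzRingType) (gen : word -> word -> Type).

Inductive tm : word -> word -> Type :=
| TGen X Y of gen X Y : tm X Y
| TId X : tm X X
| TComp X Y Z of tm Y Z & tm X Y : tm X Z
| TTens X Y X' Y' of tm X Y & tm X' Y' : tm (X ++ X') (Y ++ Y')
| TZero X Y : tm X Y
| TAdd X Y of tm X Y & tm X Y : tm X Y
| TScale X Y of R & tm X Y : tm X Y.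

Variable rel : forall X Y, tm X Y -> tm X Y -> Prop.

Inductive cong : forall X Y, tm X Y -> tm X Y -> Prop :=
| CongRel X Y (f g : tm X Y) : rel f g -> cong f g
| CongRefl X Y (f : tm X Y) : cong f f
| CongSym X Y (f g : tm X Y) : cong f g -> cong g f
| CongTrans X Y (f g h : tm X Y) : cong f g -> cong g h -> cong f h
| CongComp X Y Z (g g' : tm Y Z) (f f' : tm X Y) :
    cong g g' -> cong f f' -> cong (TComp g f) (TComp g' f')
| CongTens X Y X' Y' (f f' : tm X Y) (g g' : tm X' Y') :
    cong f f' -> cong g g' -> cong (TTens f g) (TTens f' g')
| CongAdd X Y (f f' g g' : tm X Y) :
    cong f f' -> cong g g' -> cong (TAdd f g) (TAdd f' g')
| CongScale X Y a (f f' : tm X Y) :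
    cong f f' -> cong (TScale a f) (TScale a f')
| CAddA X Y (f g h : tm X Y) : cong (TAdd f (TAdd g h)) (TAdd (TAdd f g) h)
| CAddC X Y (f g : tm X Y) : cong (TAdd f g) (TAdd g f)
| CAdd0 X Y (f : tm X Y) : cong (TAdd (TZero X Y) f) f
| CScaleA X Y a b (f : tm X Y) :
    cong (TScale a (TScale b f)) (TScale (a * b) f)
| CScale0 X Y (f : tm X Y) : cong (TScale 0 f) (TZero X Y)
| CScale1 X Y (f : tm X Y) : cong (TScale 1 f) f
| CScaleDr X Y a (f g : tm X Y) :
    cong (TScale a (TAdd f g)) (TAdd (TScale a f) (TScale a g))
| CScaleDl X Y a b (f : tm X Y) :
    cong (TScale (a + b) f) (TAdd (TScale a f) (TScale b f))
| CComp1m X Y (f : tm X Y) : cong (TComp (TId Y) f) f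
| CCompm1 X Y (f : tm X Y) : cong (TComp f (TId X)) f
| CCompA X Y Z W (h : tm Z W) (g : tm Y Z) (f : tm X Y) :
    cong (TComp h (TComp g f)) (TComp (TComp h g) f)
| CCompLinl X Y Z a (g g' : tm Y Z) (f : tm X Y) :
    cong (TComp (TAdd (TScale a g) g') f)
         (TAdd (TScale a (TComp g f)) (TComp g' f))
| CCompLinr X Y Z a (g : tm Y Z) (f f' : tm X Y) :
    cong (TComp g (TAdd (TScale a f) f'))
         (TAdd (TScale a (TComp g f)) (TComp g f'))
| CTensLinl X Y X' Y' a (f f' : tm X Y) (g : tm X' Y') :
    cong (TTens (TAdd (TScale a f) f') g)
         (TAdd (TScale a (TTens f g)) (TTens f' g))
| CTensLinr X Y X' Y' a (f : tm X Y) (g g' : tm X' Y') :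
    cong (TTens f (TAdd (TScale a g) g'))
         (TAdd (TScale a (TTens f g)) (TTens f g'))
| CTensId X Y : cong (TTens (TId X) (TId Y)) (TId (X ++ Y))
| CInterchange X Y Z X' Y' Z' (g : tm Y Z) (f : tm X Y)
    (g' : tm Y' Z') (f' : tm X' Y') :
    cong (TTens (TComp g f) (TComp g' f'))
         (TComp (TTens g g') (TTens f f'))
| CTens1m X Y (f : tm X Y) : cong (TTens (TId [::]) f) f
| CTensm1 X Y (f : tm X Y) :
    cong (hcast (cats0 X) (cats0 Y) (TTens f (TId [::]))) f
| CTensA X Y X' Y' X'' Y'' (f : tm X Y) (g : tm X' Y') (h : tm X'' Y'') :
    cong (hcast (catA X X' X'') (catA Y Y' Y'') (TTens f (TTens g h)))
         (TTens (TTens f g) h).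

Section Hom.
Variables X Y : word.

HB.instance Definition _ := gen_eqMixin (tm X Y).
HB.instance Definition _ := gen_choiceMixin (tm X Y).

Definition congb (f g : tm X Y) : bool := `[< cong f g >].

Lemma congb_refl : reflexive congb.
Proof. by move=> f; apply/asboolP; apply: CongRefl. Qed.

Lemma congb_sym : symmetric congb.
Proof. by move=> f g; apply/asboolP/asboolP; apply: CongSym. Qed.

Lemma congb_trans : transitive congb.
Proof.
by move=> g f h /asboolP fg /asboolP gh; apply/asboolP; apply: CongTrans fg gh.
Qed.

Canonical congb_equiv := EquivRel congb congb_refl congb_sym congb_trans.

Definition phom := {eq_quot congb}.
HB.instance Definition _ := Choice.on phom.
HB.instance Definition _ := EqQuotient.on phom.

Definition cls (f : tm X Y) : phom := \pi_phom f.

Lemma clsP (f g : tm X Y) : cls f = cls g <-> cong f g.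
Proof. by split=> [/eqmodP /asboolP | fg]; last by apply/eqmodP/asboolP. Qed.

Lemma clsK (f : phom) : cls (repr f) = f.
Proof. exact: reprK. Qed.

Lemma repr_cong (f : tm X Y) : cong (repr (cls f)) f.
Proof. by apply/clsP; rewrite clsK. Qed.

Lemma cls_ind (P : phom -> Prop) : (forall f, P (cls f)) -> forall f, P f.
Proof. by move=> Pc f; rewrite -(clsK f). Qed.

Definition padd (f g : phom) : phom := cls (TAdd (repr f) (repr g)).
Definition pscale a (f : phom) : phom := cls (TScale a (repr f)).
Definition pzero : phom := cls (TZero X Y).
Definition popp (f : phom) : phom := pscale (-1) f.

Lemma cls_add (f g : tm X Y) : padd (cls f) (cls g) = cls (TAdd f g).
Proof. by apply/clsP; apply: CongAdd; apply: repr_cong. Qed.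

Lemma cls_scale a (f : tm X Y) : pscale a (cls f) = cls (TScale a f).
Proof. by apply/clsP; apply: CongScale; apply: repr_cong. Qed.

Lemma paddA : associative padd.
Proof.
elim/cls_ind=> f; elim/cls_ind=> g; elim/cls_ind=> h.
by rewrite !cls_add; apply/clsP; apply: CAddA.
Qed.

Lemma paddC : commutative padd.
Proof.
elim/cls_ind=> f; elim/cls_ind=> g.
by rewrite !cls_add; apply/clsP; apply: CAddC.
Qed.

Lemma padd0 : left_id pzero padd.
Proof. by elim/cls_ind=> f; rewrite cls_add; apply/clsP; apply: CAdd0. Qed.

Lemma pscaleA a b f : pscale a (pscale b f) = pscale (a * b) f.
Proof.
by elim/cls_ind: f => f; rewrite !cls_scale; apply/clsP; apply: CScaleA.
Qed.

Lemma pscale1 : left_id 1 pscale.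
Proof. by elim/cls_ind=> f; rewrite cls_scale; apply/clsP; apply: CScale1. Qed.

Lemma pscaleDr : right_distributive pscale padd.
Proof.
move=> a; elim/cls_ind=> f; elim/cls_ind=> g.
by rewrite !(cls_add, cls_scale); apply/clsP; apply: CScaleDr.
Qed.

Lemma pscaleDl f : {morph pscale^~ f : a b / a + b >-> padd a b}.
Proof.
move=> a b; elim/cls_ind: f => f.
by rewrite !(cls_add, cls_scale); apply/clsP; apply: CScaleDl.
Qed.

Lemma paddN : left_inverse pzero popp padd.
Proof.
move=> f; rewrite -{2}[f]pscale1 /popp -pscaleDl addNr.
by elim/cls_ind: f => f; rewrite cls_scale; apply/clsP; apply: CScale0.
Qed.

HB.instance Definition _ := GRing.isZmodule.Build phom paddA paddC padd0 paddN.
HB.instance Definition _ := GRing.Zmodule_isLmodule.Build R phom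
  pscaleA pscale1 pscaleDr pscaleDl.

Lemma clsD (f g : tm X Y) : cls (TAdd f g) = cls f + cls g.
Proof. by rewrite -cls_add. Qed.

Lemma clsZ a (f : tm X Y) : cls (TScale a f) = a *: cls f.
Proof. by rewrite -cls_scale. Qed.

Lemma cls0 : cls (TZero X Y) = 0.
Proof. by []. Qed.

End Hom.

Definition pid X : phom X X := cls (TId X).
Definition pcomp X Y Z (g : phom Y Z) (f : phom X Y) : phom X Z :=
  cls (TComp (repr g) (repr f)).
Definition ptens X Y X' Y' (f : phom X Y) (g : phom X' Y') :
    phom (X ++ X') (Y ++ Y') :=
  cls (TTens (repr f) (repr g)).

Lemma cls_comp X Y Z (g : tm Y Z) (f : tm X Y) :
  pcomp (cls g) (cls f) = cls (TComp g f).
Proof. by apply/clsP; apply: CongComp; apply: repr_cong. Qed.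

Lemma cls_tens X Y X' Y' (f : tm X Y) (g : tm X' Y') :
  ptens (cls f) (cls g) = cls (TTens f g).
Proof. by apply/clsP; apply: CongTens; apply: repr_cong. Qed.

Lemma cls_hcast X X' Y Y' (eX : X = X') (eY : Y = Y') (f : tm X Y) :
  hcast (H := phom) eX eY (cls f) = cls (hcast eX eY f).
Proof. by case: _ / eX; case: _ / eY. Qed.

Lemma pcomp1m X Y (f : phom X Y) : pcomp (pid Y) f = f.
Proof.
by elim/cls_ind: f => f; rewrite cls_comp; apply/clsP; apply: CComp1m.
Qed.

Lemma pcompm1 X Y (f : phom X Y) : pcomp f (pid X) = f.
Proof.
by elim/cls_ind: f => f; rewrite cls_comp; apply/clsP; apply: CCompm1.
Qed.

Lemma pcompA X Y Z W (h : phom Z W) (g : phom Y Z) (f : phom X Y) :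
  pcomp h (pcomp g f) = pcomp (pcomp h g) f.
Proof.
elim/cls_ind: f => f; elim/cls_ind: g => g; elim/cls_ind: h => h.
by rewrite !cls_comp; apply/clsP; apply: CCompA.
Qed.

Lemma pcomp_linl X Y Z (f : phom X Y) :
  linear (fun g : phom Y Z => pcomp g f).
Proof.
move=> a; elim/cls_ind=> g; elim/cls_ind=> g'; elim/cls_ind: f => f.
by rewrite -(clsZ a g) -clsD !cls_comp -clsZ -clsD; apply/clsP; apply: CCompLinl.
Qed.

Lemma pcomp_linr X Y Z (g : phom Y Z) :
  linear (fun f : phom X Y => pcomp g f).
Proof.
move=> a; elim/cls_ind=> f; elim/cls_ind=> f'; elim/cls_ind: g => g.
by rewrite -(clsZ a f) -clsD !cls_comp -clsZ -clsD; apply/clsP; apply: CCompLinr.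
Qed.

Lemma ptens_linl X Y X' Y' (g : phom X' Y') :
  linear (fun f : phom X Y => ptens f g).
Proof.
move=> a; elim/cls_ind=> f; elim/cls_ind=> f'; elim/cls_ind: g => g.
by rewrite -(clsZ a f) -clsD !cls_tens -clsZ -clsD; apply/clsP; apply: CTensLinl.
Qed.

Lemma ptens_linr X Y X' Y' (f : phom X Y) :
  linear (fun g : phom X' Y' => ptens f g).
Proof.
move=> a; elim/cls_ind=> g; elim/cls_ind=> g'; elim/cls_ind: f => f.
by rewrite -(clsZ a g) -clsD !cls_tens -clsZ -clsD; apply/clsP; apply: CTensLinr.
Qed.

Lemma ptens_id X Y : ptens (pid X) (pid Y) = pid (X ++ Y).
Proof. by rewrite cls_tens; apply/clsP; apply: CTensId. Qed.

Lemma pinterchange X Y Z X' Y' Z' (g : phom Y Z) (f : phom X Y)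
    (g' : phom Y' Z') (f' : phom X' Y') :
  ptens (pcomp g f) (pcomp g' f') = pcomp (ptens g g') (ptens f f').
Proof.
elim/cls_ind: f => f; elim/cls_ind: g => g.
elim/cls_ind: f' => f'; elim/cls_ind: g' => g'.
by rewrite !(cls_comp, cls_tens); apply/clsP; apply: CInterchange.
Qed.

Lemma ptens1m X Y (f : phom X Y) : ptens (pid [::]) f = f.
Proof.
elim/cls_ind: f => f; rewrite (cls_tens (TId [::]) f).
by apply/clsP; apply: CTens1m.
Qed.

Lemma ptensm1 X Y (f : phom X Y) :
  hcast (H := phom) (cats0 X) (cats0 Y) (ptens f (pid [::])) = f.
Proof.
elim/cls_ind: f => f; rewrite cls_tens cls_hcast.
by apply/clsP; apply: CTensm1.
Qed.

Lemma ptensA X Y X' Y' X'' Y''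
    (f : phom X Y) (g : phom X' Y') (h : phom X'' Y'') :
  hcast (H := phom) (catA X X' X'') (catA Y Y' Y'') (ptens f (ptens g h))
    = ptens (ptens f g) h.
Proof.
elim/cls_ind: f => f; elim/cls_ind: g => g; elim/cls_ind: h => h.
by rewrite !cls_tens cls_hcast; apply/clsP; apply: CTensA.
Qed.

Definition pres : slmcat R :=
  @SLMCat R (fun X Y => phom X Y) pid pcomp ptens
    pcomp1m pcompm1 pcompA pcomp_linl pcomp_linr ptens_linl ptens_linr
    ptens_id pinterchange ptens1m ptensm1 ptensA.

Definition pgen X Y (g : gen X Y) : mor pres X Y := cls (TGen g).

End Presentation.

Definition freecat (R : comPzRingType) (gen : word -> word -> Type) : slmcat R :=
  @pres R gen (fun _ _ _ _ => False).

Notation hrel C := (forall X Y : word, mor C X Y -> mor C X Y -> Prop).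

(* Relations are given between morphisms of the free category, where all the
   morphisms derived from the generators make sense. *)
Definition presented (R : comPzRingType) (gen : word -> word -> Type)
    (rel : hrel (freecat R gen)) : slmcat R :=
  @pres R gen (fun X Y f g => rel X Y (cls _ f) (cls _ g)).

Notation I1 := (idm [:: up]).
Notation J1 := (idm [:: down]).

(* Data of the common part: [xinv] is the adjoined inverse of [x]. *)
Record base (R : comPzRingType) (C : slmcat R) := Base {
  x : mor C [:: up] [:: up];
  xinv : mor C [:: up] [:: up];
  tau : mor C [:: up; up] [:: up; up];
  cc : mor C [::] [:: down; up];
  dd : mor C [:: up; down] [::]
}.

Section Common.
Variables (R : comPzRingType) (z : ring_unit R) (C : slmcat R) (B : base C).

(* x^n for an integer n; recall that [Negz m] is -(m+1). *)
Definition xpow (n : int) : mor C [:: up] [:: up] :=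
  match n with
  | Posz m => iter m (mcomp (x B)) I1
  | Negz m => iter m.+1 (mcomp (xinv B)) I1
  end.

(* The inverse of tau forced by tau o tau = z tau + 1. *)
Definition tauinv : mor C [:: up; up] [:: up; up] :=
  tau B - uval z *: idm [:: up; up].

Definition sigma_of (T : mor C [:: up; up] [:: up; up]) :
    mor C [:: up; down] [:: down; up] :=
  (J1 ⊗ I1 ⊗ dd B : mor C [:: down; up; up; down] [:: down; up])
  ∘ (J1 ⊗ T ⊗ J1 : mor C [:: down; up; up; down] [:: down; up; up; down])
  ∘ (cc B ⊗ I1 ⊗ J1 : mor C [:: up; down] [:: down; up; up; down]).

Definition sigmap := sigma_of (tau B).
Definition sigmam := sigma_of tauinv.

Definition delta_of (S : mor C [:: up; down] [:: down; up]) :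
    mor C [:: down; down] [:: down; down] :=
  (J1 ⊗ J1 ⊗ dd B : mor C [:: down; down; up; down] [:: down; down])
  ∘ (J1 ⊗ S ⊗ J1
      : mor C [:: down; up; down; down] [:: down; down; up; down])
  ∘ (cc B ⊗ J1 ⊗ J1 : mor C [:: down; down] [:: down; up; down; down]).

Definition deltap := delta_of sigmap.
Definition deltam := delta_of sigmam.

Definition mate (f : mor C [:: up] [:: up]) : mor C [:: down] [:: down] :=
  (J1 ⊗ dd B : mor C [:: down; up; down] [:: down])
  ∘ (J1 ⊗ f ⊗ J1 : mor C [:: down; up; down] [:: down; up; down])
  ∘ (cc B ⊗ J1 : mor C [:: down] [:: down; up; down]).

Definition y := mate (x B).
(* [mate] reverses composition by the zigzag relations, so this is the inverse
   of [y]. *)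
Definition yinv := mate (xinv B).

Definition dx (n : int) : mor C [:: up; down] [::] := dd B ∘ (xpow n ⊗ J1).
Definition xc (n : int) : mor C [::] [:: down; up] := (J1 ⊗ xpow n) ∘ cc B.

Inductive common_rel : hrel C :=
| RelXXinv : common_rel (x B ∘ xinv B) I1
| RelXinvX : common_rel (xinv B ∘ x B) I1
| RelTauX : common_rel (tau B ∘ (I1 ⊗ x B) ∘ tau B) (x B ⊗ I1)
| RelSkein : common_rel (tau B ∘ tau B) (uval z *: tau B + idm [:: up; up])
| RelBraid : common_rel
    ((tau B ⊗ I1) ∘ (I1 ⊗ tau B) ∘ (tau B ⊗ I1)
       : mor C [:: up; up; up] [:: up; up; up])
    ((I1 ⊗ tau B) ∘ (tau B ⊗ I1) ∘ (I1 ⊗ tau B)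
       : mor C [:: up; up; up] [:: up; up; up])
| RelZigzagUp : common_rel
    ((dd B ⊗ I1 : mor C [:: up; down; up] [:: up])
     ∘ (I1 ⊗ cc B : mor C [:: up] [:: up; down; up])) I1
| RelZigzagDown : common_rel
    ((J1 ⊗ dd B : mor C [:: down; up; down] [:: down])
     ∘ (cc B ⊗ J1 : mor C [:: down] [:: down; up; down])) J1.

End Common.

Section Inverse.
Variables (R : comPzRingType) (C : slmcat R) (A B E : word) (n : nat).

(* The row [L, g_0, ..., g_(n-1)] is a two-sided inverse of the column
   [s, f_0, ..., f_(n-1)] : A -> B (+) E^n in the additive envelope. *)
Inductive col_inv_rel (s : mor C A B) (f : nat -> mor C A E)
    (L : mor C B A) (g : nat -> mor C E A) : hrel C :=
| ColInvl : col_inv_rel s f L g (L ∘ s + \sum_(a < n) g a ∘ f a) (idm A)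
| ColInvLL : col_inv_rel s f L g (s ∘ L) (idm B)
| ColInvLg a of (a < n)%N : col_inv_rel s f L g (s ∘ g a) 0
| ColInvfL a of (a < n)%N : col_inv_rel s f L g (f a ∘ L) 0
| ColInvfg a b of (a < n)%N & (b < n)%N :
    col_inv_rel s f L g (f a ∘ g b) ((a == b)%:R *: idm E).

(* The column [L, g_0, ..., g_(n-1)] is a two-sided inverse of the row
   [s, f_0, ..., f_(n-1)] : A (+) E^n -> B. *)
Inductive row_inv_rel (s : mor C A B) (f : nat -> mor C E B)
    (L : mor C B A) (g : nat -> mor C B E) : hrel C :=
| RowInvr : row_inv_rel s f L g (s ∘ L + \sum_(a < n) f a ∘ g a) (idm B)
| RowInvLL : row_inv_rel s f L g (L ∘ s) (idm A)
| RowInvgs a of (a < n)%N : row_inv_rel s f L g (g a ∘ s) 0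
| RowInvLf a of (a < n)%N : row_inv_rel s f L g (L ∘ f a) 0
| RowInvgf a b of (a < n)%N & (b < n)%N :
    row_inv_rel s f L g (g a ∘ f b) ((a == b)%:R *: idm E).

End Inverse.

Inductive eq_rel (R : comPzRingType) (C : slmcat R) (X Y : word)
    (f g : mor C X Y) : hrel C :=
| EqRel : eq_rel f g f g.

Definition numeta (k : int) : nat := if k is Posz n then n else 0%N.
Definition numeps (k : int) : nat := if k is Negz m then m.+1 else 0%N.

(* The generators of both definitions. [GL] is the crossing among the entries
   of the adjoined inverse, and [Geta], [Geps] are the other entries:
   Definition I : L_-, eta^diamond if k >= 0, L_+, eps^heart if k < 0;
   Definition II : L_-, eta^heart if k > 0, L_+, eps^diamond if k <= 0. *)
Inductive heis_gen (k : int) : word -> word -> Type :=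
| Gx : heis_gen k [:: up] [:: up]
| Gxinv : heis_gen k [:: up] [:: up]
| Gtau : heis_gen k [:: up; up] [:: up; up]
| Gc : heis_gen k [::] [:: down; up]
| Gd : heis_gen k [:: up; down] [::]
| GL : heis_gen k [:: down; up] [:: up; down]
| Geta of 'I_(numeta k) : heis_gen k [::] [:: up; down]
| Geps of 'I_(numeps k) : heis_gen k [:: down; up] [::].

Record heis_data (R : comPzRingType) (C : slmcat R) := HeisData {
  hbase :> base C;
  gL : mor C [:: down; up] [:: up; down];
  geta : nat -> mor C [::] [:: up; down];
  geps : nat -> mor C [:: down; up] [::]
}.

(* Families are indexed by nat, with junk value 0 outside of their range. *)
Definition fam (V : nmodType) (n : nat) (f : 'I_n -> V) (a : nat) : V :=
  if insub a is Some i then f i else 0.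

Definition gens (R : comPzRingType) (k : int)
    (rel : forall X Y, tm R (heis_gen k) X Y -> tm R (heis_gen k) X Y -> Prop) :
    heis_data (pres rel) :=
  @HeisData R (pres rel)
    (@Base R (pres rel) (pgen rel (Gx k)) (pgen rel (Gxinv k))
      (pgen rel (Gtau k)) (pgen rel (Gc k)) (pgen rel (Gd k)))
    (pgen rel (GL k))
    (fam (fun i => pgen rel (Geta i)))
    (fam (fun i => pgen rel (Geps i))).

Record heis_names (R : comPzRingType) (C : slmcat R) := HeisNames {
  nbase :> base C;
  Lp : mor C [:: down; up] [:: up; down];
  Lm : mor C [:: down; up] [:: up; down];
  eta_dia : nat -> mor C [::] [:: up; down];
  eta_heart : nat -> mor C [::] [:: up; down];
  eps_dia : nat -> mor C [:: down; up] [::];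
  eps_heart : nat -> mor C [:: down; up] [::];
  c' : mor C [::] [:: up; down];
  d' : mor C [:: down; up] [::]
}.

Section Definitions.
Variables (R : comPzRingType) (k : int) (z t : ring_unit R).
Variables (C : slmcat R) (G : heis_data C).

Local Notation zi := (uinv z).
Local Notation ti := (uinv t).
Local Notation n := (absz k).
Local Notation one := (idm (s := C) [::]).

Definition c'I : mor C [::] [:: up; down] :=
  if 0 < k then - (ti * zi) *: ((xinv G ⊗ J1) ∘ geta G n.-1)
  else if k == 0 then uval t *: (gL G ∘ cc G)
  else ti *: (gL G ∘ xc G (- k)).

Definition d'I : mor C [:: down; up] [::] :=
  if 0 <= k then uval t *: (dx G k ∘ gL G)
  else - (ti * zi) *: geps G 0.

(* The crossing that is not adjoined is defined by the leftward skein relation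
   Lp - Lm = z c' d'. *)
Definition LpI := if 0 <= k then gL G + uval z *: (c'I ∘ d'I) else gL G.
Definition LmI := if 0 <= k then gL G else gL G - uval z *: (c'I ∘ d'I).

Definition namesI : heis_names C :=
  @HeisNames R C G LpI LmI
    (geta G)
    (fun a => if a == 0%N then geta G 0 + uval z *: (LmI ∘ cc G)
              else geta G a)
    (fun a => if a == 0%N then geps G 0 + uval z *: (dd G ∘ LpI)
              else geps G a)
    (geps G)
    c'I d'I.

Definition inverse_relI : hrel C :=
  if 0 <= k
  then col_inv_rel n (sigmap G) (fun a => dx G a) (gL G) (geta G)
  else row_inv_rel n (sigmap G) (fun a => xc G a) (gL G) (geps G).

Definition bubble_relI : hrel C :=
  if 0 < k then eq_rel (dd G ∘ c'I) ((uval t * zi) *: one)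
  else if k == 0 then eq_rel (dd G ∘ c'I) ((uval t * zi - ti * zi) *: one)
  else eq_rel (d'I ∘ xc G (- k)) ((uval t * zi) *: one).

Inductive relI : hrel C :=
| CommonI X Y (f g : mor C X Y) of common_rel z G f g : relI f g
| InverseI X Y (f g : mor C X Y) of inverse_relI f g : relI f g
| BubbleI X Y (f g : mor C X Y) of bubble_relI f g : relI f g.

Definition c'II : mor C [::] [:: up; down] :=
  if 0 < k then (uval t * zi) *: geta G 0
  else ti *: (gL G ∘ xc G (- k)).

Definition d'II : mor C [:: down; up] [::] :=
  if 0 < k then uval t *: (dx G k ∘ gL G)
  else if k == 0 then ti *: (dd G ∘ gL G)
  else (uval t * zi) *: (geps G n.-1 ∘ (yinv G ⊗ I1)).

Definition LpII := if 0 < k then gL G + uval z *: (c'II ∘ d'II) else gL G.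
Definition LmII := if 0 < k then gL G else gL G - uval z *: (c'II ∘ d'II).

Definition namesII : heis_names C :=
  @HeisNames R C G LpII LmII
    (fun a => if a == 0%N then geta G 0 - uval z *: (LmII ∘ cc G)
              else geta G a)
    (geta G)
    (geps G)
    (fun a => if a == 0%N then geps G 0 - uval z *: (dd G ∘ LpII)
              else geps G a)
    c'II d'II.

Definition inverse_relII : hrel C :=
  if 0 < k
  then col_inv_rel n (sigmam z G) (fun a => dx G a) (gL G) (geta G)
  else row_inv_rel n (sigmam z G) (fun a => xc G a) (gL G) (geps G).

Definition bubble_relII : hrel C :=
  if 0 < k then eq_rel (dx G k ∘ c'II) (- (ti * zi) *: one)
  else if k == 0 then eq_rel (d'II ∘ cc G) ((uval t * zi - ti * zi) *: one)
  else eq_rel (d'II ∘ cc G) (- (ti * zi) *: one).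

Inductive relII : hrel C :=
| CommonII X Y (f g : mor C X Y) of common_rel z G f g : relII f g
| InverseII X Y (f g : mor C X Y) of inverse_relII f g : relII f g
| BubbleII X Y (f g : mor C X Y) of bubble_relII f g : relII f g.

End Definitions.

Section Bubbles.
Variables (R : comPzRingType) (k : int) (z t : ring_unit R).
Variables (C : slmcat R) (N : heis_names C).

Local Notation zi := (uinv z).
Local Notation ti := (uinv t).
Local Notation one := (idm (s := C) [::]).

Definition bub_a (m : int) : mor C [::] [::] := d' N ∘ xc N m.
Definition bub_b (m : int) : mor C [::] [::] := dx N m ∘ c' N.

Definition bub_ap (m : int) : mor C [::] [::] :=
  if 0 < m then bub_a m
  else if - k < m then - (uval t * zi) *: (dx N k ∘ eta_dia N (absz (- m)))
  else if m == - k then (uval t * zi) *: one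
  else 0.

Definition bub_bp (m : int) : mor C [::] [::] :=
  if 0 < m then bub_b m
  else if k < m then (ti * zi) *: (eps_dia N (absz (- m)) ∘ xc N (- k))
  else if m == k then - (ti * zi) *: one
  else 0.

Definition bub_am (m : int) := bub_a m - bub_ap m.
Definition bub_bm (m : int) := bub_b m - bub_bp m.

End Bubbles.

Section Heisenberg.
Variables (R : comPzRingType) (k : int) (z t : ring_unit R).

Definition heisI : slmcat R :=
  presented (relI k z t (gens (k := k) (fun _ _ _ _ => False))).

Definition heisII : slmcat R :=
  presented (relII k z t (gens (k := k) (fun _ _ _ _ => False))).

Definition heisI_names : heis_names heisI := namesI k z t (gens _).
Definition heisII_names : heis_names heisII := namesII k z t (gens _).

End Heisenberg.

Definition flip_arrow (a : arrow) : arrow := if a is up then down else up.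
Definition swap (X : word) : word := map flip_arrow X.

(* Main.v *)
(* The matrices M_+ and M_- differ by an elementary row operation (column
   operation if k < 0), because sigma_+ - sigma_- = z c d; so an inverse of one
   gives an inverse of the other. To see that the two definitions of c' (of d' if
   k < 0) agree, multiply one of them by M_+ or M_-: sigma_+ (x 1) = (1 x) sigma_-
   and the bubble relation determine all entries of the product. If k = 0 the two
   leftward crossings are rank one perturbations of each other.
   Rotating diagrams by 180 degrees, i.e. passing to the opposite category with
   up and down exchanged, turns (x, tau, c, d) into (y, -delta_-, d, c) and
   sigma_+ into -sigma_-; under this rotation Definition I for (k, t) becomes word
   for word Definition II for (-k, t^-1). Composing with the first part gives
   Omega_k. A functor out of either category is determined by the images of
   x, tau, c, d since inverses are unique, which yields both the uniqueness
   statements and the fact that the functors constructed are mutually inverse. *)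

Require Import Defs.
From mathcomp Require Import all_boot all_order all_algebra.
From mathcomp Require Import zify ring.

Set Implicit Arguments.
Unset Strict Implicit.
Unset Printing Implicit Defensive.

Import Order.TTheory GRing.Theory Num.Theory.
Import Defs.
Local Open Scope ring_scope.
Local Open Scope slm_scope.

(** The image [- deltam] of [tau] is dictated by the relations. Rotation reverses the order of the
    strands, so the rotated [tau] satisfies the dot relation with the two tensor factors exchanged.
    Passing to the inverse crossing restores the order but changes [z] to [-z] in the quadratic
    relation, and the sign changes it back. The obstacle is that words associate only
    propositionally, so diagrams would carry casts. Hence strands are added one generating object at
    a time, and the exchange of up and down is absorbed into a category [swapcat E], into which
    functors fix all words. Diagrams with downward strands are compared after capping them off with
    upward ones, which is injective and reduces identities for [sigma_of] and [delta_of] to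
    identities for [tau]. Both definitions are handled as predicates [modelI], [modelII] on data in
    an arbitrary category, so that conversion and rotation concern data only and functors come from
    the universal property. At nonzero charge both definitions adjoin the same crossing and only the
    entry of index 0 changes; at charge zero they adjoin different crossings, which needs its own
    argument. *)

Lemma hcast_id (H : word -> word -> Type) X Y (eX : X = X) (eY : Y = Y)
    (f : H X Y) :
  hcast (H := H) eX eY f = f.
Proof. by rewrite !eq_axiomK. Qed.

(** * Linearity of composition and tensor product *)

Section Linearity.
Variables (R : comPzRingType) (C : slmcat R).

Section Linear.
Variables (U V : lmodType R) (f : U -> V) (fL : linear f).

Lemma linearD_of a b : f (a + b) = f a + f b.
Proof. by have:= fL 1 a b; rewrite !scale1r. Qed.

Lemma linear0_of : f 0 = 0.
Proof. by apply: (addrI (f 0)); rewrite -linearD_of !addr0. Qed.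

Lemma linearZ_of s a : f (s *: a) = s *: f a.
Proof. by have:= fL s a 0; rewrite linear0_of !addr0. Qed.

Lemma linearN_of a : f (- a) = - f a.
Proof. by rewrite -scaleN1r linearZ_of scaleN1r. Qed.

Lemma linear_sum_of I (r : seq I) (P : pred I) F :
  f (\sum_(i <- r | P i) F i) = \sum_(i <- r | P i) f (F i).
Proof. exact: (big_morph f linearD_of linear0_of). Qed.

End Linear.

Implicit Types X Y Z W : word.

Lemma compDl X Y Z (g g' : mor C Y Z) (f : mor C X Y) :
  (g + g') ∘ f = g ∘ f + g' ∘ f.
Proof. exact: (linearD_of (comp_linl f)). Qed.
Lemma compDr X Y Z (g : mor C Y Z) (f f' : mor C X Y) :
  g ∘ (f + f') = g ∘ f + g ∘ f'.
Proof. exact: (linearD_of (comp_linr g)). Qed.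
Lemma compZl X Y Z a (g : mor C Y Z) (f : mor C X Y) :
  (a *: g) ∘ f = a *: (g ∘ f).
Proof. exact: (linearZ_of (comp_linl f)). Qed.
Lemma compZr X Y Z a (g : mor C Y Z) (f : mor C X Y) :
  g ∘ (a *: f) = a *: (g ∘ f).
Proof. exact: (linearZ_of (comp_linr g)). Qed.
Lemma compNl X Y Z (g : mor C Y Z) (f : mor C X Y) : (- g) ∘ f = - (g ∘ f).
Proof. exact: (linearN_of (comp_linl f)). Qed.
Lemma compNr X Y Z (g : mor C Y Z) (f : mor C X Y) : g ∘ (- f) = - (g ∘ f).
Proof. exact: (linearN_of (comp_linr g)). Qed.
Lemma comp0l X Y Z (f : mor C X Y) : (0 : mor C Y Z) ∘ f = 0.
Proof. exact: (linear0_of (comp_linl f)). Qed.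
Lemma comp0r X Y Z (g : mor C Y Z) : g ∘ (0 : mor C X Y) = 0.
Proof. exact: (linear0_of (comp_linr g)). Qed.
Lemma comp_suml X Y Z n (g : 'I_n -> mor C Y Z) (f : mor C X Y) :
  (\sum_i g i) ∘ f = \sum_i g i ∘ f.
Proof. exact: (linear_sum_of (comp_linl f)). Qed.
Lemma tensNl X Y X' Y' (f : mor C X Y) (g : mor C X' Y') :
  (- f) ⊗ g = - (f ⊗ g).
Proof. exact: (linearN_of (tens_linl g)). Qed.
Lemma tensNr X Y X' Y' (f : mor C X Y) (g : mor C X' Y') :
  f ⊗ (- g) = - (f ⊗ g).
Proof. exact: (linearN_of (tens_linr f)). Qed.

End Linearity.

(** * Whiskering calculus and rotation *)

Section LeftCalculus.
Variables (R : comPzRingType) (C : slmcat R).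
Implicit Types (X Y Z W : word) (a b : arrow).

(* Whiskering by one generating object on the left and taking components
   [f ⊗ idm X] produce words that compute even when X is a variable, so that the
   diagrammatic calculus can be carried out without casts. *)
Definition lw a X Y (f : mor C X Y) : mor C (a :: X) (a :: Y) :=
  idm [:: a] ⊗ f.

Definition at1 a b (f : mor C [:: a] [:: b]) X : mor C (a :: X) (b :: X) :=
  f ⊗ idm X.
Definition at2 a b a' b' (f : mor C [:: a; b] [:: a'; b']) X :
    mor C [:: a, b & X] [:: a', b' & X] :=
  f ⊗ idm X.
Definition atcup a b (f : mor C [::] [:: a; b]) X : mor C X [:: a, b & X] :=
  f ⊗ idm X.
Definition atcap a b (f : mor C [:: a; b] [::]) X : mor C [:: a, b & X] X :=
  f ⊗ idm X.

Lemma tens_lw a b X Y (f : mor C X Y) :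
  lw a (lw b f) = idm [:: a; b] ⊗ f.
Proof.
have := tensA (idm (s := C) [:: a]) (idm [:: b]) f.
by rewrite hcast_id tens_id.
Qed.

Lemma lw_id a X : lw a (idm (s := C) X) = idm (a :: X).
Proof. exact: (@tens_id R C [:: a] X). Qed.

Lemma lw_comp a X Y Z (g : mor C Y Z) (f : mor C X Y) :
  lw a (g ∘ f) = lw a g ∘ lw a f.
Proof.
by have := interchange (idm (s := C) [:: a]) (idm _) g f; rewrite comp1m.
Qed.

Lemma tens_exchange A B X Y (f : mor C A B) (g : mor C X Y) :
  (f ⊗ idm Y) ∘ (idm A ⊗ g) = (idm B ⊗ g) ∘ (f ⊗ idm X).
Proof. by rewrite -!interchange !comp1m !compm1. Qed.

Lemma at1_nat a b (f : mor C [:: a] [:: b]) X Y (g : mor C X Y) :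
  at1 f Y ∘ lw a g = lw b g ∘ at1 f X.
Proof. exact: (tens_exchange f g). Qed.

Lemma at2_nat a b a' b' (f : mor C [:: a; b] [:: a'; b']) X Y (g : mor C X Y) :
  at2 f Y ∘ lw a (lw b g) = lw a' (lw b' g) ∘ at2 f X.
Proof. by rewrite !tens_lw; apply: (tens_exchange f g). Qed.

Lemma atcup_nat a b (f : mor C [::] [:: a; b]) X Y (g : mor C X Y) :
  atcup f Y ∘ g = lw a (lw b g) ∘ atcup f X.
Proof. by rewrite tens_lw -[X in _ ∘ X]tens1m; apply: (tens_exchange f g). Qed.

Lemma atcap_nat a b (f : mor C [:: a; b] [::]) X Y (g : mor C X Y) :
  atcap f Y ∘ lw a (lw b g) = g ∘ atcap f X.
Proof.
by rewrite tens_lw -[X in _ = X ∘ _]tens1m; apply: (tens_exchange f g).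
Qed.

Lemma at1_nil a b (f : mor C [:: a] [:: b]) : at1 f [::] = f.
Proof. by have := tensm1 f; rewrite hcast_id. Qed.
Lemma at2_nil a b a' b' (f : mor C [:: a; b] [:: a'; b']) : at2 f [::] = f.
Proof. by have := tensm1 f; rewrite hcast_id. Qed.
Lemma atcup_nil a b (f : mor C [::] [:: a; b]) : atcup f [::] = f.
Proof. by have := tensm1 f; rewrite hcast_id. Qed.
Lemma atcap_nil a b (f : mor C [:: a; b] [::]) : atcap f [::] = f.
Proof. by have := tensm1 f; rewrite hcast_id. Qed.

Lemma tens_compl X Y Z W (g : mor C Y Z) (f : mor C X Y) :
  (g ∘ f) ⊗ idm W = (g ⊗ idm W) ∘ (f ⊗ idm W).
Proof. by rewrite -interchange comp1m. Qed.

(** The equalities [eX], [eY] are left free so that [erefl] can be supplied whenever both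
    bracketings compute to the same list; the cast then vanishes by conversion. *)
Lemma tensA_cast X Y X' Y' X'' Y''
    (f : mor C X Y) (g : mor C X' Y') (h : mor C X'' Y'') eX eY :
  f ⊗ g ⊗ h = hcast (H := mor C) eX eY (f ⊗ (g ⊗ h)).
Proof.
rewrite -tensA (eq_irrelevance eX (catA _ _ _)).
by rewrite (eq_irrelevance eY (catA _ _ _)).
Qed.

Lemma at2_id a b X : at2 (idm (s := C) [:: a; b]) X = idm _.
Proof. exact: (@tens_id R C [:: a; b] X). Qed.

Lemma at2_comp a b a' b' a'' b'' (g : mor C [:: a; b] [:: a'; b'])
    (f : mor C [:: a''; b''] [:: a; b]) X :
  at2 (g ∘ f) X = at2 g X ∘ at2 f X.
Proof. exact: (tens_compl X g f). Qed.

Lemma at1_lw a b c (f : mor C [:: b] [:: c]) X :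
  at2 (lw a f) X = lw a (at1 f X).
Proof. exact: (tensA_cast (idm [:: a]) f (idm X) erefl erefl). Qed.

Lemma at2_at1 a b c (f : mor C [:: a] [:: b]) X :
  at2 (at1 f [:: c]) X = at1 f (c :: X).
Proof.
have := tensA_cast f (idm [:: c]) (idm X) erefl erefl.
by rewrite [in RHS]tens_id.
Qed.

(** * Bending strands with the cup and the cap *)

Section Base.
Variables (z : ring_unit R) (B : base C).

Local Notation d_ := (atcap (dd B)).
Local Notation c_ := (atcup (cc B)).
Local Notation u := (lw up).
Local Notation v := (lw down).

(** Every factor becomes a whiskered component of the cup, the cap or [T], the form to which the
    naturality lemmas apply. *)
Lemma sigma_at T X :
  at2 (sigma_of B T) X
    = v (u (d_ X)) ∘ v (at2 T (down :: X)) ∘ c_ [:: up, down & X].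
Proof.
have E1 := tensA_cast (J1 ⊗ I1) (dd B) (idm X) erefl erefl.
have E2 := tensA_cast (J1 ⊗ T) J1 (idm X) erefl erefl.
have E2' := tensA_cast J1 T (idm (down :: X)) erefl erefl.
have E3 := tensA_cast (cc B ⊗ I1) J1 (idm X) erefl erefl.
have E3' := tensA_cast (cc B) I1 (idm (down :: X)) erefl erefl.
rewrite /at2 /sigma_of !tens_compl; congr (_ ∘ _ ∘ _).
- by rewrite tens_lw; refine (etrans E1 _); rewrite /= tens_id.
- by refine (etrans E2 _); rewrite /= tens_id; apply: E2'.
- by refine (etrans E3 _); rewrite /= tens_id; refine (etrans E3' _);
     rewrite /= tens_id.
Qed.

Lemma mate_at f X :
  at1 (mate B f) X = v (d_ X) ∘ v (at1 f (down :: X)) ∘ c_ (down :: X).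
Proof.
have E1 := tensA_cast J1 (dd B) (idm X) erefl erefl.
have E2 := tensA_cast (J1 ⊗ f) J1 (idm X) erefl erefl.
have E2' := tensA_cast J1 f (idm (down :: X)) erefl erefl.
have E3 := tensA_cast (cc B) J1 (idm X) erefl erefl.
rewrite /at1 /mate !tens_compl; congr (_ ∘ _ ∘ _).
- exact: E1.
- by refine (etrans E2 _); rewrite /= tens_id; apply: E2'.
- by refine (etrans E3 _); rewrite /= tens_id.
Qed.

Lemma delta_at S X :
  at2 (delta_of B S) X
    = v (v (d_ X)) ∘ v (at2 S (down :: X)) ∘ c_ [:: down, down & X].
Proof.
have E1 := tensA_cast (J1 ⊗ J1) (dd B) (idm X) erefl erefl.
have E2 := tensA_cast (J1 ⊗ S) J1 (idm X) erefl erefl.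
have E2' := tensA_cast J1 S (idm (down :: X)) erefl erefl.
have E3 := tensA_cast (cc B ⊗ J1) J1 (idm X) erefl erefl.
have E3' := tensA_cast (cc B) J1 (idm (down :: X)) erefl erefl.
rewrite /at2 /delta_of !tens_compl; congr (_ ∘ _ ∘ _).
- by rewrite tens_lw; refine (etrans E1 _); rewrite /= tens_id.
- by refine (etrans E2 _); rewrite /= tens_id; apply: E2'.
- by refine (etrans E3 _); rewrite /= tens_id; refine (etrans E3' _);
     rewrite /= tens_id.
Qed.

Hypothesis BH : forall X Y (f g : mor C X Y), common_rel z B f g -> f = g.

(** Composites are kept bracketed to the left, where a two-factor relation inside a longer composite
    is not a subterm; this allows rewriting with it there. *)
Lemma reass X Y Z W V (p : mor C Y Z) (q : mor C X Y) (r : mor C V Z)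
    (s : mor C X V) (h : mor C Z W) :
  p ∘ q = r ∘ s -> h ∘ p ∘ q = h ∘ r ∘ s.
Proof. by rewrite -!compA => ->. Qed.

Lemma reass1 X Y W (p : mor C Y X) (q : mor C X Y) (h : mor C X W) :
  p ∘ q = idm X -> h ∘ p ∘ q = h.
Proof. by rewrite -!compA => ->; rewrite compm1. Qed.

Lemma zigzag_up X : d_ (up :: X) ∘ u (c_ X) = idm (up :: X).
Proof.
have E := congr1 (fun f => f ⊗ idm X) (BH (RelZigzagUp z B)).
have E1 := tensA_cast (dd B) I1 (idm X) erefl erefl.
have E2 := tensA_cast I1 (cc B) (idm X) erefl erefl.
rewrite -(tens_id C [:: up] X); apply: etrans E; rewrite tens_compl.
congr (_ ∘ _); last exact: (esym E2).
by refine (esym (etrans E1 _)); rewrite /= tens_id.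
Qed.

Lemma zigzag_down X : v (d_ X) ∘ c_ (down :: X) = idm (down :: X).
Proof.
have E := congr1 (fun f => f ⊗ idm X) (BH (RelZigzagDown z B)).
have E1 := tensA_cast J1 (dd B) (idm X) erefl erefl.
have E2 := tensA_cast (cc B) J1 (idm X) erefl erefl.
rewrite -(tens_id C [:: down] X); apply: etrans E; rewrite tens_compl.
congr (_ ∘ _); first exact: (esym E1).
by refine (esym (etrans E2 _)); rewrite /= tens_id.
Qed.

(* Part of the adjunction between tensoring on the left with up and with down. *)
Lemma cap_inj W X (g g' : mor C W (down :: X)) :
  d_ X ∘ u g = d_ X ∘ u g' -> g = g'.
Proof.
have E (h : mor C W (down :: X)) : v (d_ X ∘ u h) ∘ c_ W = h.
  by rewrite lw_comp -compA -atcup_nat compA zigzag_down comp1m.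
by move=> e; rewrite -(E g) e E.
Qed.

(** A zigzag straightens. Together with [cap_inj] this characterizes [mate], and [sigma_cap] and
    [delta_cap] do the same for the bent crossings; most later identities follow by capping both
    sides. *)
Lemma mate_cap f X :
  d_ X ∘ u (at1 (mate B f) X) = d_ X ∘ at1 f (down :: X).
Proof.
rewrite mate_at !lw_comp !compA atcap_nat (reass _ (atcap_nat _ _)).
by rewrite (reass1 _ (zigzag_up _)).
Qed.

Lemma mate_cup f X :
  v (at1 f X) ∘ c_ X = at1 (mate B f) (up :: X) ∘ c_ X.
Proof.
apply: cap_inj; rewrite !lw_comp !compA mate_cap atcap_nat.
by rewrite -!compA zigzag_up compm1 at1_nat compA zigzag_up comp1m.
Qed.

Lemma sigma_cap T X :
  d_ (up :: X) ∘ u (at2 (sigma_of B T) X) = u (d_ X) ∘ at2 T (down :: X).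
Proof.
rewrite sigma_at !lw_comp !compA atcap_nat (reass _ (atcap_nat _ _)).
by rewrite (reass1 _ (zigzag_up _)).
Qed.

Lemma delta_cap S X :
  d_ (down :: X) ∘ u (at2 (delta_of B S) X) = v (d_ X) ∘ at2 S (down :: X).
Proof.
rewrite delta_at !lw_comp !compA atcap_nat (reass _ (atcap_nat _ _)).
by rewrite (reass1 _ (zigzag_up _)).
Qed.

(** Nested caps join the first upward strand to the second downward one and conversely, so moving a
    diagram through them reverses the order of the strands; hence the exchanged positions in
    [cap2_dot1] and [cap2_dot2]. *)
Definition cap2 X := d_ X ∘ u (d_ (down :: X)).

Lemma cap2_inj W X (g g' : mor C W [:: down, down & X]) :
  cap2 X ∘ u (u g) = cap2 X ∘ u (u g') -> g = g'.
Proof.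
by rewrite /cap2 -!compA -!lw_comp => e; do 2 apply: cap_inj.
Qed.

Lemma cap2_rot T X :
  cap2 X ∘ u (u (at2 (delta_of B (sigma_of B T)) X))
    = cap2 X ∘ at2 T [:: down, down & X].
Proof.
rewrite /cap2 -compA -lw_comp delta_cap lw_comp compA atcap_nat.
by rewrite -compA sigma_cap compA.
Qed.

Lemma cap2_dot1 f X :
  cap2 X ∘ u (u (v (at1 (mate B f) X))) = cap2 X ∘ at1 f _.
Proof.
rewrite /cap2 -compA -lw_comp atcap_nat lw_comp compA mate_cap.
by rewrite (reass _ (at1_nat _ _)).
Qed.

Lemma cap2_dot2 f X :
  cap2 X ∘ u (u (at1 (mate B f) (down :: X))) = cap2 X ∘ u (at1 f _).
Proof. by rewrite /cap2 -!compA -!lw_comp mate_cap. Qed.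

(** The analogue on three strands, for the braid relation. *)
Definition cap3 X := cap2 X ∘ u (u (d_ [:: down, down & X])).

Lemma cap3_inj W X (g g' : mor C W [:: down, down, down & X]) :
  cap3 X ∘ u (u (u g)) = cap3 X ∘ u (u (u g')) -> g = g'.
Proof.
by rewrite /cap3 /cap2 -!compA -!lw_comp => e; do 3 apply: cap_inj.
Qed.

Lemma cap3_rotl T X :
  cap3 X ∘ u (u (u (v (at2 (delta_of B (sigma_of B T)) X))))
    = cap3 X ∘ at2 T _.
Proof.
rewrite /cap3 -compA -!lw_comp atcap_nat !lw_comp compA cap2_rot.
by rewrite (reass _ (at2_nat _ _)).
Qed.

Lemma cap3_rotr T X :
  cap3 X ∘ u (u (u (at2 (delta_of B (sigma_of B T)) (down :: X))))
    = cap3 X ∘ u (at2 T _).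
Proof.
(* The same three caps grouped from the outside: the inner two join the two right upward strands to
   the two left downward ones. *)
have E : cap3 X = d_ X ∘ u (cap2 (down :: X)).
  by rewrite /cap3 /cap2 !lw_comp !compA.
by rewrite E -!compA -!lw_comp cap2_rot.
Qed.

Local Notation y_ := (mate B).
Local Notation rot T := (delta_of B (sigma_of B T)).

(** [sigma_of] bends the first input and the second output of [T]. A dot at an unbent end stays
    itself, at a bent end it becomes its mate; this and the next three lemmas treat the four
    ends. *)
Lemma sigma_dot_in T f X :
  at2 (sigma_of B (T ∘ (lw up f))) X = at2 (sigma_of B T) X ∘ at1 f (down :: X).
Proof.
apply: cap_inj; rewrite sigma_cap at2_comp at1_lw lw_comp !compA.
by rewrite sigma_cap.
Qed.

Lemma sigma_dot_out T f X :
  at2 (sigma_of B (at1 f [:: up] ∘ T)) X = v (at1 f X) ∘ at2 (sigma_of B T) X.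
Proof.
apply: cap_inj; rewrite sigma_cap at2_comp at2_at1 lw_comp !compA.
by rewrite atcap_nat -[in RHS]compA sigma_cap compA at1_nat.
Qed.

Lemma sigma_dot_left T f X :
  at2 (sigma_of B (T ∘ at1 f [:: up])) X
    = at1 (mate B f) (up :: X) ∘ at2 (sigma_of B T) X.
Proof.
apply: cap_inj; rewrite sigma_cap at2_comp at2_at1 lw_comp !compA.
rewrite mate_cap -sigma_cap -!compA; congr (_ ∘ _).
by rewrite at1_nat.
Qed.

Lemma sigma_dot_right T f X :
  at2 (sigma_of B (lw up f ∘ T)) X
    = at2 (sigma_of B T) X ∘ u (at1 (mate B f) X).
Proof.
apply: cap_inj; rewrite sigma_cap at2_comp at1_lw lw_comp !compA.
rewrite sigma_cap (reass _ (at2_nat _ _)) -!lw_comp mate_cap.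
by rewrite lw_comp.
Qed.

Lemma sigma_linear : linear (sigma_of B).
Proof.
move=> a T T'; rewrite /sigma_of tens_linr tens_linl comp_linr.
by rewrite [in LHS]comp_linl.
Qed.

Lemma delta_linear : linear (delta_of B).
Proof.
move=> a T T'; rewrite /delta_of tens_linr tens_linl comp_linr.
by rewrite [in LHS]comp_linl.
Qed.

(** Without a crossing the bent strands form a cap followed by a cup; by linearity this is the right
    side of [sigma_skein]. *)
Lemma sigma_id : sigma_of B (idm _) = cc B ∘ dd B.
Proof.
rewrite -[sigma_of _ _]at2_nil sigma_at at2_id lw_id compm1.
by rewrite -atcup_nat atcup_nil atcap_nil.
Qed.

Lemma rot_id : rot (idm _) = idm _.
Proof.
rewrite -[LHS]at2_nil; apply: cap2_inj.
by rewrite cap2_rot at2_id !lw_id.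
Qed.

Lemma mate_flip f X :
  d_ (up :: X) ∘ u (at1 (y_ f) (up :: X)) ∘ u (c_ X) = at1 f X.
Proof.
by rewrite mate_cap (reass _ (at1_nat _ _)) zigzag_up comp1m.
Qed.

(** Bending the strand back with a cup recovers the crossing. With [sigma_flip] and [mate_flip] this
    computes what the constructions become in the rotated category. *)
Lemma delta_flip S X :
  d_ [:: down, up & X] ∘ u (at2 (delta_of B S) (up :: X)) ∘ u (v (c_ X))
    = at2 S X.
Proof.
rewrite delta_cap -compA at2_nat compA -lw_comp.
by rewrite zigzag_up lw_id comp1m.
Qed.

Lemma sigma_flip T X :
  d_ [:: up, up & X] ∘ u (at2 (sigma_of B T) (up :: X)) ∘ u (u (c_ X))
    = at2 T X.
Proof.
rewrite sigma_cap -compA at2_nat compA -lw_comp.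
by rewrite zigzag_up lw_id comp1m.
Qed.

Lemma mate_id : y_ I1 = J1.
Proof.
rewrite -[LHS]at1_nil; apply: cap_inj; rewrite mate_cap /at1 tens_id.
by rewrite lw_id.
Qed.

Lemma mate_comp g f : y_ (g ∘ f) = y_ f ∘ y_ g.
Proof.
rewrite -[LHS]at1_nil -[RHS]at1_nil; apply: cap_inj; rewrite mate_cap.
rewrite {1}/at1 tens_compl -/(at1 g _) -/(at1 f _).
rewrite [at1 (y_ f ∘ _) _]tens_compl -/(at1 (y_ g) _) -/(at1 (y_ f) _).
by rewrite lw_comp [RHS]compA mate_cap -[RHS]compA at1_nat !compA mate_cap.
Qed.

End Base.

End LeftCalculus.

(** * Strict functors and presentations *)

Section Casts.
Variables (R : comPzRingType) (C : slmcat R).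
Local Notation hcast := (hcast (H := mor C)).
Implicit Types X Y Z W : word.

Lemma hcast_irr X X' Y Y' (eX dX : X = X') (eY dY : Y = Y') (f : mor C X Y) :
  hcast eX eY f = hcast dX dY f.
Proof. by rewrite (eq_irrelevance eX dX) (eq_irrelevance eY dY). Qed.

Lemma hcast_trans X X' X'' Y Y' Y'' (eX : X = X') (dX : X' = X'')
    (eY : Y = Y') (dY : Y' = Y'') (f : mor C X Y) :
  hcast dX dY (hcast eX eY f) = hcast (etrans eX dX) (etrans eY dY) f.
Proof. by case: _ / dX; case: _ / dY. Qed.

Lemma hcast_idm X X' (e d : X = X') : hcast e d (idm X) = idm X'.
Proof. by rewrite (eq_irrelevance d e); case: _ / e. Qed.

Lemma hcast_comp X X' Y Y' Z Z' (eX : X = X') (eY : Y = Y') (eZ : Z = Z')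
    (g : mor C Y Z) (f : mor C X Y) :
  hcast eX eZ (g ∘ f) = hcast eY eZ g ∘ hcast eX eY f.
Proof. by case: _ / eX; case: _ / eY; case: _ / eZ. Qed.

Lemma hcast_linear X X' Y Y' (eX : X = X') (eY : Y = Y') :
  linear (hcast eX eY).
Proof. by case: _ / eX; case: _ / eY. Qed.

Lemma tens_hcastl X X' Y Y' Z W (eX : X = X') (eY : Y = Y') (f : mor C X Y)
    (g : mor C Z W) :
  hcast eX eY f ⊗ g
    = hcast (congr1 (cat^~ Z) eX) (congr1 (cat^~ W) eY) (f ⊗ g).
Proof. by case: _ / eX; case: _ / eY. Qed.

Lemma tens_hcastr X X' Y Y' Z W (eX : X = X') (eY : Y = Y') (f : mor C X Y)
    (g : mor C Z W) :
  g ⊗ hcast eX eY f = hcast (congr1 (cat Z) eX) (congr1 (cat W) eY) (g ⊗ f).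
Proof. by case: _ / eX; case: _ / eY. Qed.

Lemma hcast_swap X X' Y Y' (eX : X = X') (eY : Y = Y')
    (f : mor C (swap X) (swap Y)) :
  Defs.hcast (H := fun X Y => mor C (swap X) (swap Y)) eX eY f
    = hcast (congr1 swap eX) (congr1 swap eY) f.
Proof. by case: _ / eX; case: _ / eY. Qed.

End Casts.

(* Transparent, so that the casts along it compute away on explicit words. *)
Fixpoint swap_cat (X Y : word) : swap (X ++ Y) = swap X ++ swap Y :=
  if X is a :: X' then congr1 (cons (flip_arrow a)) (swap_cat X' Y) else erefl.

Lemma swapK : involutive swap.
Proof. by move=> X; rewrite /swap -map_comp map_id_in //; case. Qed.

(** * Exchanging the two generating objects *)

Section SwapCat.
Variables (R : comPzRingType) (E : slmcat R).
Implicit Types X Y Z W : word.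

Definition smor X Y : lmodType R := mor E (swap X) (swap Y).

(** [swap] preserves concatenation only propositionally on variable words; with the cast placed
    inside the tensor product, functors into this category need none. *)
Definition stens X Y X' Y' (f : smor X Y) (g : smor X' Y') :
    smor (X ++ X') (Y ++ Y') :=
  hcast (H := mor E) (esym (swap_cat X X')) (esym (swap_cat Y Y')) (f ⊗ g).

Lemma stens_linl X Y X' Y' (g : smor X' Y') :
  linear (fun f : smor X Y => stens f g).
Proof. by move=> a f f'; rewrite /stens tens_linl hcast_linear. Qed.

Lemma stens_linr X Y X' Y' (f : smor X Y) :
  linear (fun g : smor X' Y' => stens f g).
Proof. by move=> a g g'; rewrite /stens tens_linr hcast_linear. Qed.

Lemma stens_id X Y :
  stens (idm (s := E) (swap X)) (idm (swap Y)) = idm (swap (X ++ Y)).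
Proof. by rewrite /stens tens_id hcast_idm. Qed.

Lemma sinterchange X Y Z X' Y' Z' (g : smor Y Z) (f : smor X Y)
    (g' : smor Y' Z') (f' : smor X' Y') :
  stens (g ∘ f) (g' ∘ f') = stens g g' ∘ stens f f'.
Proof. by rewrite /stens interchange -hcast_comp. Qed.

Lemma stens1m X Y (f : smor X Y) :
  stens (idm (s := E) (swap [::]) : smor [::] [::]) f = f.
Proof. exact: tens1m. Qed.

Lemma stensm1 X Y (f : smor X Y) :
  hcast (H := smor) (cats0 X) (cats0 Y)
    (stens f (idm (s := E) (swap [::]) : smor [::] [::])) = f.
Proof.
rewrite (hcast_swap (C := E)) hcast_trans -[RHS]tensm1; exact: hcast_irr.
Qed.

Lemma stensA X Y X' Y' X'' Y'' (f : smor X Y) (g : smor X' Y')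
    (h : smor X'' Y'') :
  hcast (H := smor) (catA X X' X'') (catA Y Y' Y'') (stens f (stens g h))
    = stens (stens f g) h.
Proof.
rewrite (hcast_swap (C := E)) /stens tens_hcastr tens_hcastl -tensA.
by rewrite !hcast_trans; apply: hcast_irr.
Qed.

Definition swapcat : slmcat R :=
  @SLMCat R smor (fun X => idm (swap X)) (fun _ _ _ g f => g ∘ f)
    stens
    (fun _ _ f => comp1m f) (fun _ _ f => compm1 f)
    (fun _ _ _ _ h g f => compA h g f)
    (fun X Y Z f => @comp_linl R E (swap X) (swap Y) (swap Z) f)
    (fun X Y Z g => @comp_linr R E (swap X) (swap Y) (swap Z) g)
    stens_linl stens_linr stens_id sinterchange stens1m stensm1 stensA.

End SwapCat.

(* Functors fixing all words need no casts. One into [swapcat (opcat D)] is a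
   contravariant functor to D exchanging up and down. *)
Record functor (R : comPzRingType) (C D : slmcat R)
    (F : forall X Y, mor C X Y -> mor D X Y) : Prop := Functor {
  functor_linear : forall X Y, linear (F X Y);
  functor_id : forall X, F X X (idm X) = idm X;
  functor_comp : forall X Y Z (g : mor C Y Z) (f : mor C X Y),
    F X Z (g ∘ f) = F Y Z g ∘ F X Y f;
  functor_tens : forall X Y X' Y' (f : mor C X Y) (g : mor C X' Y'),
    F _ _ (f ⊗ g) = F X Y f ⊗ F X' Y' g
}.

Section FunctorConversions.
Variables (R : comPzRingType) (C D : slmcat R).

Lemma functor_smfunctor (F : forall X Y, mor C X Y -> mor D X Y) :
  functor F -> is_smfunctor (phi := id) F.
Proof.
case=> Fl F1 Fc Ft.
exact: (@IsSMFunctor _ _ _ id F Fl F1 Fc erefl (fun _ _ => erefl) Ft).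
Qed.

(** [is_smfunctor] carries an unspecified proof that [swap] preserves concatenation; uniqueness of
    equality proofs identifies it with [swap_cat]. *)
Lemma functor_swapP (F : forall X Y, mor C X Y -> mor D (swap X) (swap Y)) :
  @functor R C (swapcat D) F <-> is_smfunctor F.
Proof.
split=> [[Fl F1 Fc Ft]|[Fl F1 Fc F0 FD Ft]].
  apply: (@IsSMFunctor _ _ _ swap F Fl F1 Fc erefl swap_cat) => X Y X' Y' f g.
  by rewrite Ft /= /stens hcast_trans hcast_id.
split=> // X Y X' Y' f g.
by rewrite /= /stens -Ft hcast_trans hcast_id.
Qed.

(** A contravariant functor read as a covariant one on the opposite category, the shape required of
    the inverse of [Omega_k]. *)
Lemma functor_swap_op (G : forall X Y, mor D X Y -> mor C (swap Y) (swap X)) :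
  @functor R D (swapcat (opcat C)) G ->
  @is_smfunctor R (opcat D) C swap (fun X Y => G Y X).
Proof.
case=> Gl G1 Gc Gt.
apply: (@IsSMFunctor _ (opcat D) C swap (fun X Y => G Y X) (fun X Y => Gl Y X)
  G1 (fun X Y Z g f => Gc _ _ _ f g) erefl swap_cat) => X Y X' Y' f g.
by rewrite Gt /= /stens (hcast_op (H := mor C)) hcast_trans hcast_id.
Qed.

End FunctorConversions.

Lemma functor_id_fun (R : comPzRingType) (C : slmcat R) :
  @functor R C C (fun X Y f => f).
Proof. by []. Qed.

Section FunctorComp.
Variables (R : comPzRingType) (C D E : slmcat R).

Lemma functor_compose (F : forall X Y, mor C X Y -> mor D X Y)
    (G : forall X Y, mor D X Y -> mor E X Y) :
  functor F -> functor G -> functor (fun X Y f => G X Y (F X Y f)).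
Proof.
case=> Fl F1 Fc Ft [Gl G1 Gc Gt]; split.
- by move=> X Y a f g; rewrite Fl Gl.
- by move=> X; rewrite F1 G1.
- by move=> X Y Z g f; rewrite Fc Gc.
- by move=> X Y X' Y' f g; rewrite Ft Gt.
Qed.

Lemma functor_swap_compose
    (F : forall X Y, mor C X Y -> mor D (swap Y) (swap X))
    (G : forall X Y, mor D X Y -> mor E (swap Y) (swap X)) :
  @functor R C (swapcat (opcat D)) F -> @functor R D (swapcat (opcat E)) G ->
  functor (fun X Y f =>
    hcast (H := mor E) (swapK X) (swapK Y) (G _ _ (F X Y f))).
Proof.
case=> Fl F1 Fc Ft [Gl G1 Gc Gt]; split.
- by move=> X Y a f g; rewrite Fl Gl hcast_linear.
- by move=> X; rewrite F1 G1 hcast_idm.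
- by move=> X Y Z g f; rewrite Fc Gc -hcast_comp.
move=> X Y X' Y' f g; rewrite Ft /= /stens (hcast_op (H := mor D)).
(* Being contravariant, [G] commutes with casts after exchanging the two equalities. *)
have Gh X1 X2 Y1 Y2 (eX : X1 = X2) (eY : Y1 = Y2) (f1 : mor D X1 Y1) :
  G _ _ (hcast (H := mor D) eX eY f1)
    = hcast (H := mor E) (congr1 swap eY) (congr1 swap eX) (G _ _ f1).
  by case: _ / eX; case: _ / eY.
rewrite Gh Gt /= /stens (hcast_op (H := mor E)) tens_hcastl tens_hcastr.
by rewrite !hcast_trans; apply: hcast_irr.
Qed.
End FunctorComp.

(** * Universal property of a presentation *)

Section Universal.
Variables (R : comPzRingType) (gen : word -> word -> Type).
Variable rel : forall X Y, tm R gen X Y -> tm R gen X Y -> Prop.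
Variables (D : slmcat R) (h : forall X Y, gen X Y -> mor D X Y).

Fixpoint ev X Y (s : tm R gen X Y) : mor D X Y :=
  match s with
  | TGen _ _ g => h g
  | TId _ => idm _
  | TComp _ _ _ g f => ev g ∘ ev f
  | TTens _ _ _ _ f g => ev f ⊗ ev g
  | TZero _ _ => 0
  | TAdd _ _ f g => ev f + ev g
  | TScale _ _ a f => a *: ev f
  end.

Lemma ev_hcast X X' Y Y' (eX : X = X') (eY : Y = Y') (f : tm R gen X Y) :
  ev (hcast eX eY f) = hcast (H := mor D) eX eY (ev f).
Proof. by case: _ / eX; case: _ / eY. Qed.

Hypothesis hP : forall X Y (f g : tm R gen X Y), rel f g -> ev f = ev g.

Lemma ev_cong X Y (f g : tm R gen X Y) : cong rel f g -> ev f = ev g.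
Proof.
elim=> {X Y f g} //=.
- by move=> X Y f g h' _ -> _ ->.
- by move=> X Y Z g g' f f' _ -> _ ->.
- by move=> X Y X' Y' f f' g g' _ -> _ ->.
- by move=> X Y f f' g g' _ -> _ ->.
- by move=> X Y a f f' _ ->.
- by move=> *; rewrite addrA.
- by move=> *; rewrite addrC.
- by move=> *; rewrite add0r.
- by move=> *; rewrite scalerA.
- by move=> *; rewrite scale0r.
- by move=> *; rewrite scale1r.
- by move=> *; rewrite scalerDr.
- by move=> *; rewrite scalerDl.
- by move=> *; rewrite comp1m.
- by move=> *; rewrite compm1.
- by move=> *; rewrite compA.
- by move=> *; rewrite comp_linl.
- by move=> *; rewrite comp_linr.
- by move=> *; rewrite tens_linl.
- by move=> *; rewrite tens_linr.
- by move=> *; rewrite tens_id.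
- by move=> *; rewrite interchange.
- by move=> *; rewrite tens1m.
- by move=> *; rewrite ev_hcast tensm1.
- by move=> *; rewrite ev_hcast tensA.
Qed.

Definition evq X Y (f : mor (pres rel) X Y) : mor D X Y := ev (repr f).

Lemma evq_cls X Y (f : tm R gen X Y) : evq (cls rel f) = ev f.
Proof. exact: (ev_cong (repr_cong _ f)). Qed.

Lemma evq_functor : functor evq.
Proof.
split.
- move=> X Y a; elim/cls_ind=> f; elim/cls_ind=> g.
  by rewrite -(clsZ rel a f) -clsD !evq_cls.
- by move=> X; rewrite evq_cls.
- move=> X Y Z; elim/cls_ind=> g; elim/cls_ind=> f.
  by rewrite [_ ∘ _]cls_comp !evq_cls.
- move=> X Y X' Y'; elim/cls_ind=> f; elim/cls_ind=> g.
  by rewrite [_ ⊗ _]cls_tens !evq_cls.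
Qed.

Lemma evq_gen X Y (g : gen X Y) : evq (pgen rel g) = h g.
Proof. exact: evq_cls. Qed.

Lemma pres_functor_ext (F G : forall X Y, mor (pres rel) X Y -> mor D X Y) :
  functor F -> functor G ->
  (forall X Y (g : gen X Y), F _ _ (pgen rel g) = G _ _ (pgen rel g)) ->
  forall X Y (f : mor (pres rel) X Y), F _ _ f = G _ _ f.
Proof.
case=> Fl F1 Fc Ft [Gl G1 Gc Gt] FG X Y; elim/cls_ind=> f.
elim: f => {X Y}.
- exact: FG.
- by move=> X; rewrite -[cls _ _]/(idm (s := pres rel) X) F1 G1.
- move=> X Y Z g Hg f Hf.
  by rewrite -cls_comp -[pcomp _ _]/(mcomp (s := pres rel) _ _) Fc Gc Hg Hf.
- move=> X Y X' Y' f Hf g Hg.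
  by rewrite -cls_tens -[ptens _ _]/(tens (s := pres rel) _ _) Ft Gt Hg Hf.
- by move=> X Y; rewrite cls0 (linear0_of (Fl _ _)) (linear0_of (Gl _ _)).
- move=> X Y f Hf g Hg.
  by rewrite clsD (linearD_of (Fl _ _)) (linearD_of (Gl _ _)) Hf Hg.
- move=> X Y a f Hf.
  by rewrite clsZ (linearZ_of (Fl _ _)) (linearZ_of (Gl _ _)) Hf.
Qed.

End Universal.

(** * Models of the two definitions *)

Section CommonConsequences.
Variables (R : comPzRingType) (z : ring_unit R) (C : slmcat R) (B : base C).
Hypothesis BH : forall X Y (f g : mor C X Y), common_rel z B f g -> f = g.

Lemma tau_tauinv : tau B ∘ tauinv z B = idm _.
Proof.
by rewrite /tauinv compDr compNr compZr compm1 (BH (RelSkein z B)) addrC addKr.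
Qed.

Lemma tauinv_tau : tauinv z B ∘ tau B = idm _.
Proof.
by rewrite /tauinv compDl compNl compZl comp1m (BH (RelSkein z B)) addrC addKr.
Qed.

Lemma tauinv_skein :
  tauinv z B ∘ tauinv z B = idm _ - uval z *: tauinv z B.
Proof.
by rewrite {1}/tauinv compDl compNl compZl comp1m tau_tauinv.
Qed.

Lemma tau_dot : tau B ∘ lw up (x B) = at1 (x B) [:: up] ∘ tauinv z B.
Proof. by rewrite -[at1 _ _](BH (RelTauX z B)) -compA tau_tauinv compm1. Qed.

Lemma dot_tau : lw up (x B) ∘ tau B = tauinv z B ∘ at1 (x B) [:: up].
Proof.
by rewrite -[at1 _ _](BH (RelTauX z B)) !compA tauinv_tau comp1m.
Qed.

Lemma tauinv_dot : tauinv z B ∘ at1 (x B) [:: up] ∘ tauinv z B = lw up (x B).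
Proof. by rewrite -dot_tau -compA tau_tauinv compm1. Qed.

Lemma tauinv_braid X :
  at2 (tauinv z B) (up :: X) ∘ lw up (at2 (tauinv z B) X)
    ∘ at2 (tauinv z B) (up :: X)
  = lw up (at2 (tauinv z B) X) ∘ at2 (tauinv z B) (up :: X)
    ∘ lw up (at2 (tauinv z B) X).
Proof.
set s := at2 _ _; set r := lw _ _.
set s' := at2 (tau B) (up :: X); set r' := lw up (at2 (tau B) X).
have sK : s ∘ s' = idm _ by rewrite /s /s' -at2_comp tauinv_tau at2_id.
have Ks : s' ∘ s = idm _ by rewrite /s /s' -at2_comp tau_tauinv at2_id.
have rK : r ∘ r' = idm _.
  by rewrite /r /r' -lw_comp -at2_comp tauinv_tau at2_id lw_id.
have Kr : r' ∘ r = idm _.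
  by rewrite /r /r' -lw_comp -at2_comp tau_tauinv at2_id lw_id.
have E : s' ∘ r' ∘ s' = r' ∘ s' ∘ r'.
  have := congr1 (fun f => f ⊗ idm X) (BH (RelBraid z B)).
  have E1 := tensA_cast (tau B) I1 (idm X) erefl erefl.
  have E2 := tensA_cast I1 (tau B) (idm X) erefl erefl.
  rewrite !tens_compl.
  have -> : tau B ⊗ I1 ⊗ idm X = s' by refine (etrans E1 _); rewrite /= tens_id.
  by have -> : I1 ⊗ tau B ⊗ idm X = r' by exact: E2.
(* The left side of the goal is a left inverse of [s' r' s']; by [E] the right side is a right
   inverse of it, so the two agree. *)
have K : (s ∘ r ∘ s) ∘ (s' ∘ r' ∘ s') = idm _.
  by rewrite !compA (reass1 _ sK) (reass1 _ rK).
rewrite -[RHS]comp1m -K E !compA (reass1 _ Kr) (reass1 _ Ks).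
by rewrite (reass1 _ Kr).
Qed.

Lemma sigma_skein : sigmap B - sigmam z B = uval z *: (cc B ∘ dd B).
Proof.
rewrite /sigmap /sigmam /tauinv (linearD_of (sigma_linear B)).
rewrite (linearN_of (sigma_linear B)) (linearZ_of (sigma_linear B)).
by rewrite sigma_id opprD opprK addrA subrr add0r.
Qed.

Lemma delta_skein : deltap B - deltam z B = uval z *: idm _.
Proof.
rewrite /deltap /deltam -(linearN_of (delta_linear B)).
rewrite -(linearD_of (delta_linear B)).
rewrite /sigmap /sigmam -(linearN_of (sigma_linear B)).
rewrite -(linearD_of (sigma_linear B)) /tauinv opprD opprK addrA subrr add0r.
rewrite (linearZ_of (sigma_linear B)) (linearZ_of (delta_linear B)).
by rewrite (rot_id BH).
Qed.

(** Sliding a dot through [tau] turns it into [tauinv]; after bending, this is the exchange of the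
    two sideways crossings that links the inverses of M_+ and M_-. *)
Lemma sigma_dot_up :
  sigmap B ∘ at1 (x B) [:: down] = lw down (x B) ∘ sigmam z B.
Proof.
have := sigma_dot_in BH (tau B) (x B) [::].
rewrite tau_dot (sigma_dot_out BH) !at2_nil at1_nil.
by move=> <-.
Qed.

Lemma sigma_dot_down :
  sigmap B ∘ lw up (y B) = at1 (y B) [:: up] ∘ sigmam z B.
Proof.
have := sigma_dot_right BH (tau B) (x B) [::].
rewrite dot_tau (sigma_dot_left BH) !at2_nil at1_nil.
by move=> <-.
Qed.

Lemma dot_cup f : lw down f ∘ cc B = at1 (mate B f) [:: up] ∘ cc B.
Proof. by have := mate_cup BH f [::]; rewrite at1_nil atcup_nil. Qed.

Lemma yK : yinv B ∘ y B = J1.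
Proof. by rewrite -(mate_comp BH) (BH (RelXXinv z B)) (mate_id BH). Qed.

Lemma yVK : y B ∘ yinv B = J1.
Proof. by rewrite -(mate_comp BH) (BH (RelXinvX z B)) (mate_id BH). Qed.

End CommonConsequences.

Section Models.
Variables (R : comPzRingType) (C : slmcat R).

(** The relations as plain equations on data, which can be checked directly in any category, in
    particular in the rotated one. *)
Definition common (z : ring_unit R) (B : base C) : Prop :=
  [/\ x B ∘ xinv B = I1, xinv B ∘ x B = I1,
      tau B ∘ (I1 ⊗ x B) ∘ tau B = x B ⊗ I1,
      tau B ∘ tau B = uval z *: tau B + idm [:: up; up]
    & [/\ (tau B ⊗ I1) ∘ (I1 ⊗ tau B) ∘ (tau B ⊗ I1)
            = (I1 ⊗ tau B) ∘ (tau B ⊗ I1) ∘ (I1 ⊗ tau B)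
            :> mor C [:: up; up; up] [:: up; up; up],
          (dd B ⊗ I1 : mor C [:: up; down; up] [:: up])
            ∘ (I1 ⊗ cc B : mor C [:: up] [:: up; down; up]) = I1
        & (J1 ⊗ dd B : mor C [:: down; up; down] [:: down])
            ∘ (cc B ⊗ J1 : mor C [:: down] [:: down; up; down]) = J1]].

Definition colinv (X Y E : word) (n : nat) (s : mor C X Y)
    (f : nat -> mor C X E) (L : mor C Y X) (g : nat -> mor C E X) : Prop :=
  [/\ L ∘ s + \sum_(a < n) g a ∘ f a = idm X, s ∘ L = idm Y,
      forall a, (a < n)%N -> s ∘ g a = 0,
      forall a, (a < n)%N -> f a ∘ L = 0
    & forall a b, (a < n)%N -> (b < n)%N -> f a ∘ g b = (a == b)%:R *: idm E].

Definition rowinv (X Y E : word) (n : nat) (s : mor C X Y)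
    (f : nat -> mor C E Y) (L : mor C Y X) (g : nat -> mor C Y E) : Prop :=
  [/\ s ∘ L + \sum_(a < n) f a ∘ g a = idm Y, L ∘ s = idm X,
      forall a, (a < n)%N -> g a ∘ s = 0,
      forall a, (a < n)%N -> L ∘ f a = 0
    & forall a b, (a < n)%N -> (b < n)%N -> g a ∘ f b = (a == b)%:R *: idm E].

Lemma colinv_ext X Y E n s f f' L g g' :
  (forall a, (a < n)%N -> f a = f' a) -> (forall a, (a < n)%N -> g a = g' a) ->
  @colinv X Y E n s f L g -> colinv n s f' L g'.
Proof.
move=> ff gg [h1 h2 h3 h4 h5]; split=> //.
- by rewrite -h1; congr (_ + _); apply: eq_bigr => i _; rewrite ff ?gg.
- by move=> a an; rewrite -gg ?h3.
- by move=> a an; rewrite -ff ?h4.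
- by move=> a b an bn; rewrite -ff -?gg ?h5.
Qed.

Lemma rowinv_ext X Y E n s f f' L g g' :
  (forall a, (a < n)%N -> f a = f' a) -> (forall a, (a < n)%N -> g a = g' a) ->
  @rowinv X Y E n s f L g -> rowinv n s f' L g'.
Proof.
move=> ff gg [h1 h2 h3 h4 h5]; split=> //.
- by rewrite -h1; congr (_ + _); apply: eq_bigr => i _; rewrite ff ?gg.
- by move=> a an; rewrite -gg ?h3.
- by move=> a an; rewrite -ff ?h4.
- by move=> a b an bn; rewrite -ff -?gg ?h5.
Qed.

Section Def.
Variables (k : int) (z t : ring_unit R) (G : heis_data C).
Local Notation n := (absz k).
Local Notation one := (idm (s := C) [::]).
Local Notation zi := (uinv z).
Local Notation ti := (uinv t).

Definition modelI : Prop :=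
  [/\ common z G,
      if 0 <= k then colinv n (sigmap G) (fun a => dx G a) (gL G) (geta G)
      else rowinv n (sigmap G) (fun a => xc G a) (gL G) (geps G)
    & if 0 < k then dd G ∘ c'I k z t G = (uval t * zi) *: one
      else if k == 0 then
        dd G ∘ c'I k z t G = (uval t * zi - ti * zi) *: one
      else d'I k z t G ∘ xc G (- k) = (uval t * zi) *: one].

Definition modelII : Prop :=
  [/\ common z G,
      if 0 < k then colinv n (sigmam z G) (fun a => dx G a) (gL G) (geta G)
      else rowinv n (sigmam z G) (fun a => xc G a) (gL G) (geps G)
    & if 0 < k then dx G k ∘ c'II k z t G = - (ti * zi) *: one
      else if k == 0 then
        d'II k z t G ∘ cc G = (uval t * zi - ti * zi) *: one
      else d'II k z t G ∘ cc G = - (ti * zi) *: one].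

End Def.

(* The families carry junk outside of their range, hence the bounds. *)
Record same_data (k : int) (G G' : heis_data C) : Prop := SameData {
  same_base : hbase G = hbase G';
  same_L : gL G = gL G';
  same_eta : forall a, (a < numeta k)%N -> geta G a = geta G' a;
  same_eps : forall a, (a < numeps k)%N -> geps G a = geps G' a
}.

Record same_names (k : int) (N N' : heis_names C) : Prop := SameNames {
  same_nbase : nbase N = nbase N';
  same_Lp : Lp N = Lp N';
  same_Lm : Lm N = Lm N';
  same_c' : c' N = c' N';
  same_d' : d' N = d' N';
  same_etas : forall a, (a < numeta k)%N ->
    eta_dia N a = eta_dia N' a /\ eta_heart N a = eta_heart N' a;
  same_epss : forall a, (a < numeps k)%N ->
    eps_dia N a = eps_dia N' a /\ eps_heart N a = eps_heart N' a
}.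

Lemma same_data_sym k G G' : same_data k G G' -> same_data k G' G.
Proof. by case=> h1 h2 h3 h4; split=> // a ha; rewrite ?h3 ?h4. Qed.

Lemma same_names_trans k N N' N'' :
  same_names k N N' -> same_names k N' N'' -> same_names k N N''.
Proof.
case=> h1 h2 h3 h4 h5 h6 h7 [g1 g2 g3 g4 g5 g6 g7].
split; rewrite ?h1 ?h2 ?h3 ?h4 ?h5 // => a ha.
  by case: (h6 a ha) => -> ->; apply: g6.
by case: (h7 a ha) => -> ->; apply: g7.
Qed.

End Models.

Lemma numeta_gt0 (k : int) : 0 < k -> numeta k = absz k.
Proof. by case: k. Qed.
Lemma numeta_ge0 (k : int) : 0 <= k -> numeta k = absz k.
Proof. by case: k. Qed.
Lemma numeps_lt0 (k : int) : (0 <= k) = false -> numeps k = absz k.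
Proof. by case: k. Qed.
Lemma numeps_le0 (k : int) : (0 < k) = false -> numeps k = absz k.
Proof. by case: k => // - []. Qed.

Section Same.
Variables (R : comPzRingType) (C : slmcat R) (k : int) (z t : ring_unit R).
Variables (G G' : heis_data C) (GG : same_data k G G').

Lemma same_dataI : c'I k z t G = c'I k z t G' /\ d'I k z t G = d'I k z t G'.
Proof.
case: G G' GG => [B L e p] [B' L' e' p'] [/= eB eL ee ep]; subst B' L'.
rewrite /c'I /d'I /=; split; last first.
  by case: ifP => // /[dup] k0 /numeps_lt0 n0; rewrite ep //; lia.
by case: ifP => // /[dup] k0 /numeta_gt0 n0; rewrite ee //; lia.
Qed.

Lemma same_dataII :
  c'II k z t G = c'II k z t G' /\ d'II k z t G = d'II k z t G'.
Proof.
case: G G' GG => [B L e p] [B' L' e' p'] [/= eB eL ee ep]; subst B' L'.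
rewrite /c'II /d'II /=; split.
  by case: ifP => // /[dup] k0 /numeta_gt0 n0; rewrite ee //; lia.
case: ifP => // /[dup] k0 /numeps_le0 n0; case: ifP => // k1.
by rewrite ep //; lia.
Qed.

Lemma same_namesI : same_names k (namesI k z t G) (namesI k z t G').
Proof.
case: same_dataI => ec ed; case: GG => eB eL ee ep.
split; rewrite /= /LpI /LmI ?ec ?ed ?eL ?eB //.
  move=> a ha; split; first exact: ee.
  by rewrite !ee // (leq_ltn_trans _ ha).
move=> a ha; split; last exact: ep.
by rewrite !ep // (leq_ltn_trans _ ha).
Qed.

Lemma same_modelI : modelI k z t G -> modelI k z t G'.
Proof.
rewrite /modelI; case: same_dataI => <- <-; case: GG => <- <- ee ep [h1 h2 h3].
split=> //; move: h2; case: ifP => k0.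
  by apply: colinv_ext => // a ha; apply: ee; rewrite numeta_ge0.
by apply: rowinv_ext => // a ha; apply: ep; rewrite numeps_lt0.
Qed.

Lemma same_namesII : same_names k (namesII k z t G) (namesII k z t G').
Proof.
case: same_dataII => ec ed; case: GG => eB eL ee ep.
split; rewrite /= /LpII /LmII ?ec ?ed ?eL ?eB //.
  move=> a ha; split; last exact: ee.
  by rewrite !ee // (leq_ltn_trans _ ha).
move=> a ha; split; first exact: ep.
by rewrite !ep // (leq_ltn_trans _ ha).
Qed.

Lemma same_modelII : modelII k z t G -> modelII k z t G'.
Proof.
rewrite /modelII; case: same_dataII => <- <-.
case: GG => <- <- ee ep [h1 h2 h3].
split=> //; move: h2; case: ifP => k0.
  by apply: colinv_ext => // a ha; apply: ee; rewrite numeta_gt0.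
by apply: rowinv_ext => // a ha; apply: ep; rewrite numeps_le0.
Qed.

End Same.

(** * Images of the data under a functor *)

Section FunctorData.
Variables (R : comPzRingType) (C D : slmcat R).
Variables (F : forall X Y, mor C X Y -> mor D X Y) (HF : functor F).

Definition fbase (B : base C) : base D :=
  Base (F (x B)) (F (xinv B)) (F (tau B)) (F (cc B)) (F (dd B)).

Definition fdata (G : heis_data C) : heis_data D :=
  HeisData (fbase G) (F (gL G)) (fun a => F (geta G a)) (fun a => F (geps G a)).

Definition fnames (N : heis_names C) : heis_names D :=
  HeisNames (fbase N) (F (Lp N)) (F (Lm N)) (fun a => F (eta_dia N a))
    (fun a => F (eta_heart N a)) (fun a => F (eps_dia N a))
    (fun a => F (eps_heart N a)) (F (c' N)) (F (d' N)).

Let FD X Y := linearD_of (@functor_linear _ _ _ _ HF X Y).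
Let FZ X Y := linearZ_of (@functor_linear _ _ _ _ HF X Y).
Let FN X Y := linearN_of (@functor_linear _ _ _ _ HF X Y).
Let F0 X Y := linear0_of (@functor_linear _ _ _ _ HF X Y).
Let F1 := functor_id HF.
Let Fc := functor_comp HF.
Let Ft := functor_tens HF.

Lemma functor_sum X Y n (f : 'I_n -> mor C X Y) :
  F (\sum_i f i) = \sum_i F (f i).
Proof. exact: (linear_sum_of (@functor_linear _ _ _ _ HF X Y)). Qed.

(* The words in the goal are in normal form, so they do not unify with [_ ++ _]
   and the factors have to be read off from the term. *)
Ltac push_tens :=
  match goal with |- _ (@tens _ _ ?X ?Y ?X' ?Y' ?f ?g) = _ =>
    refine (etrans (@functor_tens _ _ _ _ HF X Y X' Y' f g) _);
    rewrite ?Ft ?F1; try reflexivity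
  end.

Lemma functor_mate B f : F (mate B f) = mate (fbase B) (F f).
Proof. by rewrite /mate !Fc; congr (_ ∘ _ ∘ _); push_tens. Qed.

Lemma functor_sigma B T : F (sigma_of B T) = sigma_of (fbase B) (F T).
Proof. by rewrite /sigma_of !Fc; congr (_ ∘ _ ∘ _); push_tens. Qed.

Lemma functor_delta B T : F (delta_of B T) = delta_of (fbase B) (F T).
Proof. by rewrite /delta_of !Fc; congr (_ ∘ _ ∘ _); push_tens. Qed.

Lemma functor_tauinv z B : F (tauinv z B) = tauinv z (fbase B).
Proof. by rewrite /tauinv FD FN FZ F1. Qed.

Lemma functor_sigmap B : F (sigmap B) = sigmap (fbase B).
Proof. exact: functor_sigma. Qed.

Lemma functor_sigmam z B : F (sigmam z B) = sigmam z (fbase B).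
Proof. by rewrite /sigmam functor_sigma functor_tauinv. Qed.

Lemma functor_deltap B : F (deltap B) = deltap (fbase B).
Proof. by rewrite /deltap functor_delta functor_sigmap. Qed.

Lemma functor_deltam z B : F (deltam z B) = deltam z (fbase B).
Proof. by rewrite /deltam functor_delta functor_sigmam. Qed.

Lemma functor_xpow B m : F (xpow B m) = xpow (fbase B) m.
Proof.
case: m => m /=; first by elim: m => [|m IH] /=; rewrite ?F1 // Fc IH.
by rewrite Fc; congr (_ ∘ _); elim: m => [|m IH] /=; rewrite ?F1 // Fc IH.
Qed.

Lemma functor_dx B m : F (dx B m) = dx (fbase B) m.
Proof.
rewrite /dx Fc; congr (_ ∘ _).
by push_tens; rewrite functor_xpow.
Qed.

Lemma functor_xc B m : F (xc B m) = xc (fbase B) m.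
Proof.
rewrite /xc Fc; congr (_ ∘ _).
by push_tens; rewrite functor_xpow.
Qed.

Section Params.
Variables (k : int) (z t : ring_unit R) (G : heis_data C).

Lemma functor_c'I : F (c'I k z t G) = c'I k z t (fdata G).
Proof.
rewrite /c'I; case: ifP => _; rewrite ?FZ ?Fc.
  by congr (_ *: _); congr (_ ∘ _); push_tens.
case: ifP => _; first by rewrite FZ Fc.
by rewrite FZ (Fc (gL G)) functor_xc.
Qed.

Lemma functor_d'I : F (d'I k z t G) = d'I k z t (fdata G).
Proof.
by rewrite /d'I; case: ifP => _; rewrite FZ // (Fc _ (gL G)) functor_dx.
Qed.

Lemma functor_LpI : F (LpI k z t G) = LpI k z t (fdata G).
Proof.
by rewrite /LpI; case: ifP => _; rewrite ?FD ?FZ ?Fc ?functor_c'I ?functor_d'I.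
Qed.

Lemma functor_LmI : F (LmI k z t G) = LmI k z t (fdata G).
Proof.
rewrite /LmI; case: ifP => _ //.
by rewrite ?FD ?FN ?FZ ?Fc ?functor_c'I ?functor_d'I.
Qed.

Lemma functor_namesI :
  same_names k (fnames (namesI k z t G)) (namesI k z t (fdata G)).
Proof.
split=> //=; [exact: functor_LpI | exact: functor_LmI | exact: functor_c'I
  | exact: functor_d'I | |] => a _; split=> //; case: ifP => // _.
  by rewrite FD FZ Fc functor_LmI.
by rewrite FD FZ Fc functor_LpI.
Qed.

Lemma functor_c'II : F (c'II k z t G) = c'II k z t (fdata G).
Proof.
by rewrite /c'II; case: ifP => _; rewrite FZ // (Fc (gL G)) functor_xc.
Qed.

Lemma functor_d'II : F (d'II k z t G) = d'II k z t (fdata G).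
Proof.
rewrite /d'II; case: ifP => _; first by rewrite FZ (Fc _ (gL G)) functor_dx.
case: ifP => _; rewrite FZ Fc //.
by congr (_ *: _); congr (_ ∘ _); push_tens; rewrite /yinv functor_mate.
Qed.

Lemma functor_LpII : F (LpII k z t G) = LpII k z t (fdata G).
Proof.
rewrite /LpII; case: ifP => _ //.
by rewrite ?FD ?FZ ?Fc ?functor_c'II ?functor_d'II.
Qed.

Lemma functor_LmII : F (LmII k z t G) = LmII k z t (fdata G).
Proof.
rewrite /LmII; case: ifP => _ //.
by rewrite ?FD ?FN ?FZ ?Fc ?functor_c'II ?functor_d'II.
Qed.

Lemma functor_namesII :
  same_names k (fnames (namesII k z t G)) (namesII k z t (fdata G)).
Proof.
split=> //=; [exact: functor_LpII | exact: functor_LmII | exact: functor_c'II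
  | exact: functor_d'II | |] => a _; split=> //; case: ifP => // _.
  by rewrite FD FN FZ Fc functor_LmII.
by rewrite FD FN FZ Fc functor_LpII.
Qed.

End Params.

(** Used mainly for three functors: evaluation out of the free category, where it says that
    evaluation descends to the quotient; the projection onto the quotient, where it holds by
    construction; and the identity, where it turns a model back into equality of related
    morphisms. *)
Definition obeys (r : hrel C) : Prop := forall X Y f g, r X Y f g -> F f = F g.

Lemma obeys_common z B : obeys (common_rel z B) <-> common z (fbase B).
Proof.
have [E1 E2] := (Fc (x B) (xinv B), Fc (xinv B) (x B)).
have E3 : F (tau B ∘ (I1 ⊗ x B) ∘ tau B)
    = F (tau B) ∘ (I1 ⊗ F (x B)) ∘ F (tau B).
  by rewrite !Fc; congr (_ ∘ _ ∘ _); push_tens.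
have E3' : F (x B ⊗ I1 : mor C [:: up; up] [:: up; up]) = F (x B) ⊗ I1.
  by push_tens.
have E4 : F (tau B ∘ tau B) = F (tau B) ∘ F (tau B) by apply: Fc.
have E4' : F (uval z *: tau B + idm [:: up; up])
    = uval z *: F (tau B) + idm [:: up; up] by rewrite FD FZ F1.
have El : F (tau B ⊗ I1 : mor C [:: up; up; up] [:: up; up; up])
    = F (tau B) ⊗ I1 by push_tens.
have Er : F (I1 ⊗ tau B : mor C [:: up; up; up] [:: up; up; up])
    = I1 ⊗ F (tau B) by push_tens.
have E5 (p q : mor C [:: up; up; up] [:: up; up; up]) :
  F (p ∘ q ∘ p) = F p ∘ F q ∘ F p by rewrite !Fc.
have E6 : F ((dd B ⊗ I1 : mor C [:: up; down; up] [:: up])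
    ∘ (I1 ⊗ cc B : mor C [:: up] [:: up; down; up]))
  = (F (dd B) ⊗ I1 : mor D [:: up; down; up] [:: up])
    ∘ (I1 ⊗ F (cc B) : mor D [:: up] [:: up; down; up]).
  by rewrite Fc; congr (_ ∘ _); push_tens.
have E7 : F ((J1 ⊗ dd B : mor C [:: down; up; down] [:: down])
    ∘ (cc B ⊗ J1 : mor C [:: down] [:: down; up; down]))
  = (J1 ⊗ F (dd B) : mor D [:: down; up; down] [:: down])
    ∘ (F (cc B) ⊗ J1 : mor D [:: down] [:: down; up; down]).
  by rewrite Fc; congr (_ ∘ _); push_tens.
split=> [H | [h1 h2 h3 h4 [h5 h6 h7]] X Y f g []].
- split; first by rewrite -E1 (H _ _ _ _ (RelXXinv z B)) F1.
  + by rewrite -E2 (H _ _ _ _ (RelXinvX z B)) F1.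
  + by rewrite -E3 (H _ _ _ _ (RelTauX z B)).
  + by rewrite -E4 (H _ _ _ _ (RelSkein z B)).
  split; first by rewrite -El -Er -!E5 (H _ _ _ _ (RelBraid z B)).
  + by rewrite -E6 (H _ _ _ _ (RelZigzagUp z B)) F1.
  + by rewrite -E7 (H _ _ _ _ (RelZigzagDown z B)) F1.
- by rewrite E1 F1.
- by rewrite E2 F1.
- by rewrite E3 E3'.
- by rewrite E4 E4'.
- by rewrite !E5 El Er.
- by rewrite E6 F1.
- by rewrite E7 F1.
Qed.

Lemma obeys_colinv X Y E n s f L g :
  obeys (@col_inv_rel R C X Y E n s f L g)
    <-> colinv n (F s) (fun a => F (f a)) (F L) (fun a => F (g a)).
Proof.
have E1 : F (L ∘ s + \sum_(a < n) g a ∘ f a)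
    = F L ∘ F s + \sum_(a < n) F (g a) ∘ F (f a).
  by rewrite FD Fc functor_sum; congr (_ + _); apply: eq_bigr => i _; apply: Fc.
split=> [H | [h1 h2 h3 h4 h5] X' Y' f' g' []].
- split; first by rewrite -E1 (H _ _ _ _ (ColInvl _ _ _ _ _)) F1.
  + by rewrite -Fc (H _ _ _ _ (ColInvLL _ _ _ _ _)) F1.
  + by move=> a an; rewrite -Fc (H _ _ _ _ (ColInvLg _ _ _ _ an)) F0.
  + by move=> a an; rewrite -Fc (H _ _ _ _ (ColInvfL _ _ _ _ an)) F0.
  + move=> a b an bn.
    by rewrite -Fc (H _ _ _ _ (ColInvfg _ _ _ _ an bn)) FZ F1.
- by rewrite E1 F1.
- by rewrite Fc F1.
- by move=> a an; rewrite Fc F0 h3.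
- by move=> a an; rewrite Fc F0 h4.
- by move=> a b an bn; rewrite Fc FZ F1 h5.
Qed.

Lemma obeys_rowinv X Y E n s f L g :
  obeys (@row_inv_rel R C X Y E n s f L g)
    <-> rowinv n (F s) (fun a => F (f a)) (F L) (fun a => F (g a)).
Proof.
have E1 : F (s ∘ L + \sum_(a < n) f a ∘ g a)
    = F s ∘ F L + \sum_(a < n) F (f a) ∘ F (g a).
  by rewrite FD Fc functor_sum; congr (_ + _); apply: eq_bigr => i _; apply: Fc.
split=> [H | [h1 h2 h3 h4 h5] X' Y' f' g' []].
- split; first by rewrite -E1 (H _ _ _ _ (RowInvr _ _ _ _ _)) F1.
  + by rewrite -Fc (H _ _ _ _ (RowInvLL _ _ _ _ _)) F1.
  + by move=> a an; rewrite -Fc (H _ _ _ _ (RowInvgs _ _ _ _ an)) F0.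
  + by move=> a an; rewrite -Fc (H _ _ _ _ (RowInvLf _ _ _ _ an)) F0.
  + move=> a b an bn.
    by rewrite -Fc (H _ _ _ _ (RowInvgf _ _ _ _ an bn)) FZ F1.
- by rewrite E1 F1.
- by rewrite Fc F1.
- by move=> a an; rewrite Fc F0 h3.
- by move=> a an; rewrite Fc F0 h4.
- by move=> a b an bn; rewrite Fc FZ F1 h5.
Qed.

Lemma obeys_eq X Y (f g : mor C X Y) : obeys (eq_rel f g) <-> F f = F g.
Proof. by split=> [|H X' Y' f' g' []]; first exact. Qed.

Lemma obeysI k z t G : obeys (relI k z t G) <-> modelI k z t (fdata G).
Proof.
have -> : obeys (relI k z t G) <->
    [/\ obeys (common_rel z G), obeys (inverse_relI k G)
      & obeys (bubble_relI k z t G)].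
  split=> [H | [h1 h2 h3] X Y f g [] {}X {}Y {}f {}g r].
  - by split=> X Y f g r; apply: H;
      [constructor 1 | constructor 2 | constructor 3].
  - exact: h1.
  - exact: h2.
  - exact: h3.
have E1 : obeys (inverse_relI k G) <->
    (if 0 <= k then
      colinv `|k| (sigmap (fdata G)) (fun a => dx (fdata G) a) (gL (fdata G))
        (geta (fdata G))
    else rowinv `|k| (sigmap (fdata G)) (fun a => xc (fdata G) a) (gL (fdata G))
        (geps (fdata G))).
  rewrite /inverse_relI; case: ifP => _.
    split=> [/obeys_colinv | H].
      rewrite functor_sigmap; apply: colinv_ext => // a _.
      by rewrite functor_dx.
    apply/obeys_colinv; rewrite functor_sigmap; apply: colinv_ext H => // a _.
    by rewrite functor_dx.
  split=> [/obeys_rowinv | H].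
    by rewrite functor_sigmap; apply: rowinv_ext => // a _; rewrite functor_xc.
  apply/obeys_rowinv; rewrite functor_sigmap; apply: rowinv_ext H => // a _.
  by rewrite functor_xc.
have E2 : obeys (bubble_relI k z t G) <->
    (if 0 < k then
      dd (fdata G) ∘ c'I k z t (fdata G) = (uval t * uinv z) *: idm [::]
    else if k == 0 then
      dd (fdata G) ∘ c'I k z t (fdata G)
        = (uval t * uinv z - uinv t * uinv z) *: idm [::]
    else d'I k z t (fdata G) ∘ xc (fdata G) (- k)
        = (uval t * uinv z) *: idm [::]).
  rewrite /bubble_relI -functor_c'I -functor_d'I -functor_xc.
  by do 2?[case: ifP => _];
    rewrite obeys_eq (Fc (dd _), Fc (d'I _ _ _ _)) FZ F1.
rewrite /modelI; split=> [[/obeys_common h1 /E1 h2 /E2 h3] | [h1 h2 h3]] //.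
by split; [apply/obeys_common | apply/E1 | apply/E2].
Qed.

Lemma obeysII k z t G : obeys (relII k z t G) <-> modelII k z t (fdata G).
Proof.
have -> : obeys (relII k z t G) <->
    [/\ obeys (common_rel z G), obeys (inverse_relII k z G)
      & obeys (bubble_relII k z t G)].
  split=> [H | [h1 h2 h3] X Y f g [] {}X {}Y {}f {}g r].
  - by split=> X Y f g r; apply: H;
      [constructor 1 | constructor 2 | constructor 3].
  - exact: h1.
  - exact: h2.
  - exact: h3.
have E1 : obeys (inverse_relII k z G) <->
    (if 0 < k then
      colinv `|k| (sigmam z (fdata G)) (fun a => dx (fdata G) a) (gL (fdata G))
        (geta (fdata G))
    else rowinv `|k| (sigmam z (fdata G)) (fun a => xc (fdata G) a)
        (gL (fdata G)) (geps (fdata G))).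
  rewrite /inverse_relII; case: ifP => _.
    split=> [/obeys_colinv | H].
      rewrite functor_sigmam; apply: colinv_ext => // a _.
      by rewrite functor_dx.
    apply/obeys_colinv; rewrite functor_sigmam; apply: colinv_ext H => // a _.
    by rewrite functor_dx.
  split=> [/obeys_rowinv | H].
    by rewrite functor_sigmam; apply: rowinv_ext => // a _; rewrite functor_xc.
  apply/obeys_rowinv; rewrite functor_sigmam; apply: rowinv_ext H => // a _.
  by rewrite functor_xc.
have E2 : obeys (bubble_relII k z t G) <->
    (if 0 < k then
      dx (fdata G) k ∘ c'II k z t (fdata G) = - (uinv t * uinv z) *: idm [::]
    else if k == 0 then
      d'II k z t (fdata G) ∘ cc (fdata G)
        = (uval t * uinv z - uinv t * uinv z) *: idm [::]
    else d'II k z t (fdata G) ∘ cc (fdata G)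
        = - (uinv t * uinv z) *: idm [::]).
  rewrite /bubble_relII -functor_c'II -functor_d'II -functor_dx.
  by do 2?[case: ifP => _];
    rewrite obeys_eq (Fc (dx _ _), Fc (d'II _ _ _ _)) FZ F1.
rewrite /modelII; split=> [[/obeys_common h1 /E1 h2 /E2 h3] | [h1 h2 h3]] //.
by split; [apply/obeys_common | apply/E1 | apply/E2].
Qed.

End FunctorData.

(** * Equivalence of the two definitions *)

Section ColumnInverse.
Variables (R : comPzRingType) (C : slmcat R) (X Y E : word).
Implicit Types (s : mor C X Y) (L : mor C Y X) (f : nat -> mor C X E)
  (g : nat -> mor C E X).

(** The column is multiplied from the left by an elementary matrix, so its inverse is multiplied
    from the right by the inverse matrix, which alters only the entry [g 0]. Hence [L] survives the
    passage between M_+ and M_-. *)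
Lemma colinv_row_operation n s s' f L g (z : R) (c : mor C E Y) :
  (0 < n)%N -> s' = s - z *: (c ∘ f 0%N) -> colinv n s f L g ->
  colinv n s' f L
    (fun a => if a == 0%N then g 0%N + z *: (L ∘ c) else g a).
Proof.
case: n => // n _ -> [h1 h2 h3 h4 h5]; split=> //.
- rewrite -[RHS]h1 !big_ord_recl /= compDr compNr compZr compDl compZl compA.
  by rewrite -addrA [- _ + _]addrA [- _ + _]addrC addrK.
- by rewrite compDl compNl compZl h2 -compA h4 // comp0r scaler0 subr0.
- move=> a an; rewrite compDl compNl compZl -compA; case: eqP => [_|/eqP a0].
    rewrite !compDr h3 // h5 //= !compZr [s ∘ _]compA [f _ ∘ _]compA h2 h4 //.
    by rewrite comp0l comp1m comp0r !scaler0 addr0 compm1 scale1r add0r subrr.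
  by rewrite h3 // h5 // eq_sym (negbTE a0) scale0r comp0r scaler0 subr0.
- move=> a b an bn; case: eqP => [->|_]; last exact: h5.
  by rewrite compDr compZr compA h4 // comp0l scaler0 addr0 h5.
Qed.

(** The row is a left inverse of the column, so a morphism into [X] is recovered from its product
    with the column; here the product is [r] times a unit vector. *)
Lemma colinv_eq n s f L g (b : nat) (r : R) (h : mor C E X) :
  (b < n)%N -> colinv n s f L g -> s ∘ h = 0 ->
  (forall a, (a < n)%N -> f a ∘ h = (if a == b then r else 0) *: idm E) ->
  h = r *: g b.
Proof.
move=> bn [h1 _ _ _ _] sh fh.
rewrite -[h]comp1m -h1 compDl -compA sh comp0r add0r comp_suml.
rewrite (bigD1 (Ordinal bn)) //= -compA fh // eqxx compZr compm1.
rewrite big1 ?addr0 // => i; rewrite -val_eqE /= => ib.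
by rewrite -compA fh // (negbTE ib) scale0r comp0r.
Qed.

Lemma colinv_unique n s f L L' g g' :
  colinv n s f L g -> colinv n s f L' g' ->
  L = L' /\ forall a, (a < n)%N -> g a = g' a.
Proof.
move=> H [h1 h2 h3 h4 h5]; have [k1 k2 k3 k4 k5] := H; split=> [|a an].
  rewrite -[RHS]comp1m -k1 compDl -compA h2 compm1 comp_suml big1 ?addr0 //.
  by move=> i _; rewrite -compA h4 ?comp0r.
rewrite (colinv_eq (r := 1) an H (h3 a an)) ?scale1r // => b bn.
by rewrite h5 //; case: eqP.
Qed.

Lemma colinv_opp n s f L g : colinv n s f L g -> colinv n (- s) f (- L) g.
Proof.
case=> h1 h2 h3 h4 h5; split=> //.
- by rewrite compNl compNr opprK.
- by rewrite compNl compNr opprK.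
- by move=> a an; rewrite compNl h3 ?oppr0.
- by move=> a an; rewrite compNr h4 ?oppr0.
Qed.

End ColumnInverse.

Section RowInverse.
Variables (R : comPzRingType) (C : slmcat R) (X Y E : word).
Implicit Types (s : mor C X Y) (L : mor C Y X) (f : nat -> mor C E Y)
  (g : nat -> mor C Y E).

Lemma rowinv_op n s f L g :
  rowinv n s f L g <-> @colinv R (opcat C) Y X E n s f L g.
Proof.
split=> [] [h1 h2 h3 h4 h5]; split=> // a b an bn; rewrite eq_sym;
  exact: h5.
Qed.

Lemma rowinv_column_operation n s s' f L g (z : R) (d : mor C X E) :
  (0 < n)%N -> s' = s - z *: (f 0%N ∘ d) -> rowinv n s f L g ->
  rowinv n s' f L
    (fun a => if a == 0%N then g 0%N + z *: (d ∘ L) else g a).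
Proof.
move=> n0 e /rowinv_op H; apply/rowinv_op.
exact: (@colinv_row_operation _ (opcat C) _ _ _ _ _ _ _ _ _ z d n0 e H).
Qed.

Lemma rowinv_eq n s f L g (b : nat) (r : R) (h : mor C Y E) :
  (b < n)%N -> rowinv n s f L g -> h ∘ s = 0 ->
  (forall a, (a < n)%N -> h ∘ f a = (if a == b then r else 0) *: idm E) ->
  h = r *: g b.
Proof.
move=> bn /rowinv_op H.
exact: (@colinv_eq _ (opcat C) _ _ _ _ _ _ _ _ b r h bn H).
Qed.

Lemma rowinv_unique n s f L L' g g' :
  rowinv n s f L g -> rowinv n s f L' g' ->
  L = L' /\ forall a, (a < n)%N -> g a = g' a.
Proof.
move=> /rowinv_op H /rowinv_op H'.
exact: (@colinv_unique _ (opcat C) _ _ _ _ _ _ _ _ _ _ H H').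
Qed.

End RowInverse.

(** * Rank one perturbation at charge zero *)

Section ZeroCharge.
Variables (R : comPzRingType) (C : slmcat R) (X Y E : word).
Variables (z zi t ti : R) (zK : z * zi = 1) (tK : t * ti = 1).
Variables (s : mor C X Y) (L : mor C Y X) (c : mor C E Y) (d : mor C X E).
Local Notation c' := (t *: (L ∘ c)).
Local Notation d' := (t *: (d ∘ L)).
Local Notation s' := (s - z *: (c ∘ d)).
Local Notation L' := (L + z *: (c' ∘ d')).
Hypotheses (sL : s ∘ L = idm Y) (Ls : L ∘ s = idm X).
Hypothesis dc' : d ∘ c' = (t * zi - ti * zi) *: idm E.

Lemma zero_charge_cap : d' ∘ c = (t * zi - ti * zi) *: idm E.
Proof. by rewrite -dc' compZl compZr compA. Qed.

Let dLc : d ∘ L ∘ c = (zi - ti * ti * zi) *: idm E.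
Proof.
have := congr1 (fun f => ti *: f) dc'.
rewrite compZr !scalerA [ti * t]mulrC tK scale1r compA => ->.
congr (_ *: _); ring: tK.
Qed.

Lemma zero_charge_cup : L' ∘ c = t *: c'.
Proof.
rewrite compDl !(compZl, compZr) -!compA [d ∘ _]compA dLc !compZr compm1.
rewrite !scalerA -{1}[L ∘ c]scale1r -scalerDl.
by congr (_ *: _); ring: zK tK.
Qed.

Lemma zero_charge_dcup : d ∘ L' = t *: d'.
Proof.
rewrite compDr !(compZl, compZr) !compA dLc !compZl comp1m.
rewrite !scalerA -{1}[d ∘ L]scale1r -scalerDl.
by congr (_ *: _); ring: zK tK.
Qed.

(** The Sherman-Morrison formula: the inverse of [s - z c d] is [L + z (1 - z d L c)^-1 L c d L].
    The bubble relation gives [z d L c] the value [1 - t^-2], so the middle factor is [t^2], the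
    product of the coefficients of [c'] and [d']. *)
Lemma zero_charge_invr : s' ∘ L' = idm Y.
Proof.
rewrite compDl compNl (compZl z (c ∘ d)) -(compA c d) zero_charge_dcup.
rewrite compDr sL.
rewrite !(compZl, compZr) !compA sL comp1m -!compA !scalerA -addrA -scalerBl.
by rewrite [_ - _](_ : _ = 0) ?scale0r ?addr0 //; ring: tK.
Qed.

Lemma zero_charge_invl : L' ∘ s' = idm X.
Proof.
rewrite compDr compNr (compZr z _ (c ∘ d)) (compA _ c d) zero_charge_cup.
rewrite compDl Ls.
rewrite !(compZl, compZr) -!compA Ls compm1 !scalerA -addrA -scalerBl.
by rewrite [_ - _](_ : _ = 0) ?scale0r ?addr0 //; ring: tK.
Qed.

End ZeroCharge.

(** * Passage between the two definitions *)

Section Conversion.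
Variables (R : comPzRingType) (C : slmcat R) (k : int) (z t : ring_unit R).
Local Notation zi := (uinv z).
Local Notation ti := (uinv t).
Local Notation n := (absz k).

Lemma commonP (B : base C) : common z B ->
  forall X Y (f g : mor C X Y), common_rel z B f g -> f = g.
Proof.
move=> BH.
have BH' : common z (fbase (fun X Y (f : mor C X Y) => f) B) := BH.
exact: (obeys_common (functor_id_fun C) z B).2 BH'.
Qed.

Section Powers.
Variable B : base C.
Hypothesis BH : common z B.

Lemma xpowSr (m : nat) : xpow B m.+1 = xpow B m ∘ x B.
Proof.
elim: m => [|m IH] /=; first by rewrite comp1m compm1.
by rewrite -compA -IH.
Qed.

Lemma dxS (m : nat) : dx B m.+1 = dx B m ∘ at1 (x B) [:: down].
Proof.
rewrite /dx xpowSr -compA; congr (_ ∘ _).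
exact: (tens_compl [:: down] (xpow B m) (x B)).
Qed.

Lemma dx0 : dx B 0 = dd B.
Proof. by rewrite /dx /= (@tens_id R C [:: up] [:: down]) compm1. Qed.

Lemma xc0 : xc B 0 = cc B.
Proof. by rewrite /xc /= (@tens_id R C [:: down] [:: up]) comp1m. Qed.

Lemma xcS (m : nat) : xc B m.+1 = at1 (y B) [:: up] ∘ xc B m.
Proof.
rewrite /xc xpowSr -[J1 ⊗ _]/(lw down _) lw_comp -compA.
by rewrite (dot_cup (commonP BH)) !compA at1_nat.
Qed.

Lemma at1_inv a (f g : mor C [:: a] [:: a]) X :
  f ∘ g = idm [:: a] -> at1 f X ∘ at1 g X = idm (a :: X).
Proof.
move=> e; have := tens_compl X f g; rewrite e => <-.
exact: (@tens_id R C [:: a]).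
Qed.

Lemma lw_inv a X Y (f : mor C Y X) (g : mor C X Y) :
  f ∘ g = idm X -> lw a f ∘ lw a g = idm (a :: X).
Proof. by move=> e; rewrite -lw_comp e lw_id. Qed.

Lemma comp_can_l X Y Z (f : mor C X Y) (f' : mor C Y X) (g h : mor C Z X) :
  f' ∘ f = idm X -> f ∘ g = f ∘ h -> g = h.
Proof. by move=> e /(congr1 (mcomp f')); rewrite !compA e !comp1m. Qed.

Lemma sigmam_dot_up :
  sigmam z B ∘ at1 (xinv B) [:: down] = lw down (xinv B) ∘ sigmap B.
Proof.
case: (BH) => xK Kx _ _ _.
move: (sigmap B) (sigmam z B) (sigma_dot_up (commonP BH)) => sp sm E.
apply: (comp_can_l (lw_inv down Kx)).
by rewrite !compA -E (lw_inv down xK) comp1m -compA (at1_inv _ xK) compm1.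
Qed.

Lemma sigma_dot_downV :
  at1 (yinv B) [:: up] ∘ sigmap B = sigmam z B ∘ lw up (yinv B).
Proof.
move: (sigmap B) (sigmam z B) (sigma_dot_down (commonP BH)) => sp sm E.
apply: (comp_can_l (at1_inv _ (yK (commonP BH)))).
rewrite !compA -E (at1_inv _ (yVK (commonP BH))) comp1m -compA.
by rewrite (lw_inv up (yVK (commonP BH))) compm1.
Qed.

End Powers.

(** What a definition adjoins, read off from the full list of names. At charge zero Definition I
    adjoins [Lm] and Definition II adjoins [Lp], whence the test [0 <= k] here and [0 < k] in
    [dataII_of]. *)
Definition dataI_of (N : heis_names C) : heis_data C :=
  HeisData (nbase N) (if 0 <= k then Lm N else Lp N) (eta_dia N) (eps_heart N).

Definition dataII_of (N : heis_names C) : heis_data C :=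
  HeisData (nbase N) (if 0 < k then Lm N else Lp N) (eta_heart N) (eps_dia N).

(** The corrections of the entries of index 0 in the two definitions undo each other, and both use
    the same skein relation; so all names agree once [c'] and [d'] do. *)
Lemma same_names_dataII (G : heis_data C) (G' := dataII_of (namesI k z t G)) :
  c'II k z t G' = c'I k z t G -> d'II k z t G' = d'I k z t G ->
  same_names k (namesII k z t G') (namesI k z t G).
Proof.
move=> ec ed.
have eLp : LpII k z t G' = LpI k z t G.
  rewrite /LpII ec ed /= /LmI /LpI; case: (ltP 0 k) => // k0.
  by rewrite ltW.
have eLm : LmII k z t G' = LmI k z t G.
  rewrite /LmII ec ed /= /LmI /LpI; case: (ltP 0 k) => // k0.
  by case: ifP => // _; rewrite addrK.
split=> // a _ /=; rewrite ?eLp ?eLm; split=> //; case: eqP => [->|] //.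
  by rewrite addrK.
by rewrite addrK.
Qed.

Lemma same_names_dataI (G : heis_data C) (G' := dataI_of (namesII k z t G)) :
  c'I k z t G' = c'II k z t G -> d'I k z t G' = d'II k z t G ->
  same_names k (namesI k z t G') (namesII k z t G).
Proof.
move=> ec ed.
have eLp : LpI k z t G' = LpII k z t G.
  rewrite /LpI ec ed /= /LmII /LpII; case: (leP 0 k) => k0.
    by case: ifP => // _; rewrite subrK.
  by rewrite ltNge (ltW k0).
have eLm : LmI k z t G' = LmII k z t G.
  rewrite /LmI ec ed /= /LmII /LpII; case: (leP 0 k) => k0 //.
  by rewrite ltNge (ltW k0).
split=> // a _ /=; rewrite ?eLp ?eLm; split=> //; case: eqP => [->|] //.
  by rewrite subrK.
by rewrite subrK.
Qed.

Lemma sigmamE (B : base C) : common z B ->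
  sigmam z B = sigmap B - uval z *: (cc B ∘ dd B).
Proof. by move=> /commonP BH; rewrite -(sigma_skein z B) opprB addrC subrK. Qed.

Lemma sigmapE (B : base C) : common z B ->
  sigmap B = sigmam z B - (- uval z) *: (cc B ∘ dd B).
Proof. by move=> BH; rewrite sigmamE // scaleNr opprK subrK. Qed.

Lemma dxV (B : base C) (m : nat) : common z B ->
  dx B m.+1 ∘ at1 (xinv B) [:: down] = dx B m.
Proof. by case=> xK _ _ _ _; rewrite dxS -compA (at1_inv _ xK) compm1. Qed.

Lemma xcV (B : base C) (m : nat) : common z B ->
  at1 (yinv B) [:: up] ∘ xc B m.+1 = xc B m.
Proof.
by move=> BH; rewrite xcS // compA (at1_inv _ (yK (commonP BH))) comp1m.
Qed.

Lemma modelI_II_pos (G : heis_data C) (G' := dataII_of (namesI k z t G)) :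
  0 < k -> modelI k z t G ->
  [/\ modelII k z t G', c'II k z t G' = c'I k z t G
    & d'II k z t G' = d'I k z t G].
Proof.
move=> k0; rewrite /modelI /modelII k0 (ltW k0) => -[BH HM Hb].
have n0 : (0 < n)%N by lia.
have kE : dx G k = dx G n.-1.+1 by congr dx; lia.
have [_ _ h3 _ h5] := HM.
have e : sigmam z G = sigmap G - uval z *: (cc G ∘ dx G 0%N).
  by rewrite [dx G _]dx0; apply: sigmamE.
have HM' := colinv_row_operation n0 e HM.
set g' := (fun a => if _ then _ else _) in HM'.
(* Multiply [c'] by M_-. Passing the inverse dot, [sigmam] becomes [sigmap], which kills the last
   [eta]. Index 0 is the bubble relation; at a positive index the inverse dot lowers the power by
   one, and the result pairs to zero with the last [eta]. *)
have ec : c'I k z t G = (uval t * zi) *: g' 0%N.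
  apply: (colinv_eq n0 HM').
    rewrite /c'I k0 compZr compA (sigmam_dot_up BH) -compA h3; last by lia.
    by rewrite comp0r scaler0.
  case=> [|a] an; first by rewrite [dx G _]dx0 Hb.
  rewrite /c'I k0 compZr compA dxV // h5; try lia.
  have -> : (a == n.-1) = false by lia.
  by rewrite !scale0r scaler0.
have eL : LmI k z t G = gL G by rewrite /LmI ltW.
have ec' : c'II k z t G' = c'I k z t G by rewrite ec /c'II k0 /= eL.
split=> //; last by rewrite /d'II /d'I k0 (ltW k0) /= k0 eL.
split=> //.
  by rewrite /= k0 eL; apply: colinv_ext HM' => // a _; rewrite /g' eL.
(* The inverse dot lowers the power from [k] to [k - 1], which pairs to 1 with the last [eta]. *)
rewrite ec' /c'I k0 -[dx G' k]/(dx G k) kE.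
rewrite compZr compA dxV // h5 ?eqxx ?scale1r //; lia.
Qed.

Lemma modelII_I_pos (G : heis_data C) (G' := dataI_of (namesII k z t G)) :
  0 < k -> modelII k z t G ->
  [/\ modelI k z t G', c'I k z t G' = c'II k z t G
    & d'I k z t G' = d'II k z t G].
Proof.
move=> k0; rewrite /modelI /modelII k0 (ltW k0) => -[BH HM Hb].
have n0 : (0 < n)%N by lia.
have kE : dx G k = dx G n.-1.+1 by congr dx; lia.
have [_ Kx _ _ _] := BH.
have [_ _ h3 _ h5] := HM.
have e : sigmap G = sigmam z G - (- uval z) *: (cc G ∘ dx G 0%N).
  by rewrite [dx G _]dx0; apply: sigmapE.
have HM' := colinv_row_operation n0 e HM.
set g' := (fun a => if _ then _ else _) in HM'.
have c'E : c'II k z t G = (uval t * zi) *: geta G 0 by rewrite /c'II k0.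
(* Definition I builds [c'] with an inverse dot, so a dot is added before comparing with the last
   entry of the inverse of M_+. It raises the powers: index [k - 1] meets the bubble relation, lower
   indices pair to zero with the entry of index 0. *)
have ec : at1 (x G) [:: down] ∘ c'II k z t G = - (ti * zi) *: g' n.-1.
  apply: (colinv_eq _ HM'); first by lia.
    rewrite compA (sigma_dot_up (commonP BH)) -compA c'E compZr h3 //.
    by rewrite scaler0 comp0r.
  move=> a an; rewrite compA -dxS; case: eqP => [-> | an'].
    by rewrite -kE Hb.
  by rewrite c'E compZr h5 //; try lia; rewrite !scale0r scaler0.
have eL : LmII k z t G = gL G by rewrite /LmII k0.
have eg a : geta G' a = g' a by rewrite /= eL /g'; case: ifP; rewrite ?scaleNr.
have ec' : c'I k z t G' = c'II k z t G.
  rewrite /c'I k0 eg -compZr -ec -[_ ⊗ _]/(at1 (xinv G) [:: down]) compA.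
  by rewrite (at1_inv _ Kx) comp1m.
split=> //; last by rewrite /d'II /d'I k0 (ltW k0) /= (ltW k0) eL.
split=> //.
  rewrite /= (ltW k0) eL; apply: colinv_ext HM' => // a _.
  by rewrite /g' scaleNr.
rewrite ec' c'E compZr -[dd _](dx0 G) h5 ?eqxx ?scale1r //; lia.
Qed.

(** Mirror image of [modelII_I_pos]: reversed composition exchanges column and row, and by [xcS] the
    dots sit on the downward strand. *)
Lemma modelI_II_neg (G : heis_data C) (G' := dataII_of (namesI k z t G)) :
  k < 0 -> modelI k z t G ->
  [/\ modelII k z t G', c'II k z t G' = c'I k z t G
    & d'II k z t G' = d'I k z t G].
Proof.
move=> k0; have [k1 k2 k3] :
  [/\ (0 <= k) = false, (0 < k) = false & (k == 0) = false] by split; lia.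
rewrite /modelI /modelII k1 k2 k3 => -[BH HM Hb].
have n0 : (0 < n)%N by lia.
have kE : xc G (- k) = xc G n.-1.+1 by congr xc; lia.
have [_ _ h3 _ h5] := HM.
have e : sigmam z G = sigmap G - uval z *: (xc G 0%N ∘ dd G).
  by rewrite [xc G _]xc0; apply: sigmamE.
have HM' := rowinv_column_operation n0 e HM.
set g' := (fun a => if _ then _ else _) in HM'.
have d'E : d'I k z t G = - (ti * zi) *: geps G 0 by rewrite /d'I k1.
(* The dot is there to cancel the [yinv] in [d'II]. *)
have ed : d'I k z t G ∘ at1 (y G) [:: up] = (uval t * zi) *: g' n.-1.
  apply: (rowinv_eq _ HM'); first by lia.
    rewrite -compA -(sigma_dot_down (commonP BH)) compA d'E compZl h3 //.
    by rewrite scaler0 comp0l.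
  move=> a an; rewrite -compA -xcS //; case: eqP => [-> | an'].
    by rewrite -kE Hb.
  by rewrite d'E compZl h5 //; try lia; rewrite !scale0r scaler0.
have eL : LpI k z t G = gL G by rewrite /LpI k1.
have eg a : geps G' a = g' a by rewrite /= eL /g'.
have ed' : d'II k z t G' = d'I k z t G.
  rewrite /d'II k2 k3 eg -compZl -ed -[_ ⊗ _]/(at1 (yinv G) [:: up]) -compA.
  by rewrite (at1_inv _ (yVK (commonP BH))) compm1.
split=> //; last by rewrite /c'II /c'I k2 k3 /= k2 eL.
split=> //; first by rewrite /= k2 eL; apply: rowinv_ext HM'.
rewrite ed' d'E compZl -[cc _](xc0 G) h5 ?eqxx ?scale1r //; lia.
Qed.

Lemma modelII_I_neg (G : heis_data C) (G' := dataI_of (namesII k z t G)) :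
  k < 0 -> modelII k z t G ->
  [/\ modelI k z t G', c'I k z t G' = c'II k z t G
    & d'I k z t G' = d'II k z t G].
Proof.
move=> k0; have [k1 k2 k3] :
  [/\ (0 <= k) = false, (0 < k) = false & (k == 0) = false] by split; lia.
rewrite /modelI /modelII k1 k2 k3 => -[BH HM Hb].
have n0 : (0 < n)%N by lia.
have kE : xc G (- k) = xc G n.-1.+1 by congr xc; lia.
have [_ _ h3 _ h5] := HM.
have e : sigmap G = sigmam z G - (- uval z) *: (xc G 0%N ∘ dd G).
  by rewrite [xc G _]xc0; apply: sigmapE.
have HM' := rowinv_column_operation n0 e HM.
set g' := (fun a => if _ then _ else _) in HM'.
have d'E : d'II k z t G = (uval t * zi) *: (geps G n.-1 ∘ at1 (yinv G) [:: up]).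
  by rewrite /d'II k2 k3.
(* The inverse dot turns [sigmap] into [sigmam], which the last [eps] kills. It also lowers the
   powers, so positive indices pair to zero with the last [eps], and index 0 is the bubble
   relation. *)
have ed : d'II k z t G = - (ti * zi) *: g' 0%N.
  apply: (rowinv_eq n0 HM').
    rewrite d'E compZl -compA (sigma_dot_downV BH) compA h3; last by lia.
    by rewrite comp0l scaler0.
  case=> [|a] an; first by rewrite [xc G _]xc0 Hb.
  rewrite d'E compZl -compA xcV // h5; try lia.
  have -> : (n.-1 == a) = false by lia.
  by rewrite !scale0r scaler0.
have eL : LpII k z t G = gL G by rewrite /LpII k2.
have eg a : geps G' a = g' a by rewrite /= eL /g'; case: ifP; rewrite ?scaleNr.
have ed' : d'I k z t G' = d'II k z t G by rewrite ed /d'I k1 eg.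
split=> //; last by rewrite /c'II /c'I k2 k3 /= k1 eL.
split=> //.
  rewrite /= k1 eL; apply: rowinv_ext HM' => // a _.
  by rewrite /g' scaleNr.
rewrite ed' d'E compZl -compA -[xc G' _]/(xc G _) kE xcV //.
by rewrite h5 ?eqxx ?scale1r //; lia.
Qed.

Lemma modelI_II_zero (G : heis_data C) (G' := dataII_of (namesI k z t G)) :
  k = 0 -> modelI k z t G ->
  [/\ modelII k z t G', c'II k z t G' = c'I k z t G
    & d'II k z t G' = d'I k z t G].
Proof.
move=> k0; have [k1 k2 k3 n0] :
  [/\ 0 <= k, (0 < k) = false, k == 0 & n = 0%N] by rewrite k0.
rewrite /modelI /modelII k1 k2 k3 n0 => -[BH [h1 h2 _ _ _] Hb].
rewrite big_ord0 addr0 in h1.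
have xE : xc G (- k) = cc G by rewrite k0; apply: xc0.
have dE : dx G k = dd G by rewrite k0; apply: dx0.
have ec : c'I k z t G = uval t *: (gL G ∘ cc G) by rewrite /c'I k2 k3.
have ed : d'I k z t G = uval t *: (dd G ∘ gL G) by rewrite /d'I k1 dE.
have eL : LpI k z t G = gL G + uval z *: (c'I k z t G ∘ d'I k z t G).
  by rewrite /LpI k1.
rewrite ec in Hb.
have [zK tK] := (uvalK z, uvalK t).
have ec' : c'II k z t G' = c'I k z t G.
  rewrite /c'II k2 /= k2 xE eL ec ed (zero_charge_cup zK tK Hb).
  by rewrite scalerA mulrC tK scale1r.
have ed' : d'II k z t G' = d'I k z t G.
  rewrite /d'II k2 k3 /= k2 eL ec ed (zero_charge_dcup zK tK Hb).
  by rewrite scalerA mulrC tK scale1r.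
split=> //; split=> //.
  rewrite /= k2 eL ec ed (sigmamE BH); split=> //.
    by rewrite big_ord0 addr0 (zero_charge_invr zK tK).
  by rewrite (zero_charge_invl zK tK).
by rewrite ed' ed (zero_charge_cap Hb).
Qed.

Lemma modelII_I_zero (G : heis_data C) (G' := dataI_of (namesII k z t G)) :
  k = 0 -> modelII k z t G ->
  [/\ modelI k z t G', c'I k z t G' = c'II k z t G
    & d'I k z t G' = d'II k z t G].
Proof.
move=> k0; have [k1 k2 k3 n0] :
  [/\ 0 <= k, (0 < k) = false, k == 0 & n = 0%N] by rewrite k0.
rewrite /modelI /modelII k1 k2 k3 n0 => -[BH [h1 h2 _ _ _] Hb].
rewrite big_ord0 addr0 in h1.
have xE : xc G (- k) = cc G by rewrite k0; apply: xc0.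
have dE : dx G k = dd G by rewrite k0; apply: dx0.
have ec : c'II k z t G = ti *: (gL G ∘ cc G) by rewrite /c'II k2 xE.
have ed : d'II k z t G = ti *: (dd G ∘ gL G) by rewrite /d'II k2 k3.
have eL : LmII k z t G = gL G + (- uval z) *: (c'II k z t G ∘ d'II k z t G).
  by rewrite /LmII k2 scaleNr.
(* The charge zero argument is applied with [-z] and [t^-1] in place of [z] and [t], which leaves
   the scalar [t z^-1 - t^-1 z^-1] unchanged. *)
have zK : (- uval z) * (- zi) = 1 by rewrite mulrNN uvalK.
have tK : ti * uval t = 1 by rewrite mulrC uvalK.
have {}Hb : dd G ∘ (ti *: (gL G ∘ cc G))
    = (ti * - zi - uval t * - zi) *: idm [::].
  by rewrite ed in Hb; rewrite compZr compA -compZl Hb !mulrN opprK addrC.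
have ec' : c'I k z t G' = c'II k z t G.
  rewrite /c'I k2 k3 /= k1 eL ec ed (zero_charge_cup zK tK Hb).
  by rewrite scalerA mulrC tK scale1r.
have ed' : d'I k z t G' = d'II k z t G.
  rewrite /d'I k1 /= k1 -[dx G' k]/(dx G k) dE eL ec ed.
  by rewrite (zero_charge_dcup zK tK Hb) scalerA mulrC tK scale1r.
split=> //; split=> //.
  rewrite /= k1 eL ec ed (sigmapE BH); split=> //.
    by rewrite big_ord0 addr0 (zero_charge_invl zK tK).
  by rewrite (zero_charge_invr zK tK).
by rewrite ec' ec Hb !mulrN opprK addrC.
Qed.

Lemma modelI_II (G : heis_data C) (G' := dataII_of (namesI k z t G)) :
  modelI k z t G ->
  modelII k z t G' /\ same_names k (namesII k z t G') (namesI k z t G).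
Proof.
move=> HG; suff [h1 h2 h3] : [/\ modelII k z t G', c'II k z t G' = c'I k z t G
    & d'II k z t G' = d'I k z t G] by split=> //; apply: same_names_dataII.
case: (ltgtP k 0) => k0; [exact: modelI_II_neg | exact: modelI_II_pos |].
exact: modelI_II_zero.
Qed.

Lemma modelII_I (G : heis_data C) (G' := dataI_of (namesII k z t G)) :
  modelII k z t G ->
  modelI k z t G' /\ same_names k (namesI k z t G') (namesII k z t G).
Proof.
move=> HG; suff [h1 h2 h3] : [/\ modelI k z t G', c'I k z t G' = c'II k z t G
    & d'I k z t G' = d'II k z t G] by split=> //; apply: same_names_dataI.
case: (ltgtP k 0) => k0; [exact: modelII_I_neg | exact: modelII_I_pos |].
exact: modelII_I_zero.
Qed.

End Conversion.

(** * Rotation by 180 degrees *)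

Section Flip.
Variables (R : comPzRingType) (C : slmcat R) (z : ring_unit R).

Local Notation fl := (swapcat (opcat C)).
Local Notation u := (lw up).
Local Notation v := (lw down).

Definition flip_base (B : base C) : base fl :=
  @Base R fl (y B) (yinv B) (- deltam z B) (dd B) (cc B).

Lemma flip_sigmaE (B : base C) (T : mor fl [:: up; up] [:: up; up]) :
  sigma_of (flip_base B) T
    = atcap (dd B) [:: down; up]
        ∘ u (at2 (T : mor C [:: down; down] [:: down; down]) [:: up])
        ∘ u (v (cc B)).
Proof.
rewrite -[RHS]compA [u (_ (cc B))]tens_lw.
have E1 := tensA_cast (dd B) J1 I1 erefl erefl.
have E2 := tensA_cast I1 (T : mor C [:: down; down] [:: down; down]) I1
  erefl erefl.
have E3 := tens_id C [:: up] [:: down].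
(* On explicit words the casts in [stens] compute away and composition is reversed, so this equation
   in [C] is the goal up to conversion. *)
suff E : (dd B ⊗ J1 ⊗ I1 : mor C [:: up; down; down; up] [:: down; up])
  ∘ ((I1 ⊗ (T : mor C [:: down; down] [:: down; down]) ⊗ I1
      : mor C [:: up; down; down; up] [:: up; down; down; up])
  ∘ (I1 ⊗ J1 ⊗ cc B : mor C [:: up; down] [:: up; down; down; up]))
  = atcap (dd B) [:: down; up]
    ∘ (u (at2 (T : mor C [:: down; down] [:: down; down]) [:: up])
      ∘ (idm [:: up; down] ⊗ cc B
          : mor C [:: up; down] [:: up; down; down; up])) by exact: E.
congr (_ ∘ _); last congr (_ ∘ _).
- by refine (etrans E1 _); rewrite /= tens_id.
- exact: E2.
- exact: (congr1 (fun f : mor C [:: up; down] [:: up; down] => f ⊗ cc B) E3).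
Qed.

Lemma flip_deltaE (B : base C) (S : mor fl [:: up; down] [:: down; up]) :
  delta_of (flip_base B) S
    = atcap (dd B) [:: up; up]
        ∘ u (at2 (S : mor C [:: up; down] [:: down; up]) [:: up])
        ∘ u (u (cc B)).
Proof.
rewrite -[RHS]compA [u (_ (cc B))]tens_lw.
have E1 := tensA_cast (dd B) I1 I1 erefl erefl.
have E2 := tensA_cast I1 (S : mor C [:: up; down] [:: down; up]) I1 erefl erefl.
have E3 := tens_id C [:: up] [:: up].
suff E : (dd B ⊗ I1 ⊗ I1 : mor C [:: up; down; up; up] [:: up; up])
  ∘ ((I1 ⊗ (S : mor C [:: up; down] [:: down; up]) ⊗ I1
      : mor C [:: up; up; down; up] [:: up; down; up; up])
  ∘ (I1 ⊗ I1 ⊗ cc B : mor C [:: up; up] [:: up; up; down; up]))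
  = atcap (dd B) [:: up; up]
    ∘ (u (at2 (S : mor C [:: up; down] [:: down; up]) [:: up])
      ∘ (idm [:: up; up] ⊗ cc B
          : mor C [:: up; up] [:: up; up; down; up])) by exact: E.
congr (_ ∘ _); last congr (_ ∘ _).
- by refine (etrans E1 _); rewrite /= tens_id.
- exact: E2.
- exact: (congr1 (fun f : mor C [:: up; up] [:: up; up] => f ⊗ cc B) E3).
Qed.

Lemma flip_mateE (B : base C) (f : mor fl [:: up] [:: up]) :
  mate (flip_base B) f
    = atcap (dd B) [:: up]
        ∘ u (at1 (f : mor C [:: down] [:: down]) [:: up])
        ∘ u (cc B).
Proof.
rewrite -[RHS]compA.
have E2 := tensA_cast I1 (f : mor C [:: down] [:: down]) I1 erefl erefl.
suff E : (dd B ⊗ I1 : mor C [:: up; down; up] [:: up])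
  ∘ ((I1 ⊗ (f : mor C [:: down] [:: down]) ⊗ I1
      : mor C [:: up; down; up] [:: up; down; up])
  ∘ (I1 ⊗ cc B : mor C [:: up] [:: up; down; up]))
  = atcap (dd B) [:: up]
    ∘ (u (at1 (f : mor C [:: down] [:: down]) [:: up]) ∘ u (cc B))
  by exact: E.
congr (_ ∘ _); congr (_ ∘ _); exact: E2.
Qed.

Variables (B : base C).
Hypothesis BH : common z B.
Let BH' := commonP BH.

(** Moving crossings one by one through the nested caps to the upward strands reverses their order
    of composition. *)
Lemma rot_comp S T :
  delta_of B (sigma_of B (S ∘ T))
    = delta_of B (sigma_of B T) ∘ delta_of B (sigma_of B S).
Proof.
rewrite -[LHS]at2_nil -[RHS]at2_nil; apply: (cap2_inj BH').
rewrite (cap2_rot BH') !at2_comp !lw_comp !compA (cap2_rot BH').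
by rewrite -[RHS]compA at2_nat compA (cap2_rot BH').
Qed.

(** The rotated [tauinv_skein]. Its linear coefficient [-z] becomes [z] through the sign in
    [flip_base]. *)
Lemma deltam_skein : deltam z B ∘ deltam z B = idm _ - uval z *: deltam z B.
Proof.
rewrite /deltam /sigmam -rot_comp (tauinv_skein BH').
rewrite !(linearD_of (sigma_linear B), linearN_of (sigma_linear B),
  linearZ_of (sigma_linear B)).
rewrite !(linearD_of (delta_linear B), linearN_of (delta_linear B),
  linearZ_of (delta_linear B)).
by rewrite (rot_id BH').
Qed.

(** The rotated [tauinv_dot]: the caps exchange left and right, which puts the dot of the middle
    factor on the second strand, as in the relation for [tau]. *)
Lemma deltam_dot :
  deltam z B ∘ (v (y B) ∘ deltam z B) = at1 (y B) [:: down].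
Proof.
have E : cap2 B [::] ∘ u (u (deltam z B))
    = cap2 B [::] ∘ at2 (tauinv z B) [:: down; down].
  by have := cap2_rot BH' (tauinv z B) [::]; rewrite at2_nil.
have E1 := cap2_dot1 BH' (x B) [::].
have E2 := cap2_dot2 BH' (x B) [::].
move: (deltam z B) E => r E; rewrite -{1}[y B]at1_nil.
apply: (cap2_inj BH'); rewrite !lw_comp !compA E -(compA (cap2 B _)) at2_nat.
rewrite compA E1 -!compA at2_nat [at1 _ _ ∘ _]compA at1_nat !compA E E2.
by rewrite -at1_lw -(tauinv_dot BH') !at2_comp at2_at1 !compA.
Qed.

(** Three nested caps exchange the left and the right crossing, and the braid relation of [tauinv]
    is symmetric under this exchange. *)
Lemma deltam_braid (r := deltam z B) :
  at2 r [:: down] ∘ (v r ∘ at2 r [:: down]) = v r ∘ (at2 r [:: down] ∘ v r).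
Proof.
have E1 : cap3 B [::] ∘ u (u (u (v r))) = cap3 B [::] ∘ at2 (tauinv z B) _.
  by have := cap3_rotl BH' (tauinv z B) [::]; rewrite at2_nil.
have E2 := cap3_rotr BH' (tauinv z B) [::].
rewrite -/(sigmam z B) -/(deltam z B) in E2.
rewrite -/r in E2; have T := tauinv_braid BH' [:: down; down; down].
have A3 g : at2 (tauinv z B) [:: up; down; down; down] ∘ u (u (u g))
    = u (u (u g)) ∘ at2 (tauinv z B) [:: up; down; down; down].
  exact: at2_nat.
have U3 g : u (at2 (tauinv z B) [:: down; down; down]) ∘ u (u (u g))
    = u (u (u g)) ∘ u (at2 (tauinv z B) [:: down; down; down]).
  by rewrite -!lw_comp at2_nat.
move: (at2 r _) (v r) E1 E2 => p q E1 E2.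
apply: (cap3_inj BH'); rewrite !lw_comp !compA E1 E2.
rewrite (reass _ (U3 _)) E1 (reass _ (U3 _)) (reass _ (A3 _)) E2.
rewrite (reass _ (A3 _)) (reass _ (U3 _)) E1.
rewrite -2![LHS]compA -2![RHS]compA; congr (_ ∘ _).
by rewrite !compA -T.
Qed.

Lemma flip_common : common z (flip_base B).
Proof.
case: (BH) => h1 h2 h3 h4 [h5 h6 h7].
split.
- exact: (yK BH').
- exact: (yVK BH').
- suff E : - deltam z B ∘ (v (y B) ∘ - deltam z B) = at1 (y B) [:: down].
    exact: E.
  by rewrite !compNr compNl opprK deltam_dot.
- suff E : - deltam z B ∘ - deltam z B = uval z *: - deltam z B + idm _.
    exact: E.
  by rewrite compNr compNl opprK deltam_skein scalerN addrC.
split.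
- suff E : (at2 (- deltam z B) [:: down] : mor C _ _)
    ∘ (v (- deltam z B) ∘ at2 (- deltam z B) [:: down])
    = v (- deltam z B) ∘ (at2 (- deltam z B) [:: down] ∘ v (- deltam z B)).
    exact: E.
  have -> : v (- deltam z B) = - v (deltam z B).
    exact: (tensNr J1 (deltam z B)).
  have -> : at2 (- deltam z B) [:: down] = - at2 (deltam z B) [:: down].
    exact: (tensNl (deltam z B) J1).
  by rewrite !(compNl, compNr) deltam_braid.
- exact: h7.
- exact: h6.
Qed.

Lemma flip_y : y (flip_base B) = x B.
Proof.
rewrite /y flip_mateE /=; have := mate_flip BH' (x B) [::].
by rewrite at1_nil atcup_nil => <-.
Qed.

Lemma flip_tauinv : tauinv z (flip_base B) = - deltap B.
Proof.
rewrite /tauinv /= -[deltap B](subrK (deltam z B)) (delta_skein BH').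
by rewrite opprD addrC.
Qed.

(** Bending in the rotated category undoes the bending performed by [delta_of]. *)
Lemma flip_sigma_rot T :
  sigma_of (flip_base B) (- delta_of B T) = - T.
Proof.
rewrite (linearN_of (sigma_linear (flip_base B))) flip_sigmaE.
by have := delta_flip BH' T [::]; rewrite at2_nil atcup_nil => ->.
Qed.

Lemma flip_sigmap : sigmap (flip_base B) = - sigmam z B.
Proof. exact: flip_sigma_rot. Qed.

Lemma flip_sigmam : sigmam z (flip_base B) = - sigmap B.
Proof. by rewrite /sigmam flip_tauinv; apply: flip_sigma_rot. Qed.

Lemma flip_delta_rot T :
  delta_of (flip_base B) (- sigma_of B T) = - T.
Proof.
rewrite (linearN_of (delta_linear (flip_base B))) flip_deltaE.
by have := sigma_flip BH' T [::]; rewrite at2_nil atcup_nil => ->.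
Qed.

Lemma flip_deltap : deltap (flip_base B) = - tauinv z B.
Proof. by rewrite /deltap flip_sigmap; apply: flip_delta_rot. Qed.

Lemma flip_deltam : deltam z (flip_base B) = - tau B.
Proof. by rewrite /deltam flip_sigmam; apply: flip_delta_rot. Qed.

Lemma flip_xpow m : xpow (flip_base B) m = mate B (xpow B m).
Proof.
case: m => m /=.
  elim: m => [|m IH] /=; first by rewrite (mate_id BH').
  by rewrite IH (mate_comp BH').
rewrite (mate_comp BH'); congr (_ ∘ _).
elim: m => [|m IH] /=; first by rewrite (mate_id BH').
by rewrite IH (mate_comp BH').
Qed.

(** Reversal turns the cap into the cup, across which the mate of a power slides to the upward
    strand. *)
Lemma flip_dx m : dx (flip_base B) m = xc B m.
Proof.
suff E : at1 (xpow (flip_base B) m : mor C _ _) [:: up] ∘ cc B = xc B m.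
  exact: E.
by rewrite flip_xpow -(dot_cup BH').
Qed.

Lemma flip_xc m : xc (flip_base B) m = dx B m.
Proof.
suff E : dd B ∘ u (xpow (flip_base B) m : mor C _ _) = dx B m.
  exact: E.
rewrite flip_xpow; have := mate_cap BH' (xpow B m) [::].
by rewrite at1_nil atcap_nil.
Qed.

End Flip.

(** * Rotated data and bubbles *)

Section FlipData.
Variables (R : comPzRingType) (C : slmcat R) (z : ring_unit R).
Local Notation fl := (swapcat (opcat C)).

(** The sign of [gL] is that of the rotated [sigmap], which is [- sigmam]. *)
Definition flip_data (G : heis_data C) : heis_data fl :=
  @HeisData R fl (flip_base z G) (- gL G) (geps G) (geta G).

Definition flip_names (N : heis_names C) : heis_names fl :=
  @HeisNames R fl (flip_base z N) (- Lm N) (- Lp N) (eps_dia N) (eps_heart N)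
    (eta_dia N) (eta_heart N) (- d' N) (- c' N).

Variables (k k' : int) (t t' : ring_unit R).
(* Taking k' and t' instead of [- k] and [unit_inv t] makes the situation
   symmetric: applying it twice needs no transport along [- - k = k]. *)
Hypotheses (kk : k' = - k) (tt : uval t' = uinv t) (tt' : uinv t' = uval t).

Lemma same_flip_names (N N' : heis_names C) :
  same_names k' N N' -> same_names k (flip_names N) (flip_names N').
Proof.
case=> h1 h2 h3 h4 h5 h6 h7.
have ke : numeps k' = numeta k by rewrite kk; case: (k) => [[|m]|m].
have kp : numeta k' = numeps k by rewrite kk; case: (k) => [[|m]|m].
split; rewrite /= ?h1 ?h2 ?h3 ?h4 ?h5 // => a ha.
  by apply: h7; rewrite ke.
by apply: h6; rewrite kp.
Qed.

Section Bubble.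
Variable N : heis_names C.
Hypothesis BH : common z N.

Lemma flip_bub_a m : bub_a (flip_names N) m = - bub_b N m.
Proof.
rewrite /bub_a (flip_xc BH) /=.
suff E : dx N m ∘ - c' N = - (dx N m ∘ c' N) by exact: E.
exact: compNr.
Qed.

Lemma flip_bub_b m : bub_b (flip_names N) m = - bub_a N m.
Proof.
rewrite /bub_b (flip_dx BH) /=.
suff E : - d' N ∘ xc N m = - (d' N ∘ xc N m) by exact: E.
exact: compNl.
Qed.

Lemma flip_bub_ap m : bub_ap k z t (flip_names N) m = - bub_bp k' z t' N m.
Proof.
rewrite /bub_ap /bub_bp flip_bub_a kk tt' opprK; case: ifP => // _.
rewrite (flip_dx BH); case: ifP => _; first by rewrite scaleNr.
by case: ifP => _; rewrite ?scaleNr ?opprK ?oppr0.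
Qed.

Lemma flip_bub_bp m : bub_bp k z t (flip_names N) m = - bub_ap k' z t' N m.
Proof.
rewrite /bub_ap /bub_bp flip_bub_b kk tt opprK; case: ifP => // _.
rewrite (flip_xc BH); case: ifP => _; first by rewrite scaleNr opprK.
by case: ifP => _; rewrite ?scaleNr ?oppr0.
Qed.

Lemma flip_bub_am m : bub_am k z t (flip_names N) m = - bub_bm k' z t' N m.
Proof. by rewrite /bub_am flip_bub_a flip_bub_ap opprB opprK addrC. Qed.

Lemma flip_bub_bm m : bub_bm k z t (flip_names N) m = - bub_am k' z t' N m.
Proof. by rewrite /bub_bm flip_bub_b flip_bub_bp opprB opprK addrC. Qed.

End Bubble.

Variable G : heis_data C.
Hypothesis BH : common z G.

Lemma flip_c'I : c'I k z t (flip_data G) = - d'II k' z t' G.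
Proof.
rewrite /c'I /d'II kk oppr_gt0 oppr_eq0 tt tt' abszN.
case: (ltgtP k 0) => k0; rewrite ?(flip_xc BH) -?scaleNr //.
- suff E : uinv t *: (dx G (- k) ∘ - gL G) = - uinv t *: (dx G (- k) ∘ gL G).
    exact: E.
  by rewrite compNr scalerN scaleNr.
suff E : uval t *: (dd G ∘ - gL G) = - uval t *: (dd G ∘ gL G) by exact: E.
by rewrite compNr scalerN scaleNr.
Qed.

Lemma flip_d'I : d'I k z t (flip_data G) = - c'II k' z t' G.
Proof.
rewrite /d'I /c'II kk oppr_gt0 opprK tt tt'.
case: (leP 0 k) => k0; rewrite ?(flip_dx BH) -?scaleNr //.
suff E : uval t *: (- gL G ∘ xc G k) = - uval t *: (gL G ∘ xc G k) by exact: E.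
by rewrite compNl scalerN scaleNr.
Qed.

Lemma flip_LpI : LpI k z t (flip_data G) = - LmII k' z t' G.
Proof.
rewrite /LpI /LmII kk oppr_gt0 -kk flip_c'I flip_d'I.
case: (leP 0 k) => k0 //.
suff E : - gL G + uval z *: (- c'II k' z t' G ∘ - d'II k' z t' G)
    = - (gL G - uval z *: (c'II k' z t' G ∘ d'II k' z t' G)) by exact: E.
by rewrite compNl compNr opprK opprB addrC.
Qed.

Lemma flip_LmI : LmI k z t (flip_data G) = - LpII k' z t' G.
Proof.
rewrite /LmI /LpII kk oppr_gt0 -kk flip_c'I flip_d'I.
case: (leP 0 k) => k0 //.
suff E : - gL G - uval z *: (- c'II k' z t' G ∘ - d'II k' z t' G)
    = - (gL G + uval z *: (c'II k' z t' G ∘ d'II k' z t' G)) by exact: E.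
by rewrite compNl compNr opprK opprD.
Qed.

Lemma flip_names_data :
  same_names k (namesI k z t (flip_data G)) (flip_names (namesII k' z t' G)).
Proof.
split=> //; rewrite /= ?flip_LpI ?flip_LmI ?flip_c'I ?flip_d'I //.
  move=> a _; split=> //; case: ifP => // _.
  suff E : geps G 0 + uval z *: (dd G ∘ - LpII k' z t' G)
      = geps G 0 - uval z *: (dd G ∘ LpII k' z t' G) by exact: E.
  by rewrite compNr scalerN.
move=> a _; split=> //; case: ifP => // _.
suff E : geta G 0 + uval z *: (- LmII k' z t' G ∘ cc G)
    = geta G 0 - uval z *: (LmII k' z t' G ∘ cc G) by exact: E.
by rewrite compNl scalerN.
Qed.

End FlipData.

(** Definition I groups charge zero with the positive charges and Definition II with the negative
    ones, so their cases correspond under [k' = - k]. Reversal exchanges rows with columns and the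
    two indices of the Kronecker delta. *)
Lemma flip_modelI (R : comPzRingType) (C : slmcat R) (z t t' : ring_unit R)
    (k k' : int) (G : heis_data C) :
  k' = - k -> uval t' = uinv t -> uinv t' = uval t ->
  modelII k' z t' G -> modelI k z t (flip_data z G).
Proof.
move=> kk tt tt' [BH HM Hb]; split; first exact: flip_common.
  move: HM; rewrite kk oppr_gt0 abszN.
  rewrite -[sigmap _]/(sigmap (flip_base z G)) (flip_sigmap BH).
  case: (leP 0 k) => k0 HM.
    have {}HM : rowinv `|k| (- sigmam z G) (fun a => xc G a) (- gL G) (geps G).
      by apply/rowinv_op/colinv_opp/rowinv_op.
    apply: (@colinv_ext R (swapcat (opcat C)) [:: up; down] [:: down; up] [::]
      _ _ (fun a => xc G a) _ _ (geps G)) => //.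
      by move=> a _; rewrite (flip_dx BH).
    case: HM => h1 h2 h3 h4 h5; split=> // a b an bn.
    by rewrite eq_sym; apply: h5.
  have {}HM : colinv `|k| (- sigmam z G) (fun a => dx G a) (- gL G) (geta G).
    exact: colinv_opp.
  apply: (@rowinv_ext R (swapcat (opcat C)) [:: up; down] [:: down; up] [::]
      _ _ (fun a => dx G a) _ _ (geta G)) => //.
    by move=> a _; rewrite (flip_xc BH).
  case: HM => h1 h2 h3 h4 h5; split=> // a b an bn.
  by rewrite eq_sym; apply: h5.
rewrite (flip_c'I kk tt tt' BH) (flip_d'I kk tt tt' BH) (flip_xc BH).
move: Hb; rewrite kk oppr_gt0 oppr_eq0 -kk tt tt'.
case: (ltgtP k 0) => k0 Hb.
- suff E : dx G k' ∘ - c'II k' z t' G = (uval t * uinv z) *: idm [::].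
    exact: E.
  by rewrite compNr Hb scaleNr opprK.
- suff E : - d'II k' z t' G ∘ cc G = (uval t * uinv z) *: idm [::] by exact: E.
  by rewrite compNl Hb scaleNr opprK.
suff E : - d'II k' z t' G ∘ cc G
    = (uval t * uinv z - uinv t * uinv z) *: idm [::].
  exact: E.
by rewrite compNl Hb -scaleNr opprB.
Qed.

(** * The isomorphisms *)

Section FunctorBubbles.
Variables (R : comPzRingType) (C D : slmcat R) (k : int) (z t : ring_unit R).

Section Image.
Variables (F : forall X Y, mor C X Y -> mor D X Y) (HF : functor F).
Variable N : heis_names C.

Let FD X Y := linearD_of (@functor_linear _ _ _ _ HF X Y).
Let FZ X Y := linearZ_of (@functor_linear _ _ _ _ HF X Y).
Let FN X Y := linearN_of (@functor_linear _ _ _ _ HF X Y).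
Let F0 X Y := linear0_of (@functor_linear _ _ _ _ HF X Y).

Lemma functor_bub_a m : F (bub_a N m) = bub_a (fnames F N) m.
Proof. by rewrite /bub_a (functor_comp HF) (functor_xc HF). Qed.

Lemma functor_bub_b m : F (bub_b N m) = bub_b (fnames F N) m.
Proof. by rewrite /bub_b (functor_comp HF _ (c' N)) (functor_dx HF). Qed.

Lemma functor_bub_ap m :
  F (bub_ap k z t N m) = bub_ap k z t (fnames F N) m.
Proof.
rewrite /bub_ap; case: ifP => _; first exact: functor_bub_a.
case: ifP => _; last by case: ifP => _; rewrite ?FZ ?F0 ?(functor_id HF).
by rewrite FZ (functor_comp HF _ (eta_dia N _)) (functor_dx HF).
Qed.

Lemma functor_bub_bp m :
  F (bub_bp k z t N m) = bub_bp k z t (fnames F N) m.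
Proof.
rewrite /bub_bp; case: ifP => _; first exact: functor_bub_b.
case: ifP => _; last by case: ifP => _; rewrite ?FZ ?F0 ?(functor_id HF).
by rewrite FZ (functor_comp HF (eps_dia N _)) (functor_xc HF).
Qed.

Lemma functor_bub_am m :
  F (bub_am k z t N m) = bub_am k z t (fnames F N) m.
Proof. by rewrite /bub_am FD FN functor_bub_a functor_bub_ap. Qed.

Lemma functor_bub_bm m :
  F (bub_bm k z t N m) = bub_bm k z t (fnames F N) m.
Proof. by rewrite /bub_bm FD FN functor_bub_b functor_bub_bp. Qed.

End Image.

Variables (N N' : heis_names C) (NN : same_names k N N').

Lemma same_bub_a m : bub_a N m = bub_a N' m.
Proof. by rewrite /bub_a (same_nbase NN) (same_d' NN). Qed.

Lemma same_bub_b m : bub_b N m = bub_b N' m.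
Proof. by rewrite /bub_b (same_nbase NN) (same_c' NN). Qed.

Lemma same_bub_ap m : bub_ap k z t N m = bub_ap k z t N' m.
Proof.
rewrite /bub_ap same_bub_a (same_nbase NN); case: (ltP 0 m) => // m0.
(* Here [- k < m <= 0], so the index [- m] is below [k] and no junk value is read. *)
case: ifP => // km; case: (same_etas NN (a := absz (- m))) => [|-> _ //].
by rewrite numeta_ge0; lia.
Qed.

Lemma same_bub_bp m : bub_bp k z t N m = bub_bp k z t N' m.
Proof.
rewrite /bub_bp same_bub_b (same_nbase NN); case: (ltP 0 m) => // m0.
case: ifP => // km; case: (same_epss NN (a := absz (- m))) => [|-> _ //].
by rewrite numeps_lt0; lia.
Qed.

Lemma same_bub_am m : bub_am k z t N m = bub_am k z t N' m.
Proof. by rewrite /bub_am same_bub_a same_bub_ap. Qed.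

Lemma same_bub_bm m : bub_bm k z t N m = bub_bm k z t N' m.
Proof. by rewrite /bub_bm same_bub_b same_bub_bp. Qed.

End FunctorBubbles.

Section Uniqueness.
Variables (R : comPzRingType) (C : slmcat R) (k : int) (z t : ring_unit R).
Variables (G G' : heis_data C).
Hypotheses (ex : x G = x G') (etau : tau G = tau G') (ec : cc G = cc G')
  (ed : dd G = dd G').

Lemma common_base : common z G -> common z G' -> hbase G = hbase G'.
Proof.
move: G G' ex etau ec ed.
move=> [[x1 xi1 t1 c1 d1] ? ? ?] [[x2 xi2 t2 c2 d2] ? ? ?] /=.
move=> e1 -> -> -> [/= _ Kx _ _ _] [/= xK _ _ _ _].
rewrite -e1 in xK *; congr Base.
by rewrite -[LHS]compm1 -xK compA Kx comp1m.
Qed.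

Lemma modelI_unique : modelI k z t G -> modelI k z t G' -> same_data k G G'.
Proof.
case=> h1 h2 _ [g1 g2 _]; have eB := common_base h1 g1.
move: h2 g2; rewrite -eB; case: ifP => k0 h2 g2.
  have [eL eg] := colinv_unique h2 g2.
  split=> // a ha; first by apply: eg; rewrite -numeta_ge0.
  by case: (k) k0 ha.
have [eL eg] := rowinv_unique h2 g2.
split=> // a ha; last by apply: eg; rewrite -numeps_lt0.
by case: (k) k0 ha.
Qed.

Lemma modelII_unique : modelII k z t G -> modelII k z t G' -> same_data k G G'.
Proof.
case=> h1 h2 _ [g1 g2 _]; have eB := common_base h1 g1.
move: h2 g2; rewrite -eB; case: ifP => k0 h2 g2.
  have [eL eg] := colinv_unique h2 g2.
  split=> // a ha; first by apply: eg; rewrite -numeta_gt0.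
  by case: (k) k0 ha.
have [eL eg] := rowinv_unique h2 g2.
split=> // a ha; last by apply: eg; rewrite -numeps_le0.
by case: (k) k0 ha => [[]|].
Qed.

End Uniqueness.

Lemma fam_lt (V : nmodType) n (f : 'I_n -> V) a (an : (a < n)%N) :
  fam f a = f (Ordinal an).
Proof. by rewrite /fam insubT. Qed.

(** * Functors out of the presented categories *)

Section Presented.
Variables (R : comPzRingType) (k : int).

Definition assign (D : slmcat R) (G : heis_data D) X Y (g : heis_gen k X Y) :
    mor D X Y :=
  match g with
  | Gx => x G
  | Gxinv => xinv G
  | Gtau => tau G
  | Gc => cc G
  | Gd => dd G
  | GL => gL G
  | Geta i => geta G i
  | Geps i => geps G i
  end.

Local Notation free := (freecat R (heis_gen k)).
Local Notation fgens := (gens (R := R) (k := k) (fun _ _ _ _ => False)).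

Section Eval.
Variable rel : forall X Y,
  tm R (heis_gen k) X Y -> tm R (heis_gen k) X Y -> Prop.
Variables (D : slmcat R) (G : heis_data D).
Hypothesis GP : forall X Y (f g : tm R (heis_gen k) X Y),
  rel f g -> ev (assign G) f = ev (assign G) g.

Lemma same_data_evq : same_data k
  (fdata (@evq _ _ rel D (assign G)) (gens rel)) G.
Proof.
split=> [||a ha|a ha] /=; rewrite ?(evq_gen GP) //.
- by rewrite /fbase /= !(evq_gen GP) /=; case: (hbase G).
- by rewrite fam_lt (evq_gen GP).
- by rewrite fam_lt (evq_gen GP).
Qed.

End Eval.

Variable r : hrel free.

Definition proj X Y (f : mor free X Y) : mor (presented r) X Y :=
  evq (fun X Y g => pgen _ g) f.

Lemma proj_functor : functor proj.
Proof. exact: evq_functor. Qed.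

(** Evaluating a term at the generators of a quotient gives the class of that term. *)
Lemma projE X Y (f : mor free X Y) : proj f = cls _ (repr f).
Proof.
rewrite /proj /evq; elim: (repr f) => {X Y f} //=.
- by move=> X Y Z g -> f ->; apply: cls_comp.
- by move=> X Y X' Y' f -> g ->; apply: cls_tens.
- by move=> X Y f -> g ->; rewrite clsD.
- by move=> X Y a f ->; rewrite clsZ.
Qed.

Lemma obeys_proj : obeys proj r.
Proof.
move=> X Y f g rfg; rewrite !projE; apply/clsP/CongRel.
(* The relations are tested on classes in the free category, and representatives have the original
   classes. *)
by rewrite !clsK.
Qed.

Lemma same_data_proj : same_data k (fdata proj fgens) (gens _).
Proof.
split=> [||a ha|a ha] /=; rewrite /fbase /= /proj ?evq_gen //.
- by rewrite !fam_lt evq_gen.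
- by rewrite !fam_lt evq_gen.
Qed.

Section Lift.
Variables (D : slmcat R) (G : heis_data D).
Hypothesis GP : obeys (@evq _ _ (fun _ _ _ _ => False) D (assign G)) r.

Let GP' X Y (f g : tm R (heis_gen k) X Y) :
  r (cls _ f) (cls _ g) -> ev (assign G) f = ev (assign G) g.
Proof. by move/GP; rewrite !evq_cls. Qed.

Definition presented_lift X Y (f : mor (presented r) X Y) : mor D X Y :=
  evq (assign G) f.

Lemma lift_functor : functor presented_lift.
Proof. exact: (evq_functor GP'). Qed.

Lemma same_data_lift : same_data k (fdata presented_lift (gens _)) G.
Proof. exact: (same_data_evq GP'). Qed.

End Lift.

Lemma presented_ext (D : slmcat R)
    (F F' : forall X Y, mor (presented r) X Y -> mor D X Y) :
  functor F -> functor F' ->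
  same_data k (fdata F (gens _)) (fdata F' (gens _)) ->
  forall X Y (f : mor (presented r) X Y), F _ _ f = F' _ _ f.
Proof.
move=> HF HF' [eB eL ee ep]; apply: pres_functor_ext => //= X Y [] //.
- by case: eB.
- by case: eB.
- by case: eB.
- by case: eB.
- by case: eB.
- by case=> a an; have := ee a an; rewrite /= fam_lt.
- by case=> a an; have := ep a an; rewrite /= fam_lt.
Qed.

End Presented.

Section Models.
Variables (R : comPzRingType) (k : int) (z t : ring_unit R).

Lemma modelI_functor (C D : slmcat R) (F : forall X Y, mor C X Y -> mor D X Y)
    (G : heis_data C) :
  functor F -> modelI k z t G -> modelI k z t (fdata F G).
Proof.
(* Through the identity functor the model makes related morphisms equal already in [C], and [F]
   preserves the equality. *)
move=> HF H; apply/(obeysI HF) => X Y f g r; congr (F X Y _).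
have H' : modelI k z t (fdata (fun X Y (f : mor C X Y) => f) G) := H.
exact: (obeysI (functor_id_fun C) k z t G).2 H' _ _ _ _ r.
Qed.

Lemma modelII_functor (C D : slmcat R) (F : forall X Y, mor C X Y -> mor D X Y)
    (G : heis_data C) :
  functor F -> modelII k z t G -> modelII k z t (fdata F G).
Proof.
move=> HF H; apply/(obeysII HF) => X Y f g r; congr (F X Y _).
have H' : modelII k z t (fdata (fun X Y (f : mor C X Y) => f) G) := H.
exact: (obeysII (functor_id_fun C) k z t G).2 H' _ _ _ _ r.
Qed.

Definition gensI : heis_data (heisI k z t) := gens _.
Definition gensII : heis_data (heisII k z t) := gens _.

Lemma modelI_gens : modelI k z t gensI.
Proof.
apply: same_modelI (same_data_proj _) _.
by apply/(obeysI (proj_functor _)); apply: obeys_proj.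
Qed.

Lemma modelII_gens : modelII k z t gensII.
Proof.
apply: same_modelII (same_data_proj _) _.
by apply/(obeysII (proj_functor _)); apply: obeys_proj.
Qed.

Variable D : slmcat R.

Lemma heisI_lift (G : heis_data D) : modelI k z t G ->
  exists2 F : forall X Y, mor (heisI k z t) X Y -> mor D X Y,
    functor F & same_data k (fdata F gensI) G.
Proof.
move=> HG; have H : obeys (@evq _ _ (fun _ _ _ _ => False) D (assign G))
    (relI k z t (gens (k := k) (fun _ _ _ _ => False))).
  apply/obeysI; first exact: evq_functor.
  by apply: same_modelI (same_data_sym (same_data_evq _)) HG.
exists (@presented_lift R k _ D G); first exact: (lift_functor H).
exact: (same_data_lift H).
Qed.

Lemma heisII_lift (G : heis_data D) : modelII k z t G ->
  exists2 F : forall X Y, mor (heisII k z t) X Y -> mor D X Y,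
    functor F & same_data k (fdata F gensII) G.
Proof.
move=> HG; have H : obeys (@evq _ _ (fun _ _ _ _ => False) D (assign G))
    (relII k z t (gens (k := k) (fun _ _ _ _ => False))).
  apply/obeysII; first exact: evq_functor.
  by apply: same_modelII (same_data_sym (same_data_evq _)) HG.
exists (@presented_lift R k _ D G); first exact: (lift_functor H).
exact: (same_data_lift H).
Qed.

Lemma heisI_ext (F F' : forall X Y, mor (heisI k z t) X Y -> mor D X Y) :
  functor F -> functor F' ->
  F _ _ (x gensI) = F' _ _ (x gensI) ->
  F _ _ (tau gensI) = F' _ _ (tau gensI) ->
  F _ _ (cc gensI) = F' _ _ (cc gensI) ->
  F _ _ (dd gensI) = F' _ _ (dd gensI) ->
  forall X Y (f : mor (heisI k z t) X Y), F _ _ f = F' _ _ f.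
Proof.
move=> HF HF' ex et ec ed; apply: presented_ext => //.
apply: (modelI_unique (z := z) (t := t)) => //; apply: modelI_functor => //;
  exact: modelI_gens.
Qed.

Lemma heisII_ext (F F' : forall X Y, mor (heisII k z t) X Y -> mor D X Y) :
  functor F -> functor F' ->
  F _ _ (x gensII) = F' _ _ (x gensII) ->
  F _ _ (tau gensII) = F' _ _ (tau gensII) ->
  F _ _ (cc gensII) = F' _ _ (cc gensII) ->
  F _ _ (dd gensII) = F' _ _ (dd gensII) ->
  forall X Y (f : mor (heisII k z t) X Y), F _ _ f = F' _ _ f.
Proof.
move=> HF HF' ex et ec ed; apply: presented_ext => //.
apply: (modelII_unique (z := z) (t := t)) => //; apply: modelII_functor => //;
  exact: modelII_gens.
Qed.

End Models.

Lemma same_namesP (R : comPzRingType) (C : slmcat R) (k : int)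
    (N N' : heis_names C) :
  same_names k N N' ->
  [/\ forall a : nat, a%:Z < k ->
        eta_dia N a = eta_dia N' a /\ eta_heart N a = eta_heart N' a
    & forall a : nat, a%:Z < - k ->
        eps_dia N a = eps_dia N' a /\ eps_heart N a = eps_heart N' a].
Proof.
case=> _ _ _ _ _ he hp; split=> a ak.
  by apply: he; case: (k) ak.
by apply: hp; case: (k) ak => [[|m]|m] //=; lia.
Qed.

(** * Identification of the two presentations *)

Section PartOne.
Variables (R : comPzRingType) (k : int) (z t : ring_unit R).

Lemma heisI_to_heisII :
  exists2 F : forall X Y, mor (heisI k z t) X Y -> mor (heisII k z t) X Y,
    functor F
    & same_names k (fnames F (heisI_names k z t)) (heisII_names k z t).
Proof.
have [HG HN] := modelII_I (modelII_gens k z t).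
have [F HF FG] := heisI_lift HG; exists F => //.
apply: same_names_trans (functor_namesI HF _ _ _ _) _.
exact: same_names_trans (same_namesI _ _ FG) HN.
Qed.

Lemma heisII_to_heisI :
  exists2 F : forall X Y, mor (heisII k z t) X Y -> mor (heisI k z t) X Y,
    functor F
    & same_names k (fnames F (heisII_names k z t)) (heisI_names k z t).
Proof.
have [HG HN] := modelI_II (modelI_gens k z t).
have [F HF FG] := heisII_lift HG; exists F => //.
apply: same_names_trans (functor_namesII HF _ _ _ _) _.
exact: same_names_trans (same_namesII _ _ FG) HN.
Qed.

Lemma heisI_iso_heisII :
  exists F : forall X Y, mor (heisI k z t) X Y -> mor (heisII k z t) X Y,
    [/\ functor F, is_smiso (phi := id) F
      & same_names k (fnames F (heisI_names k z t)) (heisII_names k z t)].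
Proof.
have [F HF FN] := heisI_to_heisII; have [G HG GN] := heisII_to_heisI.
exists F; split=> //; split; first exact: functor_smfunctor.
have [fx _ ft fc fd] := same_nbase FN.
have [gx _ gt gc gd] := same_nbase GN.
exists id, G, (fun=> erefl), (fun=> erefl); split.
- exact: functor_smfunctor.
- apply: (heisI_ext (functor_compose HF HG) (functor_id_fun _)) => /=.
  + by rewrite fx gx.
  + by rewrite ft gt.
  + by rewrite fc gc.
  + by rewrite fd gd.
- apply: (heisII_ext (functor_compose HG HF) (functor_id_fun _)) => /=.
  + by rewrite gx fx.
  + by rewrite gt ft.
  + by rewrite gc fc.
  + by rewrite gd fd.
Qed.

End PartOne.

(** * The isomorphism [Omega_k] *)

Section PartTwo.
Variables (R : comPzRingType) (z : ring_unit R).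

Lemma heisI_flip (k k' : int) (t t' : ring_unit R) :
  k' = - k -> uval t' = uinv t -> uinv t' = uval t ->
  exists2 F : forall X Y, mor (heisI k z t) X Y ->
      mor (swapcat (opcat (heisI k' z t'))) X Y,
    functor F & same_names k (fnames F (heisI_names k z t))
                  (flip_names z (heisI_names k' z t')).
Proof.
move=> kk tt tt'; have [HG HN] := modelI_II (modelI_gens k' z t').
have [F HF FG] := heisI_lift (flip_modelI kk tt tt' HG); exists F => //.
apply: same_names_trans (functor_namesI HF _ _ _ _) _.
apply: same_names_trans (same_namesI _ _ FG) _.
have [BH _ _] := HG.
apply: same_names_trans (flip_names_data kk tt tt' BH) _.
exact: same_flip_names kk _ _ HN.
Qed.

Lemma modelI_common (C : slmcat R) (k : int) (t : ring_unit R)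
    (G : heis_data C) :
  modelI k z t G -> common z G.
Proof. by case. Qed.

(** Two rotations return [x] as the mate of its mate, and [tau] with both signs cancelling; by
    uniqueness of functors on these four generators the composites are identities. *)
Lemma flip_flip (C D A : slmcat R) (N : heis_names C) (M : heis_names D)
    (P : heis_names A)
    (F : forall X Y, mor C X Y -> mor D (swap Y) (swap X))
    (G : forall X Y, mor D X Y -> mor A (swap Y) (swap X)) :
  @functor R D (swapcat (opcat A)) G ->
  common z P ->
  @fbase R C (swapcat (opcat D)) F N = flip_base z M ->
  @fbase R D (swapcat (opcat A)) G M = flip_base z P ->
  [/\ G _ _ (F _ _ (x N)) = x P, G _ _ (F _ _ (tau N)) = tau P,
      G _ _ (F _ _ (cc N)) = cc P & G _ _ (F _ _ (dd N)) = dd P].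
Proof.
move=> HG BP [ex _ et ec ed] eG; split.
- rewrite ex -(flip_y BP) -eG; exact: (functor_mate HG M (x M)).
- have E := functor_deltam HG z M; rewrite eG (flip_deltam BP) in E.
  rewrite et (linearN_of (@functor_linear _ _ _ _ HG _ _)).
  exact: (canLR (@opprK _) E).
- by rewrite ec; apply: (congr1 (@dd R _) eG).
- by rewrite ed; apply: (congr1 (@cc R _) eG).
Qed.

Lemma heisI_iso_flip (k k' : int) (t t' : ring_unit R) :
  k' = - k -> uval t' = uinv t -> uinv t' = uval t ->
  exists F : forall X Y, mor (heisI k z t) X Y ->
      mor (opcat (heisI k' z t')) (swap X) (swap Y),
    [/\ @functor R (heisI k z t) (swapcat (opcat (heisI k' z t'))) F, is_smiso F
      & same_names k
          (@fnames R (heisI k z t) (swapcat (opcat (heisI k' z t'))) F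
            (heisI_names k z t))
          (flip_names z (heisI_names k' z t'))].
Proof.
move=> kk tt tt'; have [F HF FN] := heisI_flip kk tt tt'.
have [|G HG GN] := @heisI_flip k' k t' t _ (esym tt') (esym tt).
  by rewrite kk opprK.
exists F; split=> //; split; first exact/functor_swapP.
exists swap, (fun X Y g => G Y X g), swapK, swapK; split.
- exact: functor_swap_op.
- have [ex et ec ed] := flip_flip (P := heisI_names k z t) HG
    (modelI_common (modelI_gens k z t)) (same_nbase FN) (same_nbase GN).
  apply: (heisI_ext (functor_swap_compose HF HG) (functor_id_fun _));
    by rewrite hcast_id.
- have [ex et ec ed] := flip_flip (P := heisI_names k' z t') HF
    (modelI_common (modelI_gens k' z t')) (same_nbase GN) (same_nbase FN).
  move=> X Y g; rewrite (hcast_op (H := mor (heisI k' z t'))).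
  apply: (heisI_ext (functor_swap_compose HG HF) (functor_id_fun _));
    by rewrite hcast_id.
Qed.

End PartTwo.

Local Close Scope slm_scope.

Theorem theorem3p2 (R : comPzRingType) (z t : ring_unit R) (k : int) :
  (let M := heisI_names k z t in
   let N := heisII_names k z t in
   exists Theta : forall X Y, mor (heisI k z t) X Y -> mor (heisII k z t) X Y,
     is_smiso (phi := id) Theta /\
     [/\ Theta _ _ (x M) = x N,
         Theta _ _ (y M) = y N,
         Theta _ _ (tau M) = tau N
       & Theta _ _ (tauinv z M) = tauinv z N] /\
     [/\ Theta _ _ (cc M) = cc N
       & Theta _ _ (dd M) = dd N] /\
     [/\ Theta _ _ (sigmap M) = sigmap N,
         Theta _ _ (sigmam z M) = sigmam z N,
         Theta _ _ (deltap M) = deltap N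
       & Theta _ _ (deltam z M) = deltam z N] /\
     [/\ Theta _ _ (Lp M) = Lp N,
         Theta _ _ (Lm M) = Lm N,
         Theta _ _ (c' M) = c' N
       & Theta _ _ (d' M) = d' N] /\
     (forall a : nat, a%:Z < k ->
        Theta _ _ (eta_dia M a) = eta_dia N a /\
        Theta _ _ (eta_heart M a) = eta_heart N a) /\
     (forall a : nat, a%:Z < - k ->
        Theta _ _ (eps_dia M a) = eps_dia N a /\
        Theta _ _ (eps_heart M a) = eps_heart N a) /\
     (forall n : int,
        [/\ Theta _ _ (bub_ap k z t M n) = bub_ap k z t N n,
            Theta _ _ (bub_am k z t M n) = bub_am k z t N n,
            Theta _ _ (bub_bp k z t M n) = bub_bp k z t N n
          & Theta _ _ (bub_bm k z t M n) = bub_bm k z t N n])) /\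
  (let t' := unit_inv t in
   let M := heisI_names k z t in
   let N := heisI_names (- k) z t' in
   let on_generators (Omega : forall X Y, mor (heisI k z t) X Y ->
         mor (opcat (heisI (- k) z t')) (swap X) (swap Y)) :=
     [/\ Omega _ _ (x M) = y N,
         Omega _ _ (tau M) = - deltam z N,
         Omega _ _ (dd M) = cc N
       & Omega _ _ (cc M) = dd N] in
   exists Omega : forall X Y, mor (heisI k z t) X Y ->
       mor (opcat (heisI (- k) z t')) (swap X) (swap Y),
     (is_smiso Omega /\ on_generators Omega) /\
     (forall Omega' : forall X Y, mor (heisI k z t) X Y ->
          mor (opcat (heisI (- k) z t')) (swap X) (swap Y),
        is_smiso Omega' -> on_generators Omega' ->
        forall X Y (f : mor (heisI k z t) X Y), Omega' _ _ f = Omega _ _ f) /\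
     [/\ Omega _ _ (y M) = x N
       & Omega _ _ (tauinv z M) = - deltap N] /\
     [/\ Omega _ _ (sigmap M) = - sigmam z N,
         Omega _ _ (sigmam z M) = - sigmap N,
         Omega _ _ (deltap M) = - tauinv z N
       & Omega _ _ (deltam z M) = - tau N] /\
     [/\ Omega _ _ (Lp M) = - Lm N,
         Omega _ _ (Lm M) = - Lp N,
         Omega _ _ (d' M) = - c' N
       & Omega _ _ (c' M) = - d' N] /\
     (forall a : nat, a%:Z < k ->
        Omega _ _ (eta_dia M a) = eps_dia N a /\
        Omega _ _ (eta_heart M a) = eps_heart N a) /\
     (forall a : nat, a%:Z < - k ->
        Omega _ _ (eps_dia M a) = eta_dia N a /\
        Omega _ _ (eps_heart M a) = eta_heart N a) /\
     (forall n : int,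
        [/\ Omega _ _ (bub_ap k z t M n) = - bub_bp (- k) z t' N n,
            Omega _ _ (bub_am k z t M n) = - bub_bm (- k) z t' N n,
            Omega _ _ (bub_bp k z t M n) = - bub_ap (- k) z t' N n
          & Omega _ _ (bub_bm k z t M n) = - bub_am (- k) z t' N n])).
Proof.
split=> [M N|t' M N on_generators].
  have [F [HF FI FN]] := heisI_iso_heisII k z t; exists F; split=> //.
  have EB : fbase F M = N := same_nbase FN.
  have [Eeta Eeps] := same_namesP FN.
  split.
    split; [exact: (congr1 (@x _ _) EB) | | exact: (congr1 (@tau _ _) EB) |].
      by rewrite -EB; apply: (functor_mate HF).
    by rewrite (functor_tauinv HF) EB.
  split.
    by split; [exact: (congr1 (@cc _ _) EB) | exact: (congr1 (@dd _ _) EB)].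
  split; first by rewrite (functor_sigmap HF) (functor_sigmam HF)
    (functor_deltap HF) (functor_deltam HF) EB.
  split; first by case: FN.
  do 2![split=> //] => n.
  by rewrite (functor_bub_ap k z t HF) (functor_bub_am k z t HF)
    (functor_bub_bp k z t HF) (functor_bub_bm k z t HF) (same_bub_ap z t FN)
    (same_bub_am z t FN) (same_bub_bp z t FN) (same_bub_bm z t FN).
have [||| F [HF FI FN]] := @heisI_iso_flip R z k (- k) t t' => //.
have BN : common z N := modelI_common (modelI_gens _ _ _).
have EB : @fbase R _ (swapcat (opcat (heisI (- k) z t'))) F M = flip_base z N.
  exact: same_nbase FN.
have [Eeta Eeps] := same_namesP FN.
have EG : on_generators F.
  split; [exact: (congr1 (@x _ _) EB) | exact: (congr1 (@tau _ _) EB)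
   | exact: (congr1 (@dd _ _) EB) | exact: (congr1 (@cc _ _) EB)].
exists F; split=> //.
split.
  move=> F' [F'S _] [ex' et' ed' ec'] X Y f; have [ex et ed ec] := EG.
  apply: (heisI_ext ((functor_swapP _).2 F'S) HF).
  - exact: (etrans ex' (esym ex)).
  - exact: (etrans et' (esym et)).
  - exact: (etrans ec' (esym ec)).
  - exact: (etrans ed' (esym ed)).
split.
  split.
    apply: (etrans _ (flip_y BN)); rewrite -EB; exact: (functor_mate HF).
  apply: (etrans _ (flip_tauinv BN)); rewrite -EB; exact: (functor_tauinv HF).
split.
  split.
  - apply: (etrans _ (flip_sigmap BN)); rewrite -EB; exact: (functor_sigmap HF).
  - apply: (etrans _ (flip_sigmam BN)); rewrite -EB; exact: (functor_sigmam HF).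
  - apply: (etrans _ (flip_deltap BN)); rewrite -EB; exact: (functor_deltap HF).
  - apply: (etrans _ (flip_deltam BN)); rewrite -EB; exact: (functor_deltam HF).
split.
  by split; [exact: same_Lp FN | exact: same_Lm FN | exact: same_d' FN
    | exact: same_c' FN].
do 2![split=> //] => n; split.
- apply: (etrans (functor_bub_ap k z t HF M n)).
  rewrite (same_bub_ap z t FN); exact: flip_bub_ap.
- apply: (etrans (functor_bub_am k z t HF M n)).
  rewrite (same_bub_am z t FN); exact: flip_bub_am.
- apply: (etrans (functor_bub_bp k z t HF M n)).
  rewrite (same_bub_bp z t FN); exact: flip_bub_bp.
- apply: (etrans (functor_bub_bm k z t HF M n)).
  rewrite (same_bub_bm z t FN); exact: flip_bub_bm.
Qed.
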